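(* Let $(X_k)$ be an ergodic Markov chain satisfying the $m$-step minorization condition stated in the context, and consider the split chain built on its $m$-skeleton. Let $n$ be a positive integer with $m\mid n$, let $x\in\mathcal{X}$, $\alpha\in(0,1]$, and let $f\colon\mathcal{X}\to\mathbb{R}$ be measurable with $\int f\,d\pi=0$ and such that $$\mathbf{a}=\Big\|\sum_{i=0}^{\sigma(0)}|Z_i(f)|\Big\|_{\psi_\alpha,\bar{\mathbf{P}}_{x^*}},\quad \mathbf{b}=\Big\|\sum_{i=0}^{\sigma(0)}|Z_i(f)|\Big\|_{\psi_\alpha,\bar{\mathbf{P}}_{\pi^*}},\quad \mathbf{c}=\|s_0(f)\|_{\psi_\alpha,\bar{\mathbf{P}}}$$ are finite. Set $M=\mathbf{c}\,(3\alpha^{-2}\log(n/m))^{1/\alpha}$ and $\varsigma^2=\bar{\mathbf{E}}\,s_0(f)^2$. Then for all $t\ge0$, $$\begin{aligned}\mathbf{P}_x\Big(\Big|\sum_{i=0}^{n-1}f(X_i)\Big|>3t\Big)\le{}&2\exp\Big(-\frac{t^\alpha}{\mathbf{a}^\alpha}\Big)+2\pi^*(\theta)^{-1}\exp\Big(-\frac{t^\alpha}{\mathbf{b}^\alpha}\Big)+2e^8\exp\Big(-\frac{t^\alpha}{2(4\mathbf{c})^\alpha}\Big)\\&+4\exp\Big(-\frac{t^2}{32\big(\lceil n/(2m)\rceil\varsigma^2+Mt/6\big)}\Big).\end{aligned}$$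
   Context: Chain: $(X_k)_{k\ge0}$ is a time-homogeneous Harris ergodic Markov chain on $(\mathcal{X},\mathcal{B})$ ($\mathcal{B}$ countably generated) with kernel $P$ and invariant probability measure $\pi$; $\mathbf{P}_x$ is its law started at $x$. Minorization: there are $C\in\mathcal{B}$, $\pi(C)>0$, a probability measure $\nu$ with $\nu(C)>0$, $\delta\in(0,1]$ and an integer $m\ge1$ with $P^m(x,B)\ge\delta\nu(B)$ for $x\in C$, $B\in\mathcal{B}$. Split chain: on an enlarged probability space one adds variables $Y_k\in\{0,1\}$, $k\ge0$, such that, conditionally on $\sigma(X_i,i\le km)$, $\sigma(Y_i,i\le k-1)$ and $X_{km}=x$, $$\bar{\mathbf{P}}(Y_k=1,X_{km+1}\in dx_1,\dots,X_{(k+1)m}\in dx_m)=1_C(x)\frac{\delta\nu(dx_m)}{P^m(x,dx_m)}P(x,dx_1)\cdots P(x_{m-1},dx_m),$$ and $\bar{\mathbf{P}}(Y_k=0,\dots)$ is the same with the factor $1_C(x)\frac{\delta\nu(dx_m)}{P^m(x,dx_m)}$ replaced by $1-1_C(x)\frac{\delta\nu(dx_m)}{P^m(x,dx_m)}$. For a probability $\mu$ on $\mathcal{X}$ let $\mu^*$ on $\mathcal{X}\times\{0,1\}$ be $\mu^*(A\times\{1\})=\delta\mu(A\cap C)$, $\mu^*(A\times\{0\})=(1-\delta)\mu(A\cap C)+\mu(A\cap C^c)$; $\bar{\mathbf{P}}_{\mu^*}$ is the law when $(X_0,Y_0)\sim\mu^*$ (under it $X$ has law $\mathbf{P}_\mu$),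 and $\bar{\mathbf{P}}_{x^*}=\bar{\mathbf{P}}_{\delta_x^*}$. Put $\theta=C\times\{1\}$, so $\pi^*(\theta)=\delta\pi(C)$. $\sigma(0)=\min\{k\ge0:Y_k=1\}$, $\sigma(i)=\min\{k>\sigma(i-1):Y_k=1\}$; $Z_j(f)=\sum_{k=0}^{m-1}f(X_{jm+k})$; $s_i(f)=\sum_{j=\sigma(i)+1}^{\sigma(i+1)}Z_j(f)$. The law of $s_i(f)$ depends neither on $i$ nor on the initial distribution. Orlicz norm: $\|Y\|_{\psi_\alpha,\mu}=\inf\{c>0:\mathbf{E}_\mu\exp(|Y|^\alpha/c^\alpha)\le2\}$. Convention: $\log u$ in the definition of $M$ means $\log(\max(u,e))$. *)

(* Defs.v *)
From HB Require Import structures.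
From mathcomp Require Import all_boot all_order all_algebra.
From mathcomp Require Import all_classical all_reals all_analysis.
Import Order.TTheory GRing.Theory Num.Theory.
Import numFieldNormedType.Exports.

Set Implicit Arguments.
Unset Strict Implicit.
Unset Printing Implicit Defensive.

Local Open Scope classical_set_scope.
Local Open Scope ring_scope.
Local Open Scope ereal_scope.

Definition countably_generated d (T : measurableType d) : Prop :=
  exists G : set (set T), countable G /\ @measurable d T = <<s G >>.

Section kernel_powers.
Context d (T : measurableType d) (R : realType) (P : R.-pker T ~> T).

Fixpoint kpow (n : nat) : R.-spker T ~> T :=
  if n is n'.+1 then mkcomp_noparam P (kpow n')
  else kdirac (@measurable_id d T setT).

(* path_int B g j x is
     \int_(x_1 in B 0) P(x, dx_1) ... \int_(x_j in B j.-1) P(x_j.-1, dx_j) g(x_j)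
   (and g x when j = 0). *)
Fixpoint path_int (B : nat -> set T) (g : T -> \bar R) (j : nat) (x : T) :
    \bar R :=
  if j is j'.+1 then
    \int[P x]_(y in B 0%N) path_int (fun i => B i.+1) g j' y
  else g x.

Definition invariant_law (pi : probability T R) : Prop :=
  forall A, measurable A -> \int[pi]_x P x A = pi A.

Definition irreducible (pi : probability T R) : Prop :=
  forall A, measurable A -> 0 < pi A ->
  forall x, exists n : nat, (0 < n)%N /\ 0 < kpow n x A.

Definition aperiodic (pi : probability T R) : Prop :=
  ~ exists (p : nat) (E : nat -> set T),
      [/\ (2 <= p)%N,
          forall i, measurable (E i),
          trivIset [set i | (i < p)%N] E,
          forall i x, (i < p)%N -> E i x -> P x (E (i.+1 %% p)%N) = 1
        & 0 < pi (E 0%N)].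

Definition minorization (m : nat) (C : set T) (delta : R)
    (nu : probability T R) : Prop :=
  forall x B, C x -> measurable B -> delta%:E * nu B <= kpow m x B.

(* r x is a version of the density of delta * nu with respect to P^m(x, .)
   for x in C; joint measurability is what makes the split kernel a kernel
   (such versions exist because the sigma-algebra is countably generated).
   The values of r outside C play no role. *)
Definition minorization_density (m : nat) (C : set T) (delta : R)
    (nu : probability T R) (r : T -> T -> R) : Prop :=
  [/\ measurable_fun setT (fun z : T * T => r z.1 z.2),
      forall x y, (0 <= r x y)%R
    & forall x B, C x -> measurable B ->
        \int[kpow m x]_(y in B) (r x y)%:E = delta%:E * nu B].

End kernel_powers.

Section chains.
Context d (T : measurableType d) (R : realType) (P : R.-pker T ~> T).
Context d' (Omega : measurableType d').

Definition history (X : nat -> Omega -> T) (n : nat) : set (set Omega) :=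
  <<s [set E | exists i A, [/\ (i <= n)%N, measurable A & E = X i @^-1` A]] >>.

Definition markov_chain (Pr : probability Omega R) (mu : probability T R)
    (X : nat -> Omega -> T) : Prop :=
  [/\ forall i, measurable_fun setT (X i),
      forall A, measurable A -> Pr (X 0%N @^-1` A) = mu A
    & forall n E A, history X n E -> measurable A ->
        Pr (E `&` X n.+1 @^-1` A) = \int[Pr]_(w in E) P (X n w) A].

Definition harris_recurrent (pi : probability T R)
    (Px : T -> probability Omega R) (X : nat -> Omega -> T) : Prop :=
  forall A, measurable A -> 0 < pi A -> forall x,
    Px x [set w | forall N : nat, exists n : nat, (N <= n)%N /\ A (X n w)] = 1.

Definition harris_ergodic (pi : probability T R)
    (Px : T -> probability Omega R) (X : nat -> Omega -> T) : Prop :=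
  [/\ invariant_law P pi, irreducible P pi, aperiodic P pi
    & harris_recurrent pi Px X].

(* mu^* , as a set function on T * bool (true standing for 1) *)
Definition split_law (C : set T) (delta : R) (mu : probability T R)
    (A : set (T * bool)) : \bar R :=
  let A1 := [set x | A (x, true)] in
  let A0 := [set x | A (x, false)] in
  delta%:E * mu (A1 `&` C)
  + ((1 - delta)%:E * mu (A0 `&` C) + mu (A0 `&` ~` C)).

Definition split_atom (C : set T) : set (T * bool) := C `*` [set true].

Definition split_weight (C : set T) (r : T -> T -> R) (b : bool) (x y : T) : R :=
  let p := (\1_C x * r x y)%R in if b then p else (1 - p)%R.

Definition split_history (m : nat) (X : nat -> Omega -> T)
    (Y : nat -> Omega -> bool) (k : nat) : set (set Omega) :=
  <<s [set E | exists i A,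
               [/\ (i <= k * m)%N, measurable A & E = X i @^-1` A]]
      `|` [set E | exists i b, (i < k)%N /\ E = Y i @^-1` [set b]] >>.

(* The last clause is the conditional law of (Y_k, X_(km+1), ..., X_((k+1)m))
   given the past, integrated over past events and tested on rectangles
   B 0 x ... x B m.-1. *)
Definition split_chain (m : nat) (C : set T) (delta : R) (r : T -> T -> R)
    (Pr : probability Omega R) (mu : probability T R)
    (X : nat -> Omega -> T) (Y : nat -> Omega -> bool) : Prop :=
  [/\ forall i, measurable_fun setT (X i),
      forall i, measurable_fun setT (Y i),
      forall A, measurable A ->
        Pr [set w | A (X 0%N w, Y 0%N w)] = split_law C delta mu A
    & forall k b E (B : nat -> set T),
        split_history m X Y k E -> (forall j, measurable (B j)) ->
        Pr (E `&` [set w | Y k w = b /\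
                           forall j, (j < m)%N -> B j (X (k * m + j.+1)%N w)])
        = \int[Pr]_(w in E)
            path_int P B
              (fun y => (split_weight C r b (X (k * m)%N w) y)%:E)
              m (X (k * m)%N w)].

End chains.

(* None stands for +oo, the minimum of the empty set. *)
Definition next_one (y : nat -> bool) (l : nat) : option nat :=
  if pselect (exists k, (l <= k)%N && y k) is left h then Some (ex_minn h)
  else None.

Fixpoint sigma_time (y : nat -> bool) (i : nat) : option nat :=
  if i is i'.+1 then obind (fun k => next_one y k.+1) (sigma_time y i')
  else next_one y 0.

Section additive_functionals.
Context d (T : measurableType d) (R : realType).
Context d' (Omega : measurableType d').
Variables (m : nat) (f : T -> R).
Variables (X : nat -> Omega -> T) (Y : nat -> Omega -> bool).

Definition Zblock (j : nat) (w : Omega) : R :=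
  (\sum_(k < m) f (X (j * m + k)%N w))%R.

Definition sigma (i : nat) (w : Omega) : option nat :=
  sigma_time (fun k => Y k w) i.

(* \sum_(0 <= i <= sigma 0) |Z_i(f)|, possibly infinite when sigma 0 = +oo *)
Definition abs_first_sum (w : Omega) : \bar R :=
  if sigma 0 w is Some k then \sum_(0 <= i < k.+1) `|Zblock i w|%:E
  else \sum_(0 <= i <oo) `|Zblock i w|%:E.

(* The junk value 0 is only taken when sigma i or sigma i.+1 is infinite, a null
   event for the chains considered. *)
Definition sblock (i : nat) (w : Omega) : R :=
  match sigma i w, sigma i.+1 w with
  | Some k, Some l => (\sum_(k.+1 <= j < l.+1) Zblock j w)%R
  | _, _ => 0%R
  end.

End additive_functionals.

(* \bar R-valued, so that it is +oo when no c is admissible *)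
Definition orlicz_norm d (Omega : measurableType d) (R : realType)
    (Pr : probability Omega R) (alpha : R) (Z : Omega -> \bar R) : \bar R :=
  ereal_inf [set c%:E | c in [set c : R | (0 < c)%R /\
    \int[Pr]_w expeR ((`|Z w| `^ alpha) / (c `^ alpha)%:E) <= 2%:E]].

(* Main.v *)
(* With N = n / m and D_k the sum of the Z_j from k up to the first j >= k with
   Y_j = 1, one has Z_k = D_k - D_(k+1) + Y_k D_(k+1), so that
     sum_(k < N) Z_k = D_0 - D_N + sum_(i < #{k < N : Y_k = 1}) s_i.
   D_0 is at most the sum of the |Z_i| up to sigma(0).  On {sigma(0) < N}, D_N is
   a block taken a fixed number of steps after an earlier regeneration; comparing
   with the stationary chain, which regenerates at time 0 with probability
   pi^*(theta), bounds its tail by that of D_0 under the invariant law.  The same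
   identity under the invariant law gives E s_i = 0.  Each s_i is independent of
   the s_j with j + 2 <= i, so the sums over even and over odd indices are random
   walks; each is truncated at M, the bounded part being handled by Bernstein's
   inequality and the rest by its exponential moment, and both through the maximal
   inequality for exponential supermartingales, since the number of summands is
   random.
   That regenerations occur almost surely for every initial law is proved by
   following the zero set of the probability of never regenerating along the
   m-skeleton: aperiodicity forces a subset of positive pi-measure of it to be
   absorbing, and Harris recurrence does the rest. *)

Require Import Defs.
From HB Require Import structures.
From mathcomp Require Import all_boot all_order all_algebra.
From mathcomp Require Import all_classical all_reals all_analysis.
From mathcomp Require Import measurable_realfun zify ring lra.
Import Order.TTheory GRing.Theory Num.Theory.
Import numFieldNormedType.Exports.

Set Implicit Arguments.
Unset Strict Implicit.
Unset Printing Implicit Defensive.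

Local Open Scope classical_set_scope.
Local Open Scope ring_scope.
Local Open Scope ereal_scope.

(** * Integrals along paths of a kernel *)

Section nonneg_induction.
Context d (T : measurableType d) (R : realType).

Import HBNNSimple.

Lemma ge0_fun_ind (Q : (T -> \bar R) -> Prop) :
  (forall A, measurable A -> Q (fun x => (\1_A x)%:E)) ->
  (forall (k : R) (f : T -> \bar R), (0 <= k)%R -> (forall x, 0 <= f x) ->
    measurable_fun setT f -> Q f -> Q (fun x => k%:E * f x)) ->
  (forall f g : T -> \bar R, (forall x, 0 <= f x) -> measurable_fun setT f ->
    (forall x, 0 <= g x) -> measurable_fun setT g ->
    Q f -> Q g -> Q (fun x => f x + g x)) ->
  (forall f : nat -> T -> \bar R, (forall n x, 0 <= f n x) ->
    (forall n, measurable_fun setT (f n)) ->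
    (forall x, nondecreasing_seq (f ^~ x)) ->
    (forall n, Q (f n)) -> Q (fun x => limn (f ^~ x))) ->
  forall f : T -> \bar R, (forall x, 0 <= f x) -> measurable_fun setT f -> Q f.
Proof.
move=> Q1 QZ QD Ql f f0 mf.
pose h := nnsfun_approx measurableT mf.
have hf : f = fun x => limn (fun n => (h n x)%:E).
  apply/funext => x; apply/esym/cvg_lim => //.
  exact: (cvg_nnsfun_approx measurableT mf (fun t _ => f0 t)).
rewrite hf; apply: (Ql (fun n x => (h n x)%:E)).
- by move=> n x; rewrite lee_fin.
- by move=> n; exact/measurable_EFinP.
- move=> x n1 n2 n12; rewrite lee_fin.
  by have /lefP := nd_nnsfun_approx measurableT mf n12; exact.
move=> n; pose g := h n.
have gE : (fun x => (h n x)%:E) = fun x => \sum_(y <- finmap.enum_fset (fset_set (range g)))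
    (y%:E * (\1_(g @^-1` [set y]) x)%:E).
  apply/funext => x; rewrite /= (fimfunE g x) fsbig_finite//=.
  by rewrite -sumEFin; apply: eq_bigr => y _; rewrite EFinM.
rewrite gE.
have : {in finmap.enum_fset (fset_set (range g)), forall y : R, (0 <= y)%R}.
  by move=> y; rewrite (in_fset_set (fimfunP g)) inE => -[x _ <-]; exact: fun_ge0.
elim: (finmap.enum_fset (fset_set (range g))) => [|y s ih] sP.
  rewrite (_ : (fun x => _) = fun x => 0 * (\1_(@set0 T) x)%:E).
    apply: QZ => //; last exact: Q1.
    exact/measurable_EFinP.
  by apply/funext => x; rewrite big_nil mul0e.
have mi (z : R) : measurable_fun setT (fun x => (\1_(g @^-1` [set z]) x)%:E).
  exact/measurable_EFinP.
rewrite (_ : (fun x => _) = fun x => y%:E * (\1_(g @^-1` [set y]) x)%:E +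
  \sum_(y <- s) (y%:E * (\1_(g @^-1` [set y]) x)%:E)); last first.
  by apply/funext => x; rewrite big_cons.
have y0 : (0 <= y)%R by apply: sP; rewrite mem_head.
have s0 : {in s, forall y : R, (0 <= y)%R}.
  by move=> z zs; apply: sP; rewrite inE zs orbT.
apply: QD.
- by move=> x; rewrite mule_ge0// lee_fin.
- exact: measurable_funeM.
- by move=> x; rewrite big_seq sume_ge0// => z zs; rewrite mule_ge0// lee_fin// s0.
- by apply: emeasurable_sum => z; exact: measurable_funeM.
- by apply: QZ => //; exact: Q1.
- exact: ih.
Qed.
End nonneg_induction.

Section integral_restriction.
Context d (T : measurableType d) (R : realType) (mu : {measure set T -> \bar R}).

Lemma integral_in_indic (D : set T) (f : T -> \bar R) :
  \int[mu]_(x in D) f x = \int[mu]_x (f x * (\1_D x)%:E).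
Proof.
rewrite integral_mkcond; apply: eq_integral => x _.
by rewrite patchE indicE; case: (x \in D); rewrite ?mule1 ?mule0.
Qed.

Lemma integral_setI_indic (D A : set T) (f : T -> \bar R) :
  \int[mu]_(x in D `&` A) f x = \int[mu]_(x in D) (f x * (\1_A x)%:E).
Proof.
rewrite [LHS]integral_in_indic [RHS]integral_in_indic.
apply: eq_integral => x _.
by rewrite indicI EFinM /= -muleA [_%:E * (\1_A x)%:E]muleC.
Qed.

End integral_restriction.

Section change_of_law.
Context d1 d2 d3 (O1 : measurableType d1) (O2 : measurableType d2)
  (S : measurableType d3) (R : realType).
Variables (m1 : {measure set O1 -> \bar R}) (m2 : {measure set O2 -> \bar R}).

Lemma integral_eq_law (E : set O1) (V1 : O1 -> S) (V2 : O2 -> S) (q : \bar R) :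
  measurable E -> measurable_fun setT V1 -> measurable_fun setT V2 ->
  0 <= q -> q \is a fin_num ->
  (forall A, measurable A -> m1 (E `&` V1 @^-1` A) = q * m2 (V2 @^-1` A)) ->
  forall phi : S -> \bar R, (forall x, 0 <= phi x) -> measurable_fun setT phi ->
  \int[m1]_(w in E) phi (V1 w) = q * \int[m2]_w phi (V2 w).
Proof.
move=> mE mV1 mV2 q0 qfin h.
have m1f (f : S -> \bar R) : measurable_fun setT f -> measurable_fun E (fun w => f (V1 w)).
  by move=> mf; apply: measurable_funTS; exact: measurableT_comp.
have m2f (f : S -> \bar R) : measurable_fun setT f -> measurable_fun setT (fun w => f (V2 w)).
  by move=> mf; exact: measurableT_comp.
apply: ge0_fun_ind.
- move=> A mA.
  rewrite (_ : (fun w => _) = fun w => (\1_(V1 @^-1` A) w)%:E)//.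
  rewrite [X in q * X](_ : _ = \int[m2]_w (\1_(V2 @^-1` A) w)%:E)//.
  have mA1 : measurable (V1 @^-1` A) by rewrite -[X in measurable X]setTI; exact: mV1.
  have mA2 : measurable (V2 @^-1` A) by rewrite -[X in measurable X]setTI; exact: mV2.
  by rewrite !integral_indic// setIT setIC h.
- move=> k f k0 f0 mf Qf.
  by rewrite !ge0_integralZl ?lee_fin ?Qf 1?muleCA //; [exact: m2f|exact: m1f].
- move=> f g f0 mf g0 mg Qf Qg.
  rewrite ge0_integralD ?Qf ?Qg//; [|exact: m1f|exact: m1f].
  rewrite ge0_integralD//; [|exact: m2f|exact: m2f].
  by rewrite -ge0_muleDr ?integral_ge0. 
- move=> f f0 mf ndf Qf.
  rewrite (@monotone_convergence _ _ _ m1 E mE (fun n w => f n (V1 w)))//; last first.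
    by move=> n; exact: m1f.
  have := @cvg_monotone_convergence _ _ _ m2 _ measurableT (fun n w => f n (V2 w))
    (fun n => m2f _ (mf n)) (fun n w _ => f0 n (V2 w)) (fun w _ => ndf (V2 w)).
  move=> /(cvgeZl qfin) cf.
  by apply/cvg_lim => //; under eq_fun do rewrite Qf.
Qed.

End change_of_law.

Section path_integrals.
Context d (T : measurableType d) (R : realType) (P : R.-pker T ~> T).

Lemma measurable_kernel_integral d' (S : measurableType d') (A : set T)
    (F : S * T -> \bar R) : measurable A -> measurable_fun setT F ->
  measurable_fun setT (fun z : S * T => \int[P z.2]_(y in A) F (z.1, y)).
Proof.
move=> mA mF.
have ge0_case (G : S * T -> \bar R) : (forall z, 0 <= G z) -> measurable_fun setT G ->
    measurable_fun setT (fun z : S * T => \int[P z.2]_(y in A) G (z.1, y)).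
  move=> G0 mG.
  under eq_fun do rewrite integral_in_indic.
  have := @measurable_fun_integral_sfinite_kernel _ _ (S * T)%type T R
    (fun u => G (u.1.1, u.2) * (\1_A u.2)%:E) (kernel.kernel_snd P).
  apply.
    by move=> u; rewrite mule_ge0.
  apply: emeasurable_funM.
    apply: measurableT_comp => //; apply: measurable_fun_pair => //.
    exact: measurableT_comp.
  by apply/measurable_EFinP; exact: measurableT_comp.
rewrite (_ : (fun z => _) = (fun z : S * T => \int[P z.2]_(y in A) (F^\+ (z.1, y))
    - \int[P z.2]_(y in A) (F^\- (z.1, y)))); last first.
  apply/funext => z; rewrite [LHS]integralE.
  by congr (_ - _); apply: eq_integral => y _; rewrite ?funeposE ?funenegE.
apply: emeasurable_funB; apply: ge0_case => //.
- exact: measurable_funepos.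
- exact: measurable_funeneg.
Qed.

Lemma measurable_path_int_param d' (S : measurableType d') (B : nat -> set T)
    (g : S * T -> \bar R) j :
  (forall i, measurable (B i)) -> measurable_fun setT g ->
  measurable_fun setT (fun z : S * T => path_int P B (fun y => g (z.1, y)) j z.2).
Proof.
elim: j B => [|j ih] B mB mg /=.
  by rewrite (_ : (fun z => _) = g)//; apply/funext => -[].
exact: (measurable_kernel_integral (mB 0%N) (ih _ (fun i => mB i.+1) mg)).
Qed.

Lemma measurable_path_int (B : nat -> set T) (g : T -> \bar R) j :
  (forall i, measurable (B i)) -> measurable_fun setT g ->
  measurable_fun setT (path_int P B g j).
Proof.
move=> mB mg.
have mg' : measurable_fun setT (fun z : T * T => g z.2) by exact: measurableT_comp.
have := measurable_path_int_param j mB mg'.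
move=> /(measurable_fun_pair2 point); exact.
Qed.

Lemma path_int_ge0 (B : nat -> set T) (g : T -> \bar R) j x :
  (forall y, 0 <= g y) -> 0 <= path_int P B g j x.
Proof.
by move=> g0; elim: j B x => [|j ih] B x //=; apply: integral_ge0 => y _; exact: ih.
Qed.

Lemma path_int_eq (B B' : nat -> set T) (g g' : T -> \bar R) j x :
  (forall i, (i < j)%N -> B i = B' i) -> g =1 g' ->
  path_int P B g j x = path_int P B' g' j x.
Proof.
move=> BB gg; elim: j B B' x BB => [|j ih] B B' x BB //=.
by rewrite BB//; apply: eq_integral => y _; apply: ih => i ij; exact: BB.
Qed.

Lemma path_int_add (B : nat -> set T) (g : T -> \bar R) i j x :
  path_int P B g (i + j) x = path_int P B (path_int P (fun k => B (i + k)%N) g j) i x.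
Proof.
elim: i B x => [|i ih] B x //=.
by apply: eq_integral => y _; rewrite ih; apply: path_int_eq.
Qed.

Lemma path_intZ (B : nat -> set T) (k : R) (g : T -> \bar R) j x :
  (0 <= k)%R -> (forall i, measurable (B i)) ->
  (forall y, 0 <= g y) -> measurable_fun setT g ->
  path_int P B (fun y => k%:E * g y) j x = k%:E * path_int P B g j x.
Proof.
move=> k0 mB g0 mg; elim: j B x mB => [|j ih] B x mB //=.
under eq_integral do rewrite ih//.
rewrite ge0_integralZl//.
- apply: measurable_funTS; exact: measurable_path_int.
- by move=> y _; exact: path_int_ge0.
Qed.

Lemma path_intD (B : nat -> set T) (f g : T -> \bar R) j x :
  (forall i, measurable (B i)) ->
  (forall y, 0 <= f y) -> measurable_fun setT f ->
  (forall y, 0 <= g y) -> measurable_fun setT g ->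
  path_int P B (fun y => f y + g y) j x = path_int P B f j x + path_int P B g j x.
Proof.
move=> mB f0 mf g0 mg; elim: j B x mB => [|j ih] B x mB //=.
under eq_integral do rewrite ih//.
rewrite ge0_integralD//.
- by move=> y _; exact: path_int_ge0.
- apply: measurable_funTS; exact: measurable_path_int.
- by move=> y _; exact: path_int_ge0.
- apply: measurable_funTS; exact: measurable_path_int.
Qed.

Lemma le_path_int (B : nat -> set T) (f g : T -> \bar R) j x :
  (forall i, measurable (B i)) ->
  (forall y, 0 <= f y) -> measurable_fun setT f -> measurable_fun setT g ->
  (forall y, f y <= g y) -> path_int P B f j x <= path_int P B g j x.
Proof.
move=> mB f0 mf mg fg; elim: j B x mB => [|j ih] B x mB //=.
apply: ge0_le_integral => //.
- by move=> y _; exact: path_int_ge0.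
- apply: measurable_funTS; exact: measurable_path_int.
- apply: measurable_funTS; exact: measurable_path_int.
- by move=> y _; exact: ih.
Qed.

Lemma path_int_monotone_cvg (B : nat -> set T) (f : nat -> T -> \bar R) j x :
  (forall i, measurable (B i)) ->
  (forall n y, 0 <= f n y) -> (forall n, measurable_fun setT (f n)) ->
  (forall y, nondecreasing_seq (f ^~ y)) ->
  path_int P B (fun y => limn (f ^~ y)) j x = limn (fun n => path_int P B (f n) j x).
Proof.
move=> mB f0 mf ndf; elim: j B x mB => [|j ih] B x mB //=.
under eq_integral do rewrite ih//.
rewrite monotone_convergence//.
- by move=> n; apply: measurable_funTS; exact: measurable_path_int.
- by move=> n y _; exact: path_int_ge0.
- by move=> y _ n1 n2 n12; apply: le_path_int => // z; exact: ndf.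
Qed.

Lemma path_int_kpow (A : set T) j x : measurable A ->
  path_int P (fun=> setT) (fun y => (\1_A y)%:E) j x = kpow P j x A.
Proof.
move=> mA; elim: j x => [|j ih] x //=.
by apply: eq_integral => y _; rewrite ih.
Qed.

Lemma integral_kpow (g : T -> \bar R) j x : (forall y, 0 <= g y) ->
  measurable_fun setT g ->
  path_int P (fun=> setT) g j x = \int[kpow P j x]_y g y.
Proof.
move: g; apply: ge0_fun_ind.
- by move=> A mA; rewrite path_int_kpow// integral_indic// setIT.
- by move=> k f k0 f0 mf Qf; rewrite path_intZ// Qf ge0_integralZl.
- by move=> f g f0 mf g0 mg Qf Qg; rewrite path_intD// Qf Qg ge0_integralD.
- move=> f f0 mf ndf Qf; rewrite path_int_monotone_cvg// monotone_convergence//.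
  by congr (limn _); apply/funext => n; exact: Qf.
Qed.

Lemma path_int_setI (B : nat -> set T) (A : set T) (g : T -> \bar R) j x :
  path_int P (fun i => if i == j then B i `&` A else B i) g j.+1 x =
  path_int P B (fun y => g y * (\1_A y)%:E) j.+1 x.
Proof.
elim: j B x => [|j ih] B x /=; first by rewrite integral_setI_indic.
by apply: eq_integral => y _; exact: (ih (fun i => B i.+1)).
Qed.

Lemma path_int_ae_eq (B : nat -> set T) (g g' : T -> \bar R) (N : set T) j x :
  (forall i, measurable (B i)) -> measurable_fun setT g -> measurable_fun setT g' ->
  measurable N -> kpow P j x N = 0 -> (forall y, ~ N y -> g y = g' y) ->
  path_int P B g j x = path_int P B g' j x.
Proof.
move=> mB mg mg' mN + gg; elim: j B x mB => [|j ih] B x mB /=.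
  rewrite /kdirac diracE => N0; apply: gg => Nx.
  by move: N0; rewrite mem_set//= => /eqP; rewrite onee_eq0.
move=> N0; apply: ae_eq_integral => //.
- by apply: measurable_funTS; exact: measurable_path_int.
- by apply: measurable_funTS; exact: measurable_path_int.
have : ae_eq (P x) setT (fun y => kpow P j y N) (cst 0).
  apply/ae_eq_integral_abs => //; first exact: measurable_kernel.
  by under eq_integral do rewrite gee0_abs//.
apply: filterS => y /(_ Logic.I) N0y By.
exact: ih.
Qed.

Lemma kpow_setT j x : kpow P j x setT = 1.
Proof.
elim: j x => [|j ih] x /=; first by rewrite /kdirac diracT.
rewrite /kcomp_noparam; under eq_integral do rewrite ih.
by rewrite integral_cst// mul1e prob_kernel.
Qed.

Lemma integral_kpow_add (g : T -> \bar R) i j x : (forall y, 0 <= g y) ->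
  measurable_fun setT g ->
  \int[kpow P (i + j) x]_y g y = \int[kpow P i x]_y \int[kpow P j y]_z g z.
Proof.
move=> g0 mg; rewrite -!integral_kpow//.
- by rewrite path_int_add; apply: path_int_eq => // y; rewrite integral_kpow.
- by move=> y; exact: integral_ge0.
- under eq_fun do rewrite -integral_kpow//.
  exact: measurable_path_int.
Qed.

End path_integrals.

Section sigma_algebra_closure.
Context (U : pointedType) (G : set (set U)).

Lemma sigma_algebraI (A B : set U) : <<s G >> A -> <<s G >> B -> <<s G >> (A `&` B).
Proof. exact: (@measurableI _ (g_sigma_algebraType G)). Qed.

Lemma sigma_algebraU (A B : set U) : <<s G >> A -> <<s G >> B -> <<s G >> (A `|` B).
Proof. exact: (@measurableU _ (g_sigma_algebraType G)). Qed.


Lemma sigma_algebraT : <<s G >> setT.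
Proof. exact: (@measurableT _ (g_sigma_algebraType G)). Qed.

Lemma sigma_algebra_forall_lt (n : nat) (A : nat -> set U) :
  (forall i, (i < n)%N -> <<s G >> (A i)) -> <<s G >> [set u | forall i, (i < n)%N -> A i u].
Proof.
elim: n A => [|n ih] A hA.
  rewrite (_ : [set _ | _] = setT); first exact: sigma_algebraT.
  by apply/seteqP; split.
rewrite (_ : [set _ | _] = [set u | forall i, (i < n)%N -> A i u] `&` A n).
  by apply: sigma_algebraI; [apply: ih => i in_; apply: hA; exact: ltnW|exact: hA].
apply/seteqP; split => u /=.
  by move=> h; split; [move=> i ni; apply: h; exact: ltnW|exact: h].
by move=> [h hn] i; rewrite ltnS leq_eqVlt => /predU1P[->//|]; exact: h.
Qed.

End sigma_algebra_closure.

Section truncated_density.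
Context d (T : measurableType d) (R : realType) (P : R.-pker T ~> T).
Variables (m : nat) (C : set T) (delta : R) (nu : probability T R) (r : T -> T -> R).
Hypothesis Pmin : minorization P m C delta nu.
Hypothesis rden : minorization_density P m C delta nu r.

Lemma density_le1_ae x : C x -> kpow P m x [set y | (1 < r x y)%R] = 0.
Proof.
move=> Cx; have [mr r0 rE] := rden.
have mrx : measurable_fun setT (r x).
  exact: (measurable_fun_pair2 x mr).
set N := [set y | _].
have mN : measurable N.
  rewrite (_ : N = r x @^-1` `]1%R, +oo[%classic).
    by rewrite -[X in measurable X]setTI; exact: mrx.
  by apply/seteqP; split => y /=; rewrite in_itv/= andbT.
have kfin : kpow P m x N \is a fin_num.
  rewrite ge0_fin_numE// (@le_lt_trans _ _ 1)// ?ltry//.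
  by rewrite -(kpow_setT P m x); apply: le_measure; rewrite ?inE.
have h0 y : N y -> 0 <= (r x y - 1)%:E.
  by move=> Ny; rewrite lee_fin subr_ge0 ltW.
have mh : measurable_fun N (fun y => (r x y - 1)%:E).
  apply/measurable_EFinP; apply: measurable_funTS.
  exact: measurable_funB.
have : \int[kpow P m x]_(y in N) (r x y - 1)%:E <= 0.
  have := Pmin Cx mN; rewrite -(rE x N Cx mN).
  rewrite (eq_integral (fun y => (r x y - 1)%:E + cst 1 y)); last first.
    by move=> y _ /=; rewrite -EFinD subrK.
  rewrite ge0_integralD// integral_cst// mul1e.
  by rewrite -leeBrDr// subee.
move=> hle; have : \int[kpow P m x]_(y in N) `|(r x y - 1)%:E| = 0.
  apply/eqP; rewrite eq_le integral_ge0 ?andbT//.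
  rewrite (le_trans _ hle)// le_eqVlt; apply/orP; left; apply/eqP.
  by apply: eq_integral => y; rewrite inE => Ny; rewrite gee0_abs// h0.
move=> /(ae_eq_integral_abs _ mN mh)[N' [mN' N'0 NN']].
apply/eqP; rewrite eq_le measure_ge0 andbT -N'0; apply: le_measure; rewrite ?inE//.
move=> y Ny; apply: NN' => /= /(_ Ny) []; apply/eqP.
by rewrite gt_eqF// subr_gt0.
Qed.

(* Where r exceeds 1 it does so only on P^m(x, .)-null sets, by the minorization;
   capping it makes both split weights nonnegative everywhere. *)
Definition density1 x y : R := Num.min (r x y) 1%R.

Lemma density1_ge0_le1 x y : (0 <= density1 x y <= 1)%R.
Proof.
have [_ r0 _] := rden.
by rewrite /density1 le_min r0 ler01/= ge_min lexx orbT.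
Qed.

Lemma measurable_density1 : measurable_fun setT (fun z : T * T => density1 z.1 z.2).
Proof. by have [mr _ _] := rden; exact: measurable_minr. Qed.

Lemma density1_outside x y : ~ (1 < r x y)%R -> r x y = density1 x y.
Proof.
by move=> /negP; rewrite -leNgt => r1; rewrite /density1; apply/esym/min_l.
Qed.

Lemma measurable_density_above x : measurable [set y | (1 < r x y)%R].
Proof.
have [mr _ _] := rden.
rewrite (_ : [set _ | _] = r x @^-1` `]1%R, +oo[%classic).
  by rewrite -[X in measurable X]setTI; exact: (measurable_fun_pair2 x mr).
by apply/seteqP; split => y /=; rewrite in_itv/= andbT.
Qed.

Lemma density1_minorization_density : minorization_density P m C delta nu density1.
Proof.
have [mr r0 rE] := rden.
split; first exact: measurable_density1.
  by move=> x y; have /andP[] := density1_ge0_le1 x y.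
move=> x B Cx mB; rewrite -(rE x)//; apply: ae_eq_integral => //.
- apply/measurable_EFinP; apply: measurable_funTS.
  exact: (measurable_fun_pair2 x measurable_density1).
- apply/measurable_EFinP; apply: measurable_funTS.
  exact: (measurable_fun_pair2 x mr).
exists [set y | (1 < r x y)%R]; split => //.
- exact: measurable_density_above.
- exact: density_le1_ae.
- by move=> y /= h; apply/negP => h2; apply: h => _; rewrite -density1_outside//; apply/negP.
Qed.

Lemma measurable_split_weight (r' : T -> T -> R) b x :
  measurable_fun setT (fun z : T * T => r' z.1 z.2) ->
  measurable_fun setT (fun y => (split_weight C r' b x y)%:E).
Proof.
move=> mr; apply/measurable_EFinP; rewrite /split_weight.
have mp : measurable_fun setT (fun y => \1_C x * r' x y)%R.
  by apply: measurable_funM => //; exact: (measurable_fun_pair2 x mr).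
by case: b => //; exact: measurable_funB.
Qed.

Lemma split_chain_density1 dO (Omega : measurableType dO) (Pr : probability Omega R)
    (mu : probability T R) (X : nat -> Omega -> T) (Y : nat -> Omega -> bool) :
  split_chain P m C delta r Pr mu X Y -> split_chain P m C delta density1 Pr mu X Y.
Proof.
move=> [mX mY X0 XY]; split => // k b E B HE mB.
rewrite XY//; apply: eq_integral => w _.
have [mr r0 rE] := rden.
have [CX|CX] := pselect (C (X (k * m)%N w)); last first.
  apply: path_int_eq => // y; congr EFin; rewrite /split_weight indicE memNset//.
  by rewrite !mul0r.
apply: (@path_int_ae_eq _ _ _ _ _ _ _ [set y | (1 < r (X (k * m)%N w) y)%R]) => //.
- exact: measurable_split_weight.
- exact: measurable_split_weight measurable_density1.
- exact: measurable_density_above.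
- exact: density_le1_ae.
- by move=> y /= h; rewrite /split_weight density1_outside.
Qed.

End truncated_density.

Section path_space.
Context d (T : measurableType d).

Definition rect (J : nat) (A : nat -> set T) (S : nat -> set bool) :
    set (nat -> T * bool) :=
  [set v | forall i, (i < J)%N -> A i (v i).1 /\ S i (v i).2].

Definition rects : set (set (nat -> T * bool)) :=
  [set G | exists J A S, (forall i, measurable (A i)) /\ G = rect J A S].

End path_space.

Notation pathT T := (g_sigma_algebraType (@rects _ T)).

Section path_space_theory.
Context d (T : measurableType d).

Lemma rect_setI_closed : setI_closed (@rects _ T).
Proof.
move=> _ _ [J [A [S [mA ->]]]] [J' [A' [S' [mA' ->]]]].
exists (maxn J J').
exists (fun i => (if (i < J)%N then A i else setT) `&` (if (i < J')%N then A' i else setT)).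
exists (fun i => (if (i < J)%N then S i else setT) `&` (if (i < J')%N then S' i else setT)).
split; first by move=> i; apply: measurableI; case: ifP.
apply/seteqP; split => v /=.
  move=> [h h'] i iJ; split; split; case: ifPn => // ij.
  - by have [] := h _ ij.
  - by have [] := h' _ ij.
  - by have [] := h _ ij.
  - by have [] := h' _ ij.
move=> h; split=> i iJ.
  by have := h i; rewrite leq_max iJ/= => /(_ isT)[[? _] [? _]].
by have := h i; rewrite leq_max iJ orbT/= => /(_ isT)[[_ ?] [_ ?]].
Qed.

Lemma measurable_rect J (A : nat -> set T) S : (forall i, measurable (A i)) ->
  measurable (rect J A S : set (pathT T)).
Proof. by move=> mA; apply: sub_sigma_algebra; exists J, A, S. Qed.

Lemma measurable_pathX i : measurable_fun setT (fun v : pathT T => (v i).1).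
Proof.
move=> _ A mA; rewrite setTI.
rewrite (_ : _ @^-1` _ = rect i.+1 (fun j => if j == i then A else setT) (fun=> setT)).
  by apply: measurable_rect => j; case: ifP.
apply/seteqP; split => v /=.
  by move=> Av j _; case: eqVneq => // ->.
by move=> /(_ i (ltnSn i)); rewrite eqxx => -[].
Qed.

Lemma measurable_pathY i : measurable_fun setT (fun v : pathT T => (v i).2).
Proof.
move=> _ A mA; rewrite setTI.
rewrite (_ : _ @^-1` _ = rect i.+1 (fun=> setT) (fun j => if j == i then A else setT)).
  exact: measurable_rect.
apply/seteqP; split => v /=.
  by move=> Av j _; case: eqVneq => // ->.
by move=> /(_ i (ltnSn i)); rewrite eqxx => -[].
Qed.

Lemma measurable_fun_path dO (Omega : measurableType dO) (V : Omega -> pathT T) :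
  (forall i, measurable_fun setT (fun w => (V w i).1)) ->
  (forall i, measurable_fun setT (fun w => (V w i).2)) -> measurable_fun setT V.
Proof.
move=> m1 m2; apply: (@measurability _ _ _ _ setT V (@rects _ T)) => //.
move=> _ [_ [J [A [S [mA ->]]]] <-]; rewrite setTI.
rewrite (_ : _ @^-1` _ = [set w | forall i, (i < J)%N ->
  ((fun w => (V w i).1) @^-1` A i `&` (fun w => (V w i).2) @^-1` S i) w])//.
elim: J => [|J ih].
  by rewrite (_ : [set _ | _] = setT)//; apply/seteqP; split.
rewrite (_ : [set _ | _] = [set w | forall i, (i < J)%N ->
  ((fun w => (V w i).1) @^-1` A i `&` (fun w => (V w i).2) @^-1` S i) w] `&`
  ((fun w => (V w J).1) @^-1` A J `&` (fun w => (V w J).2) @^-1` S J)).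
  apply: measurableI => //; apply: measurableI.
    by rewrite -[X in measurable X]setTI; exact: m1.
  by rewrite -[X in measurable X]setTI; exact: m2.
apply/seteqP; split => w /=.
  by move=> h; split; [move=> i iJ; apply: h; exact: ltnW|exact: h].
by move=> [h hJ] i; rewrite ltnS leq_eqVlt => /predU1P[->//|]; exact: h.
Qed.

Lemma path_measure_unique (R : realType) (m1 m2 : {measure set (pathT T) -> \bar R}) :
  m1 setT < +oo ->
  (forall J A S, (forall i, measurable (A i)) -> m1 (rect J A S) = m2 (rect J A S)) ->
  forall G, measurable G -> m1 G = m2 G.
Proof.
move=> fin1 h.
have setTE : setT = rect 0 (fun=> @setT T) (fun=> setT) by apply/seteqP; split.
move=> G mG.
apply: (@g_sigma_algebra_measure_unique _ R (pathT T) (@rects _ T) _ (fun=> setT)) => //.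
- exact: sub_sigma_algebra.
- by move=> _; exists 0%N, (fun=> setT), (fun=> setT).
- by rewrite bigcup_const.
- exact: rect_setI_closed.
- by move=> _ [J [A [S [mA ->]]]]; exact: h.
Qed.

End path_space_theory.

Section transition_extension.
Context d (T : measurableType d) (R : realType) (P : R.-pker T ~> T).
Context dO (Omega : measurableType dO) (Pr : probability Omega R).

Lemma integral_transition (E E' : set Omega) (xi zeta : Omega -> T)
    (w : T -> T -> R) (B : nat -> set T) j :
  measurable E -> measurable E' ->
  measurable_fun setT xi -> measurable_fun setT zeta ->
  (forall x y, 0 <= w x y)%R -> measurable_fun setT (fun z : T * T => w z.1 z.2) ->
  (forall i, measurable (B i)) ->
  (forall A, measurable A -> Pr (E' `&` xi @^-1` A) =
    \int[Pr]_(o in E) path_int P B (fun y => (w (zeta o) y)%:E * (\1_A y)%:E) j (zeta o)) ->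
  forall phi : T -> \bar R, (forall y, 0 <= phi y) -> measurable_fun setT phi ->
  \int[Pr]_(o in E') phi (xi o) =
    \int[Pr]_(o in E) path_int P B (fun y => (w (zeta o) y)%:E * phi y) j (zeta o).
Proof.
move=> mE mE' mxi mzeta w0 mw mB hA.
have mwx x : measurable_fun setT (w x) by exact: (measurable_fun_pair2 x mw).
have mxif (f : T -> \bar R) : measurable_fun setT f -> measurable_fun E' (fun w => f (xi w)).
  by move=> mf; apply: measurable_funTS; exact: measurableT_comp.
have wf0 (f : T -> \bar R) : (forall y, 0 <= f y) -> forall o y, 0 <= (w (zeta o) y)%:E * f y.
  by move=> f0 o y; rewrite mule_ge0// lee_fin.
have mwf (f : T -> \bar R) : measurable_fun setT f ->
    forall o, measurable_fun setT (fun y => (w (zeta o) y)%:E * f y).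
  by move=> mf o; apply: emeasurable_funM => //; exact/measurable_EFinP.
have mpath (f : T -> \bar R) : measurable_fun setT f -> measurable_fun E
    (fun o => path_int P B (fun y => (w (zeta o) y)%:E * f y) j (zeta o)).
  move=> mf; apply: measurable_funTS.
  pose g (z : T * T) := (w z.1 z.2)%:E * f z.2.
  have mg : measurable_fun setT g.
    by apply: emeasurable_funM; [exact/measurable_EFinP|exact: measurableT_comp].
  have mz : measurable_fun setT (fun o => (zeta o, zeta o)) by exact: measurable_fun_pair.
  exact: (measurableT_comp (measurable_path_int_param P j mB mg) mz).
apply: ge0_fun_ind.
- move=> A mA; rewrite -hA//.
  rewrite (_ : (fun o => _) = fun o => (\1_(xi @^-1` A) o)%:E)//.
  by rewrite integral_indic 1?setIC// -[X in measurable X]setTI; exact: mxi.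
- move=> k f k0 f0 mf Qf.
  rewrite ge0_integralZl ?lee_fin ?Qf//; last exact: mxif.
  rewrite -ge0_integralZl ?lee_fin//; [|exact: mpath|by move=> o _; apply: path_int_ge0; exact: wf0].
  apply: eq_integral => o _; rewrite -path_intZ//; [|exact: wf0|exact: mwf].
  by apply: path_int_eq => // y; rewrite muleCA.
- move=> f g f0 mf g0 mg Qf Qg.
  rewrite ge0_integralD ?Qf ?Qg//; [|exact: mxif|exact: mxif].
  rewrite -ge0_integralD//; last 4 first.
  + by move=> o _; apply: path_int_ge0; exact: wf0.
  + exact: mpath.
  + by move=> o _; apply: path_int_ge0; exact: wf0.
  + exact: mpath.
  apply: eq_integral => o _; rewrite -path_intD//; last 4 first.
  + exact: wf0.
  + exact: mwf.
  + exact: wf0.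
  + exact: mwf.
  by apply: path_int_eq => // y; rewrite ge0_muleDr.
- move=> f f0 mf ndf Qf.
  rewrite (@monotone_convergence _ _ _ Pr E' mE' (fun n w => f n (xi w)))//; last first.
    by move=> n; exact: mxif.
  rewrite [RHS](_ : _ = \int[Pr]_(o in E) limn (fun n =>
      path_int P B (fun y => (w (zeta o) y)%:E * f n y) j (zeta o))); last first.
    apply: eq_integral => o _; rewrite -path_int_monotone_cvg//; last 3 first.
    + by move=> n; exact: wf0.
    + by move=> n; exact: mwf.
    + by move=> y n1 n2 n12; rewrite lee_wpmul2l ?lee_fin// ndf.
    apply: path_int_eq => // y; apply/esym/cvg_lim => //.
    apply: cvgeZl => //; apply: ereal_nondecreasing_is_cvgn; exact: ndf.
  rewrite monotone_convergence//; last 3 first.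
  + by move=> n; exact: mpath.
  + by move=> n o _; apply: path_int_ge0; exact: wf0.
  + move=> o _ n1 n2 n12; apply: le_path_int => //.
    * exact: wf0.
    * exact: mwf.
    * exact: mwf.
    * by move=> y; rewrite lee_wpmul2l ?lee_fin// ndf.
  by congr (limn _); apply/funext => n; exact: Qf.
Qed.

End transition_extension.

Section split_histories.
Context d (T : measurableType d) dO (Omega : measurableType dO).
Variables (m : nat) (X : nat -> Omega -> T) (Y : nat -> Omega -> bool).

Lemma split_history_sub k l : (k <= l)%N ->
  split_history m X Y k `<=` split_history m X Y l.
Proof.
move=> kl; apply: sub_sigma_algebra2 => E [[i [A [ik mA ->]]]|[i [b [ik ->]]]].
  by left; exists i, A; split => //; rewrite (leq_trans ik)// leq_mul2r kl orbT.
by right; exists i, b; split => //; exact: leq_trans kl.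
Qed.

Lemma split_historyX k i (A : set T) : (i <= k * m)%N -> measurable A ->
  split_history m X Y k (X i @^-1` A).
Proof. by move=> ik mA; apply: sub_sigma_algebra; left; exists i, A. Qed.

Lemma split_historyY k i (S : set bool) : (i < k)%N ->
  split_history m X Y k (Y i @^-1` S).
Proof.
move=> ik.
have Sb b : split_history m X Y k (Y i @^-1` (S `&` [set b])).
  have [Sb|Sb] := pselect (S b); last first.
    rewrite (_ : S `&` _ = set0) ?preimage_set0; first exact: sigma_algebra0.
    by apply/seteqP; split => // c [Sc cb]; apply: Sb; rewrite -cb.
  rewrite (_ : S `&` _ = [set b]); first by apply: sub_sigma_algebra; right; exists i, b.
  by apply/seteqP; split => [c []//|c ->].
rewrite (_ : S = (S `&` [set true]) `|` (S `&` [set false])).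
  by rewrite preimage_setU; exact: sigma_algebraU (Sb true) (Sb false).
by apply/seteqP; split => [[] Sb'|c [[]//|[]//]]; [left|right].
Qed.

Lemma split_history_measurable k :
  (forall i, measurable_fun setT (X i)) -> (forall i, measurable_fun setT (Y i)) ->
  split_history m X Y k `<=` measurable.
Proof.
move=> mX mY; apply: smallest_sub; first exact: sigma_algebra_measurable.
by move=> E [[i [A [_ mA ->]]]|[i [b [_ ->]]]]; rewrite -[X in measurable X]setTI;
  [exact: mX|exact: mY].
Qed.

End split_histories.

Definition path_from (m : nat) d (T : measurableType d) (Omega : Type)
    (X : nat -> Omega -> T) (Y : nat -> Omega -> bool) (k : nat) (w : Omega) :
    pathT T :=
  fun i => (X (k * m + i)%N w, Y (k + i)%N w).

Section cylinder_probabilities.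
Context d (T : measurableType d) (R : realType) (P : R.-pker T ~> T).
Variables (m : nat) (C : set T) (delta : R) (r : T -> T -> R).
Hypothesis m0 : (0 < m)%N.
Hypothesis mC : measurable C.
Hypothesis mr : measurable_fun setT (fun z : T * T => r z.1 z.2).
Hypothesis r01 : forall x y, (0 <= r x y <= 1)%R.

Lemma split_weight_ge0 b x y : (0 <= split_weight C r b x y)%R.
Proof.
have /andP[r0 r1] := r01 x y.
have p0 : (0 <= \1_C x * r x y)%R by rewrite mulr_ge0.
have p1 : (\1_C x * r x y <= 1)%R.
  by rewrite indicE; case: (x \in C); rewrite ?mul1r// mul0r.
by rewrite /split_weight; case: b; rewrite ?subr_ge0.
Qed.

Definition set_weight (S : set bool) x y : R :=
  (\1_S true * split_weight C r true x y + \1_S false * split_weight C r false x y)%R.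

Lemma set_weight_ge0 S x y : (0 <= set_weight S x y)%R.
Proof. by rewrite addr_ge0// mulr_ge0// split_weight_ge0. Qed.

Lemma set_weight1 b x y : set_weight [set b] x y = split_weight C r b x y.
Proof.
rewrite /set_weight !indicE; case: b.
  by rewrite (@mem_set _ [set true] true)// (@memNset _ [set true] false)// mul1r mul0r addr0.
by rewrite (@mem_set _ [set false] false)// (@memNset _ [set false] true)// mul1r mul0r add0r.
Qed.

Lemma set_weightT x y : set_weight setT x y = 1%R.
Proof. by rewrite /set_weight !indicT !mul1r /split_weight/= addrC subrK. Qed.

Lemma measurable_split_weight2 b :
  measurable_fun setT (fun z : T * T => split_weight C r b z.1 z.2).
Proof.
rewrite /split_weight.
have mp : measurable_fun setT (fun z : T * T => \1_C z.1 * r z.1 z.2)%R.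
  by apply: measurable_funM => //; exact: measurableT_comp.
by case: b => //; exact: measurable_funB.
Qed.

Lemma measurable_set_weight S :
  measurable_fun setT (fun z : T * T => set_weight S z.1 z.2).
Proof.
by apply: measurable_funD; apply: measurable_funM => //; exact: measurable_split_weight2.
Qed.

Fixpoint cyl (J : nat) (A : nat -> set T) (S : nat -> set bool) (x : T) : \bar R :=
  if J is J'.+1 then
    (\1_(A 0%N) x)%:E * path_int P (fun i => A i.+1) (fun y =>
      (set_weight (S 0%N) x y)%:E *
      cyl J' (fun i => A (m + i)%N) (fun j => S j.+1) y) m x
  else (\1_(A 0%N) x)%:E.

Lemma cyl_ge0 J A S x : 0 <= cyl J A S x.
Proof.
elim: J A S x => [|J ih] A S x; rewrite /= ?lee_fin//.
rewrite mule_ge0 ?lee_fin//; apply: path_int_ge0 => y.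
by rewrite mule_ge0// lee_fin set_weight_ge0.
Qed.

Lemma measurable_cyl J A S : (forall i, measurable (A i)) ->
  measurable_fun setT (cyl J A S).
Proof.
elim: J A S => [|J ih] A S mA /=; first exact/measurable_EFinP.
apply: emeasurable_funM; first exact/measurable_EFinP.
pose g (z : T * T) := (set_weight (S 0%N) z.1 z.2)%:E *
  cyl J (fun i => A (m + i)%N) (fun j => S j.+1) z.2.
have mg : measurable_fun setT g.
  apply: emeasurable_funM; first by apply/measurable_EFinP; exact: measurable_set_weight.
  by apply: measurableT_comp => //; exact: ih.
have mz : measurable_fun setT (fun x : T => (x, x)) by exact: measurable_fun_pair.
exact: (measurableT_comp (measurable_path_int_param P m (fun i => mA i.+1) mg) mz).
Qed.

Context dO (Omega : measurableType dO) (Pr : probability Omega R) (mu : probability T R).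
Variables (X : nat -> Omega -> T) (Y : nat -> Omega -> bool).
Hypothesis XY : split_chain P m C delta r Pr mu X Y.

Let mX : forall i, measurable_fun setT (X i). Proof. by case: XY. Qed.
Let mY : forall i, measurable_fun setT (Y i). Proof. by case: XY. Qed.

Lemma split_block_law k (S : set bool) E (B : nat -> set T) :
  split_history m X Y k E -> (forall j, measurable (B j)) ->
  Pr (E `&` [set w | S (Y k w) /\ forall j, (j < m)%N -> B j (X (k * m + j.+1)%N w)])
  = \int[Pr]_(w in E)
     path_int P B (fun y => (set_weight S (X (k * m)%N w) y)%:E) m (X (k * m)%N w).
Proof.
move=> HE mB; have [_ _ _ XYk] := XY.
have mE : measurable E by exact: (split_history_measurable mX mY) HE.
pose F b := [set w | Y k w = b /\ forall j, (j < m)%N -> B j (X (k * m + j.+1)%N w)].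
pose G b := [set w | S b] `&` (E `&` F b) : set Omega.
have HF b : split_history m X Y k.+1 (E `&` F b).
  apply: sigma_algebraI; first exact: split_history_sub (leqnSn k) _ HE.
  rewrite (_ : F b = Y k @^-1` [set b] `&`
    [set w | forall j, (j < m)%N -> (X (k * m + j.+1)%N @^-1` B j) w]); last first.
    by apply/seteqP; split.
  apply: sigma_algebraI; first exact: split_historyY.
  apply: sigma_algebra_forall_lt => j jm; apply: split_historyX => //.
  by rewrite mulSn addnC leq_add2r.
have mF b : measurable (E `&` F b) by exact: (split_history_measurable mX mY) (HF b).
have mG b : measurable (G b).
  rewrite /G; have [Sb|Sb] := pselect (S b).
    rewrite (_ : [set w | S b] = setT) ?setTI//.
    by apply/seteqP; split.
  rewrite (_ : [set w | S b] = set0) ?set0I//.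
  by apply/seteqP; split.
rewrite (_ : E `&` _ = G true `|` G false); last first.
  apply/seteqP; split => w /=.
    by move=> [Ew [+ Bw]]; case Yw: (Y k w) => Sw; [left|right].
  by move=> [] [Sb [Ew [Yw Bw]]]; rewrite Yw.
have -> : Pr (G true `|` G false) = Pr (G true) + Pr (G false).
  apply: measureU => //.
  by apply/seteqP; split => // w [[_ [_ [Yw _]]] [_ [_ [Yw' _]]]]; move: Yw'; rewrite Yw.
have PG b : Pr (G b) = (\1_S b)%:E * \int[Pr]_(w in E)
     path_int P B (fun y => (split_weight C r b (X (k * m)%N w) y)%:E) m (X (k * m)%N w).
  rewrite -XYk//; rewrite /G indicE; have [Sb|Sb] := pselect (S b).
    rewrite mem_set// mul1e (_ : [set w | S b] = setT) ?setTI//.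
    by apply/seteqP; split.
  rewrite memNset// mul0e (_ : [set w | S b] = set0) ?set0I ?measure0//.
  by apply/seteqP; split.
have mpath b : measurable_fun E (fun w =>
    path_int P B (fun y => (split_weight C r b (X (k * m)%N w) y)%:E) m (X (k * m)%N w)).
  apply: measurable_funTS.
  have mg : measurable_fun setT (fun z : T * T => (split_weight C r b z.1 z.2)%:E).
    by apply/measurable_EFinP; exact: measurable_split_weight2.
  have mz : measurable_fun setT (fun w => (X (k * m)%N w, X (k * m)%N w)).
    exact: measurable_fun_pair.
  exact: (measurableT_comp (measurable_path_int_param P m mB mg) mz).
have w0 b x y : 0 <= (split_weight C r b x y)%:E by rewrite lee_fin split_weight_ge0.
have mw b x : measurable_fun setT (fun y => (split_weight C r b x y)%:E).
  by apply/measurable_EFinP; exact: (measurable_fun_pair2 x (measurable_split_weight2 b)).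
rewrite !PG -!ge0_integralZl ?lee_fin//; last 2 first.
- by move=> w _; exact: path_int_ge0.
- by move=> w _; exact: path_int_ge0.
rewrite -ge0_integralD//; last 4 first.
- by move=> w _; rewrite mule_ge0 ?lee_fin//; exact: path_int_ge0.
- exact: measurable_funeM.
- by move=> w _; rewrite mule_ge0 ?lee_fin//; exact: path_int_ge0.
- exact: measurable_funeM.
apply: eq_integral => w _.
rewrite -!path_intZ// -path_intD//; last 4 first.
- by move=> y; rewrite mule_ge0 ?lee_fin// split_weight_ge0.
- exact: measurable_funeM.
- by move=> y; rewrite mule_ge0 ?lee_fin// split_weight_ge0.
- exact: measurable_funeM.
Qed.

Lemma split_cyl_law J k E (A : nat -> set T) (S : nat -> set bool) :
  split_history m X Y k E -> (forall i, measurable (A i)) ->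
  Pr (E `&` [set w | (forall i, (i <= J * m)%N -> A i (X (k * m + i)%N w)) /\
                     (forall j, (j < J)%N -> S j (Y (k + j)%N w))])
  = \int[Pr]_(w in E) cyl J A S (X (k * m)%N w).
Proof.
elim: J k E A S => [|J ih] k E A S HE mA.
  have mE : measurable E by exact: (split_history_measurable mX mY) HE.
  rewrite /= [RHS](_ : _ = \int[Pr]_(w in E) (\1_(X (k * m)%N @^-1` A 0%N) w)%:E)//.
  rewrite integral_indic//; last by rewrite -[X in measurable X]setTI; exact: mX.
  rewrite setIC; congr (Pr (_ `&` E)); apply/seteqP; split => w /=.
    by move=> [/(_ 0%N (leqnn _))]; rewrite addn0.
  by move=> A0; split => // i; rewrite mul0n leqn0 => /eqP ->; rewrite addn0.
pose E1 := E `&` X (k * m)%N @^-1` A 0%N.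
have HE1 : split_history m X Y k E1 by apply: sigma_algebraI => //; exact: split_historyX.
have mE1 : measurable E1 by exact: (split_history_measurable mX mY) HE1.
pose F := [set w | S 0%N (Y k w) /\ forall j, (j < m)%N -> A j.+1 (X (k * m + j.+1)%N w)].
have HE2 : split_history m X Y k.+1 (E1 `&` F).
  apply: sigma_algebraI; first exact: split_history_sub (leqnSn k) _ HE1.
  rewrite (_ : F = Y k @^-1` S 0%N `&`
    [set w | forall j, (j < m)%N -> (X (k * m + j.+1)%N @^-1` A j.+1) w]); last first.
    by apply/seteqP; split.
  apply: sigma_algebraI; first exact: split_historyY.
  apply: sigma_algebra_forall_lt => j jm; apply: split_historyX => //.
  by rewrite mulSn addnC leq_add2r.
have mE2 : measurable (E1 `&` F) by exact: (split_history_measurable mX mY) HE2.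
have km1 i : (k.+1 * m + i = k * m + (m + i))%N by rewrite mulSn addnAC addnC addnA.
rewrite (_ : E `&` _ = (E1 `&` F) `&`
   [set w | (forall i, (i <= J * m)%N -> A (m + i)%N (X (k.+1 * m + i)%N w)) /\
            (forall j, (j < J)%N -> S j.+1 (Y (k.+1 + j)%N w))]); last first.
  apply/seteqP; split => w /=.
    move=> [Ew [Aw Sw]]; split; split.
    - by split => //=; have := Aw 0%N (leq0n _); rewrite addn0.
    - split; first by have := Sw 0%N (ltn0Sn _); rewrite addn0.
      by move=> j jm; apply: Aw; rewrite mulSn (leq_trans jm)// leq_addr.
    - by move=> i iJ; rewrite km1; apply: Aw; rewrite mulSn leq_add2l.
    - by move=> j jJ; rewrite addSnnS; exact: Sw.
  move=> [[[Ew A0] [S0 F0]] [Aw Sw]]; split => //; split.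
    move=> i; have [im _|im] := leqP i m.
      case: i im => [|i] im; first by rewrite addn0.
      exact: F0.
    rewrite mulSn -[in (_ <= _)%N](subnKC (ltnW im)) leq_add2l => /Aw.
    by rewrite km1 !(subnKC (ltnW im)).
  by move=> [|j] jJ; [rewrite addn0|have := Sw j jJ; rewrite addSnnS].
rewrite (ih k.+1 (E1 `&` F) (fun i => A (m + i)%N) (fun j => S j.+1) HE2)//.
rewrite (@integral_transition _ _ _ P _ _ Pr E1 _ (X (k.+1 * m)%N) (X (k * m)%N)
   (set_weight (S 0%N)) (fun i => A i.+1) m)//; last 5 first.
- exact: set_weight_ge0.
- exact: measurable_set_weight.
- move=> D mD.
  rewrite (_ : E1 `&` F `&` _ = E1 `&` [set w | S 0%N (Y k w) /\ forall j, (j < m)%N ->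
      (if j == m.-1 then A j.+1 `&` D else A j.+1) (X (k * m + j.+1)%N w)]); last first.
    apply/seteqP; split => w /=.
      move=> [[E1w [S0 F0]] Dw]; split => //; split => // j jm.
      case: ifPn => [/eqP jE|_]; last exact: F0.
      by split; [exact: F0|rewrite jE prednK// addnC -mulSn].
    move=> [E1w [S0 F0]]; split; first split => //.
      split => // j jm; have := F0 j jm; case: ifP => // _ []//.
    have := F0 m.-1; rewrite eqxx prednK// => /(_ (leqnn _))[_].
    by rewrite addnC -mulSn.
  rewrite (split_block_law (S 0%N) (B := fun j => if j == m.-1 then A j.+1 `&` D
      else A j.+1) HE1); last by move=> j; case: ifP => // _; exact: measurableI.
  apply: eq_integral => w _; rewrite -(prednK m0).
  exact: (path_int_setI P (fun j => A j.+1) D _ m.-1).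
- by move=> y; exact: cyl_ge0.
- exact: measurable_cyl.
rewrite integral_setI_indic; apply: eq_integral => w _.
by rewrite muleC.
Qed.

End cylinder_probabilities.

Section path_laws.
Context d (T : measurableType d) (R : realType).

Lemma exists_pushforward dO (O : measurableType dO) (m : {measure set O -> \bar R})
    (V : O -> pathT T) : measurable_fun setT V ->
  exists m1 : {measure set (pathT T) -> \bar R}, forall G, m1 G = m (V @^-1` G).
Proof.
move=> mV.
by unshelve eexists; first refine (pushforward m V : measure _ _).
Qed.

Lemma path_law_unique d1 d2 (O1 : measurableType d1) (O2 : measurableType d2)
    (m1 : {finite_measure set O1 -> \bar R}) (m2 : {measure set O2 -> \bar R})
    (E : set O1) (V1 : O1 -> pathT T) (V2 : O2 -> pathT T) (q : \bar R) :
  measurable E -> measurable_fun setT V1 -> measurable_fun setT V2 ->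
  0 <= q -> q \is a fin_num ->
  (forall J A S, (forall i, measurable (A i)) ->
    m1 (E `&` V1 @^-1` (rect J A S)) = q * m2 (V2 @^-1` (rect J A S))) ->
  forall G, measurable G -> m1 (E `&` V1 @^-1` G) = q * m2 (V2 @^-1` G).
Proof.
move=> mE mV1 mV2 q0 qfin h G mG.
have E0 : (0 <= fine q)%R by rewrite fine_ge0.
have [n1 n1E] := exists_pushforward (mrestr m1 mE) mV1.
have [n2 n2E] := exists_pushforward m2 mV2.
have msE A : mscale (NngNum E0) n2 A = q * m2 (V2 @^-1` A).
  by rewrite -n2E -[in RHS](fineK qfin).
have n1E' A : n1 A = m1 (E `&` V1 @^-1` A) by rewrite n1E /mrestr setIC.
rewrite -n1E' -msE; apply: path_measure_unique => //.
- rewrite n1E' preimage_setT setIT.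
  by rewrite ltey_eq fin_num_measure.
- by move=> J A S mA; rewrite n1E' [RHS]msE h.
Qed.

End path_laws.

Section split_laws.
Context d (T : measurableType d) (R : realType) (P : R.-pker T ~> T).
Variables (m : nat) (C : set T) (delta : R) (nu : probability T R) (r : T -> T -> R).
Hypothesis m0 : (0 < m)%N.
Hypothesis mC : measurable C.
Hypothesis delta0 : (0 <= delta)%R.
Hypothesis rden : minorization_density P m C delta nu r.
Hypothesis r01 : forall x y, (0 <= r x y <= 1)%R.

Let mr : measurable_fun setT (fun z : T * T => r z.1 z.2). Proof. by case: rden. Qed.

Section one_chain.
Context dO (Omega : measurableType dO) (Pr : probability Omega R) (mu : probability T R).
Variables (X : nat -> Omega -> T) (Y : nat -> Omega -> bool).
Hypothesis XY : split_chain P m C delta r Pr mu X Y.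

Lemma split_measurableX i : measurable_fun setT (X i). Proof. by case: XY. Qed.
Lemma split_measurableY i : measurable_fun setT (Y i). Proof. by case: XY. Qed.

Lemma split_initial_law A : measurable A -> Pr (X 0%N @^-1` A) = mu A.
Proof.
move=> mA; have [_ _ XY0 _] := XY.
have := XY0 (A `*` setT); rewrite (_ : [set w | _] = X 0%N @^-1` A); last first.
  by apply/seteqP; split => w //= [].
move=> ->; last exact: measurableX.
rewrite /split_law (_ : [set x | _] = A); last by apply/seteqP; split => x //= [].
have fC : mu (A `&` C) \is a fin_num by apply: fin_num_measure; exact: measurableI.
rewrite addeA -muleDl// -EFinD addrCA subrr addr0 mul1e.
rewrite -[in RHS](setIT A) -(setUv C) setIUr; apply/esym; apply: measureU.
- exact: measurableI.
- by apply: measurableI => //; exact: measurableC.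
- by rewrite setIACA setICr setI0.
Qed.

Lemma split_initial_regeneration : Pr (Y 0%N @^-1` [set true]) = delta%:E * mu C.
Proof.
have [_ _ XY0 _] := XY.
have := XY0 (setT `*` [set true]); rewrite (_ : [set w | _] = Y 0%N @^-1` [set true]); last first.
  by apply/seteqP; split => w //= [].
move=> ->; last exact: measurableX.
rewrite /split_law (_ : [set x | _] = setT); last by apply/seteqP; split.
rewrite (_ : [set x | (_ `*` _) (x, false)] = set0); last by apply/seteqP; split => x //= [].
by rewrite setTI !set0I !measure0 mule0 !adde0.
Qed.

Lemma measurable_path_from k : measurable_fun setT (path_from m X Y k).
Proof.
by apply: measurable_fun_path => i; [exact: split_measurableX|exact: split_measurableY].
Qed.

Lemma split_skeleton_step k E A : split_history m X Y k E -> measurable A ->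
  Pr (E `&` X (k.+1 * m)%N @^-1` A) = \int[Pr]_(w in E) kpow P m (X (k * m)%N w) A.
Proof.
move=> HE mA.
have := @split_block_law _ _ _ P m C delta r mC mr r01 _ _ Pr mu X Y XY k setT E
  (fun i => if i == m.-1 then setT `&` A else setT) HE.
rewrite (_ : [set w | _] = X (k.+1 * m)%N @^-1` A); last first.
  apply/seteqP; split => w /=.
    move=> [_ /(_ m.-1)]; rewrite eqxx prednK// => /(_ (leqnn _))[_].
    by rewrite addnC -mulSn.
  move=> Aw; split => // j jm; case: ifP => // /eqP jE; split => //.
  by rewrite jE prednK// addnC -mulSn.
move=> -> ; last by move=> j; case: ifP => // _; exact: measurableI.
apply: eq_integral => w _.
rewrite -(path_int_kpow P m (X (k * m)%N w) mA) -(prednK m0).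
rewrite (path_int_setI P (fun=> setT) A _ m.-1).
by apply: path_int_eq => // y; rewrite set_weightT mul1e.
Qed.

Lemma split_regeneration_step k E A : split_history m X Y k E -> measurable A ->
  Pr (E `&` Y k @^-1` [set true] `&` X (k.+1 * m)%N @^-1` A) =
  Pr (E `&` X (k * m)%N @^-1` C) * (delta%:E * nu A).
Proof.
move=> HE mA.
have mE : measurable E.
  exact: (split_history_measurable split_measurableX split_measurableY) HE.
have := @split_block_law _ _ _ P m C delta r mC mr r01 _ _ Pr mu X Y XY k [set true] E
  (fun i => if i == m.-1 then setT `&` A else setT) HE.
rewrite (_ : [set w | _] = Y k @^-1` [set true] `&` X (k.+1 * m)%N @^-1` A); last first.
  apply/seteqP; split => w /=.
    move=> [Yw /(_ m.-1)]; rewrite eqxx prednK// => /(_ (leqnn _))[_].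
    by rewrite addnC -mulSn.
  move=> [Yw Aw]; split => // j jm; case: ifP => // /eqP jE; split => //.
  by rewrite jE prednK// addnC -mulSn.
rewrite setIA => ->; last by move=> j; case: ifP => // _; exact: measurableI.
have [_ r0 rE] := rden.
have mrx x : measurable_fun setT (fun y => (r x y)%:E).
  by apply/measurable_EFinP; exact: (measurable_fun_pair2 x mr).
have mXC : measurable (X (k * m)%N @^-1` C).
  by rewrite -[X in measurable X]setTI; exact: split_measurableX.
rewrite (eq_integral (fun w => (delta%:E * nu A) * (\1_(X (k * m)%N @^-1` C) w)%:E)).
  rewrite ge0_integralZl//; last 2 first.
  - by apply/measurable_EFinP; exact: measurable_indic.
  - by rewrite mule_ge0.
  by rewrite integral_indic// muleC setIC.
move=> w _; set x := X (k * m)%N w.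
rewrite indicE (_ : (w \in _) = (x \in C)); last by apply/idP/idP; rewrite !inE.
rewrite -[X in path_int _ _ _ X]prednK//.
rewrite (path_int_setI P (fun=> setT) A _ m.-1) prednK//.
rewrite integral_kpow; last 2 first.
- by move=> y; rewrite mule_ge0// lee_fin set_weight_ge0.
- apply: emeasurable_funM; last exact/measurable_EFinP.
  apply/measurable_EFinP.
  exact: (measurable_fun_pair2 x (measurable_set_weight mC mr [set true])).
rewrite -integral_in_indic.
have wE y : set_weight C r [set true] x y = (\1_C x * r x y)%R by rewrite set_weight1.
under eq_integral do rewrite wE.
have [Cx|Cx] := pselect (C x).
  rewrite indicE (mem_set Cx) mule1 -(rE x A Cx mA).
  by apply: eq_integral => y _; rewrite mul1r.
rewrite indicE (memNset Cx) mule0.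
by apply: integral0_eq => y _; rewrite mul0r.
Qed.

Lemma split_regeneration_law k E A : split_history m X Y k E -> measurable A ->
  Pr (E `&` Y k @^-1` [set true] `&` X (k.+1 * m)%N @^-1` A) =
  Pr (E `&` Y k @^-1` [set true]) * nu A.
Proof.
move=> HE mA; have := split_regeneration_step HE measurableT.
rewrite preimage_setT setIT probability_setT mule1 => ->.
by rewrite split_regeneration_step// muleA.
Qed.

Lemma split_regeneration_history k E : split_history m X Y k E ->
  split_history m X Y k.+1 (E `&` Y k @^-1` [set true]).
Proof.
move=> HE; apply: sigma_algebraI; first exact: split_history_sub (leqnSn k) _ HE.
exact: split_historyY.
Qed.

Lemma split_history_meas k : split_history m X Y k `<=` measurable.
Proof. exact: (split_history_measurable split_measurableX split_measurableY). Qed.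

Lemma split_integral_law k E (mu0 : probability T R) : split_history m X Y k E ->
  (forall A, measurable A -> Pr (E `&` X (k * m)%N @^-1` A) = Pr E * mu0 A) ->
  forall phi : T -> \bar R, (forall x, 0 <= phi x) -> measurable_fun setT phi ->
  \int[Pr]_(w in E) phi (X (k * m)%N w) = Pr E * \int[mu0]_x phi x.
Proof.
move=> HE hE; apply: (@integral_eq_law _ _ _ _ _ _ _ _ mu0 E (X (k * m)%N) id).
- exact: split_history_meas HE.
- exact: split_measurableX.
- exact: measurable_id.
- exact: measure_ge0.
- by apply: fin_num_measure; exact: split_history_meas HE.
- by move=> A mA; rewrite preimage_id; exact: hE.
Qed.

Lemma split_rect_law J k E (A : nat -> set T) (S : nat -> set bool) :
  split_history m X Y k E -> (forall i, measurable (A i)) ->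
  Pr (E `&` path_from m X Y k @^-1` rect J A S) =
  \int[Pr]_(w in E) cyl P m C r J (fun i => if (i < J)%N then A i else setT) S
    (X (k * m)%N w).
Proof.
move=> HE mA; pose A' i := if (i < J)%N then A i else setT.
have mA' i : measurable (A' i) by rewrite /A'; case: ifP.
rewrite -(split_cyl_law m0 mC mr r01 XY J S HE mA'); congr (Pr (_ `&` _)).
apply/seteqP; split => w /=.
  move=> h; split => i iJ; last by have [] := h i iJ.
  by rewrite /A'; case: ifPn => // /h[].
move=> [hA hS] i iJ; split; last exact: hS.
have := hA i; rewrite /A' iJ; apply.
by rewrite (leq_trans (ltnW iJ))// leq_pmulr.
Qed.

End one_chain.

Lemma split_path_law dO (Omega : measurableType dO) (Pr : probability Omega R)
    (mu : probability T R) (X : nat -> Omega -> T) (Y : nat -> Omega -> bool)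
    dO' (Omega' : measurableType dO') (Pr' : probability Omega' R)
    (mu' : probability T R) (X' : nat -> Omega' -> T) (Y' : nat -> Omega' -> bool) k E :
  split_chain P m C delta r Pr mu X Y -> split_chain P m C delta r Pr' mu' X' Y' ->
  split_history m X Y k E ->
  (forall A, measurable A -> Pr (E `&` X (k * m)%N @^-1` A) = Pr E * mu' A) ->
  forall G, measurable G ->
  Pr (E `&` path_from m X Y k @^-1` G) = Pr E * Pr' (path_from m X' Y' 0 @^-1` G).
Proof.
move=> XY XY' HE hE.
have mE : measurable E by exact: (split_history_meas XY) HE.
have mp := measurable_path_from XY k.
have mp' := measurable_path_from XY' 0.
apply: (path_law_unique mE mp mp').
- exact: measure_ge0.
- exact: fin_num_measure.
move=> J A S mA.
pose A' i := if (i < J)%N then A i else setT.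
have mA' i : measurable (A' i) by rewrite /A'; case: ifP.
have mcyl := measurable_cyl P m mC mr J S mA'.
have cyl0 x : 0 <= cyl P m C r J A' S x by exact: cyl_ge0.
transitivity (Pr E * \int[mu']_x cyl P m C r J A' S x).
  apply: (etrans (split_rect_law XY J S HE mA)).
  exact: (split_integral_law XY HE hE cyl0 mcyl).
congr (_ * _); apply/esym.
have HT : split_history m X' Y' 0 setT by exact: sigma_algebraT.
have := split_rect_law XY' J S HT mA; rewrite setTI => hT.
apply: (etrans hT).
apply: (etrans (split_integral_law XY' (mu0 := mu') HT _ cyl0 mcyl)).
  by move=> D mD; rewrite setTI mul0n (split_initial_law XY')// probability_setT mul1e.
by rewrite probability_setT mul1e.
Qed.

Lemma split_regeneration dO (Omega : measurableType dO) (Pr : probability Omega R)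
    (mu : probability T R) (X : nat -> Omega -> T) (Y : nat -> Omega -> bool)
    dO' (Omega' : measurableType dO') (Pr' : probability Omega' R)
    (X' : nat -> Omega' -> T) (Y' : nat -> Omega' -> bool) k E :
  split_chain P m C delta r Pr mu X Y -> split_chain P m C delta r Pr' nu X' Y' ->
  split_history m X Y k E ->
  forall G, measurable G ->
  Pr (E `&` Y k @^-1` [set true] `&` path_from m X Y k.+1 @^-1` G) =
  Pr (E `&` Y k @^-1` [set true]) * Pr' (path_from m X' Y' 0 @^-1` G).
Proof.
move=> XY XY' HE; apply: (split_path_law XY XY').
  exact: split_regeneration_history.
by move=> A mA; exact: (split_regeneration_law XY).
Qed.

End split_laws.

Section invariant_law_theory.
Context d (T : measurableType d) (R : realType) (P : R.-pker T ~> T).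
Variable pi : probability T R.
Hypothesis pi_inv : invariant_law P pi.

Lemma invariant_integral (g : T -> \bar R) : (forall x, 0 <= g x) ->
  measurable_fun setT g -> \int[pi]_x \int[P x]_y g y = \int[pi]_x g x.
Proof.
have mPg (f : T -> \bar R) : (forall x, 0 <= f x) -> measurable_fun setT f ->
    measurable_fun setT (fun x => \int[P x]_y f y).
  by move=> f0 mf; exact: (@measurable_path_int _ _ _ P (fun=> setT) f 1).
move: g; apply: ge0_fun_ind.
- move=> A mA; rewrite [RHS]integral_indic// setIT.
  apply: (etrans _ (pi_inv mA)).
  by apply: eq_integral => x _; rewrite integral_indic// setIT.
- move=> k f k0 f0 mf Qf; rewrite [RHS]ge0_integralZl// -Qf -ge0_integralZl//.
  + by apply: eq_integral => x _; rewrite ge0_integralZl.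
  + exact: mPg.
  + by move=> x _; exact: integral_ge0.
- move=> f g f0 mf g0 mg Qf Qg; rewrite [RHS]ge0_integralD// -Qf -Qg -ge0_integralD//.
  + by apply: eq_integral => x _; rewrite ge0_integralD.
  + by move=> x _; exact: integral_ge0.
  + exact: mPg.
  + by move=> x _; exact: integral_ge0.
  + exact: mPg.
- move=> f f0 mf ndf Qf; rewrite [RHS]monotone_convergence//.
  rewrite (eq_integral (fun x => limn (fun n => \int[P x]_y f n y))); last first.
    by move=> x _; rewrite monotone_convergence.
  rewrite monotone_convergence//.
  + by congr (limn _); apply/funext => n; exact: Qf.
  + by move=> n; exact: mPg.
  + by move=> n x _; exact: integral_ge0.
  + by move=> x _ n1 n2 n12; apply: ge0_le_integral => // y _; exact: ndf.
Qed.

Lemma invariant_kpow j A : measurable A -> \int[pi]_x kpow P j x A = pi A.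
Proof.
move=> mA; elim: j => [|j ih].
  by rewrite /= /kdirac/= (eq_integral (fun x => (\1_A x)%:E))// integral_indic// setIT.
rewrite -ih -[RHS]invariant_integral//.
by have := @measurable_kernel _ _ _ _ _ (kpow P j) A mA.
Qed.

End invariant_law_theory.

Section absorbing_sets.
Context d (T : measurableType d) (R : realType) (P : R.-pker T ~> T).

Lemma measure_full (mu : {measure set T -> \bar R}) (F : set T) :
  mu setT = 1 -> measurable F -> mu F = 1 <-> mu (~` F) = 0.
Proof.
move=> muT mF; have mFC := measurableC mF.
have : mu F + mu (~` F) = 1.
  transitivity (mu setT) => //.
  by rewrite -(setUv F); apply/esym; apply: measureU => //; exact: setICr.
have Ff : mu F \is a fin_num.
  rewrite ge0_fin_numE// (@le_lt_trans _ _ 1) ?ltry//.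
  by rewrite -muT; apply: le_measure; rewrite ?inE.
move=> h; split => [F1|F0]; last by move: h; rewrite F0 adde0.
by move: h => /(congr1 (fun z => z - 1)); rewrite F1 addeAC subee// add0e.
Qed.

Lemma kernel_eq1 (F : set T) x : measurable F -> P x F = 1 <-> P x (~` F) = 0.
Proof. by apply: measure_full; exact: prob_kernel. Qed.

Lemma kernel_bigcap_eq1 (F : nat -> set T) x : (forall i, measurable (F i)) ->
  (forall i, P x (F i) = 1) -> P x (\bigcap_i F i) = 1.
Proof.
move=> mF F1; apply/kernel_eq1; first exact: bigcapT_measurable.
apply/eqP; rewrite eq_le measure_ge0 andbT setC_bigcap.
have mFC i : measurable (~` F i) by exact: measurableC.
rewrite (le_trans (generalized_Boole_inequality (P x) mFC _))//.
  exact: bigcup_measurable.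
by rewrite eseries0// => i _ _; apply/kernel_eq1.
Qed.

Variable pi : probability T R.
Hypothesis pi_inv : invariant_law P pi.
Hypothesis pi_irr : irreducible P pi.
Hypothesis P_aper : aperiodic P pi.
Variables (m : nat) (h : T -> \bar R).
Hypothesis m0 : (0 < m)%N.
Hypothesis h0 : forall x, 0 <= h x.
Hypothesis mh : measurable_fun setT h.
Hypothesis h_harm : forall x, h x = \int[kpow P m x]_y h y.

Let A j := [set x | \int[kpow P j x]_y h y = 0].

Let mint j : measurable_fun setT (fun x => \int[kpow P j x]_y h y).
Proof.
by under eq_fun do rewrite -integral_kpow//; exact: measurable_path_int.
Qed.

Let mA j : measurable (A j).
Proof.
rewrite (_ : A j = (fun x => \int[kpow P j x]_y h y) @^-1` [set 0])//.
by rewrite -[X in measurable X]setTI; exact: mint.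
Qed.

Let A_periodic j : A (j + m)%N = A j.
Proof.
apply/seteqP; split => x; rewrite /A/= integral_kpow_add// => <-;
  by apply: eq_integral => y _; rewrite -h_harm.
Qed.

Let A_step j x : A j.+1 x -> P x (A j) = 1.
Proof.
have -> : A j.+1 x = (path_int P (fun=> setT) h j.+1 x = 0).
  by rewrite integral_kpow.
move=> /= Ax; apply/kernel_eq1 => //.
have : ae_eq (P x) setT (path_int P (fun=> setT) h j) (cst 0).
  apply/ae_eq_integral_abs => //; first exact: measurable_path_int.
  by under eq_integral do rewrite gee0_abs ?path_int_ge0//.
move=> [N [mN N0 hN]]; apply/eqP; rewrite eq_le measure_ge0 andbT -N0.
apply: le_measure; rewrite ?inE//; first exact: measurableC.
by move=> y Ay; apply: hN => /= /(_ Logic.I); rewrite integral_kpow.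
Qed.

Let E i := A (i * m.-1)%N.

Let E_step i x : E i x -> P x (E i.+1) = 1.
Proof.
rewrite /E -A_periodic -[in X in A (_ + X)](prednK m0) addnS => /A_step.
by rewrite mulSn addnC.
Qed.

Let E_periodic i : E (i + m)%N = E i.
Proof.
have AM a k : A (a + m * k)%N = A a.
  elim: k => [|k ih]; first by rewrite muln0 addn0.
  by rewrite mulnS addnCA addnC A_periodic.
by rewrite /E mulnDl AM.
Qed.

Let e x i : bool := `[< E i x >].

Let e_periodic x i : e x (i + m)%N = e x i.
Proof. by rewrite /e E_periodic. Qed.

Let e_window x s : (\sum_(i < m) e x (i + s) = \sum_(i < m) e x i)%N.
Proof.
elim: s => [|s <-]; first by apply: eq_bigr => i _; rewrite addn0.
apply/eqP; rewrite -(eqn_add2l (e x s)); apply/eqP.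
transitivity (\sum_(i < m.+1) e x (i + s))%N.
  rewrite big_ord_recl /= add0n; congr addn.
  by apply: eq_bigr => i _; rewrite /bump/= add1n addSnnS.
by rewrite big_ord_recr /= addnC [(m + s)%N]addnC e_periodic.
Qed.

(* E j is the zero set of the P^(j (m - 1))-average of h: it is m-periodic in j, and
   P moves it into E j.+1, so that j |-> E j runs through the phases of h.  Starting from a point lying in as many of the E_j as possible, the intersections
   G s of the shifted E_(i + s) over its pattern of indices i form a cycle of sets
   carried into one another; by aperiodicity the cycle has length one. *)
Lemma aperiodic_absorbing : (exists x, h x = 0) ->
  exists F, [/\ measurable F, F `<=` [set x | h x = 0],
    forall x, F x -> P x F = 1 & 0 < pi F].
Proof.
move=> [x0 hx0].
pose c x := (\sum_(i < m) e x i)%N.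
have c_le x : (c x <= m)%N.
  rewrite /c -[leqRHS]card_ord -sum1_card; apply: leq_sum => i _.
  by case: (e x i).
have E0 x : E 0%N x <-> h x = 0.
  rewrite /E mul0n.
  by have -> : A 0 x = (path_int P (fun=> setT) h 0 x = 0) by rewrite integral_kpow.
have ex_c : exists k, `[< exists x, c x = k >] by exists (c x0); apply/asboolP; exists x0.
have c_bd k : `[< exists x, c x = k >] -> (k <= m)%N.
  by move=> /asboolP[x <-].
have [c0 /asboolP[xs xsk] kmax] := ex_maxnP ex_c c_bd.
have cmax x : (c x <= c xs)%N by rewrite xsk; apply: kmax; apply/asboolP; exists x.
have c_gt0 : (0 < c xs)%N.
  apply: leq_trans (cmax x0); rewrite /c -(prednK m0) big_ord_recl/=.
  by rewrite (_ : e x0 0%N = true)//; apply/asboolP/E0.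
pose q := e xs.
have q_periodic i : q (i + m)%N = q i by exact: e_periodic.
have q_periodicM j i : q (i + j * m)%N = q i.
  by elim: j => [|j ih]; rewrite ?mul0n ?addn0// mulSn addnCA addnC q_periodic.
have implT (B : set T) : [set y | true -> B y] = B.
  by apply/seteqP; split => y /=; [apply|].
have implF (B : set T) : [set y | false -> B y] = setT.
  by apply/seteqP; split.
pose G s := \bigcap_i [set y | q i -> E (i + s)%N y].
have mGi s i : measurable [set y | q i -> E (i + s)%N y].
  by case: (q i); rewrite ?implT ?implF//; exact: mA.
have mG s : measurable (G s) by apply: bigcapT_measurable => i; exact: mGi.
have G_step s x : G s x -> P x (G s.+1) = 1.
  move=> Gx; apply: kernel_bigcap_eq1 => i; first exact: mGi.
  have := Gx i Logic.I; case: (q i) => /= Ex.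
    by rewrite implT addnS; apply: E_step; exact: Ex.
  by rewrite implF prob_kernel.
have e_modn x i : e x (i %% m)%N = e x i.
  rewrite [in RHS](divn_eq i m) addnC; elim: (i %/ m)%N => [|j ih]; first by rewrite mul0n addn0.
  by rewrite mulSn addnCA addnC e_periodic.
have Gq s y i : G s y -> e y (i + s)%N = q i.
  move=> Gy.
  have qe j : (q j <= e y (j + s))%N.
    by case qj : (q j) => //=; rewrite lt0b; apply/asboolP; exact: Gy qj.
  suff small j : (j < m)%N -> e y (j + s)%N = q j.
    transitivity (q (i %% m)%N); last exact: e_modn.
    by rewrite -small ?ltn_pmod// -[LHS]e_modn -[RHS]e_modn modnDml.
  move=> jm; have : (\sum_(i < m) (e y (i + s) - q i) = 0)%N.
    apply/eqP; rewrite sumnB//; rewrite subn_eq0 e_window.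
    by have := cmax y.
  move/eqP; rewrite sum_nat_eq0 => /forallP/(_ (Ordinal jm)) /=.
  by have := qe j; case: (q j) => //=; case: (e y (j + s)%N).
have q0 : exists i, q i.
  move: c_gt0; rewrite lt0n sum_nat_eq0 negb_forall => /existsP[i].
  by rewrite /= eqb0 negbK => qi; exists i.
have ex_p : exists p, (0 < p)%N && `[< forall i, q (i + p)%N = q i >].
  by exists m; rewrite m0/=; apply/asboolP.
have [p /andP[p_gt0 /asboolP qp] pmin] := ex_minnP ex_p.
have qpM j i : q (i + j * p)%N = q i.
  by elim: j => [|j ih]; rewrite ?mul0n ?addn0// mulSn addnCA addnC qp.
have Gxs : G 0%N xs by move=> i _ /asboolP; rewrite addn0.
have G_periodic s : G (s + p)%N = G s.
  apply/seteqP; split => y Gy i _ /= qi; apply/asboolP.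
    rewrite -[`[< _ >]]/(e y (i + s)%N).
    have -> : e y (i + s)%N = e y (i + (m.-1 * p) + (s + p))%N.
      have -> : (i + m.-1 * p + (s + p) = (i + s) + p * m)%N.
        by rewrite addnACA -mulSnr prednK// mulnC.
      by rewrite -[LHS]e_modn -[RHS]e_modn [in RHS]addnC modnMDl.
    by rewrite (Gq _ _ _ Gy) qpM.
  rewrite -[`[< _ >]]/(e y (i + (s + p))%N).
  by rewrite (_ : (i + (s + p) = (i + p) + s)%N) ?(Gq _ _ _ Gy) ?qp// addnAC addnA.
have G_kpow n s x : G s x -> kpow P n x (G (s + n)%N) = 1.
  elim: n s x => [|n ih] s x Gx; first by rewrite addn0 /= /kdirac/= diracE mem_set.
  transitivity (\int[P x]_y cst 1 y); last by rewrite integral_cst// mul1e prob_kernel.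
  apply: ae_eq_integral => //.
    exact: (@measurable_kernel _ _ _ _ _ (kpow P n) _ (mG _)).
  exists (~` G s.+1); split; first exact: measurableC.
    by apply/kernel_eq1 => //; exact: G_step.
  by move=> y /= nG Gy; apply: nG => _; rewrite -addSnnS ih.
have piG s : pi (G s) <= pi (G s.+1).
  rewrite -(pi_inv (mG s.+1)).
  rewrite (@le_trans _ _ (\int[pi]_(x in G s) P x (G s.+1)))//.
    rewrite (eq_integral (cst 1)); first by rewrite integral_cst// mul1e.
    by move=> x; rewrite inE => /G_step.
  apply: ge0_subset_integral => //; exact: measurable_kernel.
have piGM n s' : pi (G s') <= pi (G (s' + n)%N).
  by elim: n => [|n ih]; rewrite ?addn0// addnS (le_trans ih).
have [s Gs] : exists s, 0 < pi (G s).
  apply: contrapT => /forallNP nG.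
  have G0 s : pi (G s) = 0.
    by apply/eqP; rewrite eq_le measure_ge0 andbT leNgt; apply/negP.
  pose U := \bigcup_s G s.
  have mU : measurable U by exact: bigcup_measurable.
  have piU : pi (~` U) = 1.
    apply/(measure_full (probability_setT pi) (measurableC mU)); rewrite setCK.
    apply/eqP; rewrite eq_le measure_ge0 andbT.
    rewrite (le_trans (generalized_Boole_inequality pi mG mU))//.
    by rewrite eseries0// => i _ _; exact: G0.
  have [|n [_]] := pi_irr (measurableC mU) _ xs; first by rewrite piU.
  rewrite (_ : kpow P n xs (~` U) = 0) ?ltxx//.
  apply/(measure_full (kpow_setT P n xs) mU)/eqP; rewrite eq_le; apply/andP; split.
    by rewrite -(kpow_setT P n xs); apply: le_measure; rewrite ?inE.
  rewrite -(G_kpow n _ _ Gxs); apply: le_measure; rewrite ?inE//.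
  exact: bigcup_sup.
have G_periodicM k : G (k * p)%N = G 0%N.
  by elim: k => [|k ih]; rewrite ?mul0n// mulSnr G_periodic.
have piG0 : 0 < pi (G 0%N).
  rewrite (lt_le_trans Gs)// (le_trans (piGM (s * p.-1)%N s))//.
  by rewrite -mulnS prednK// G_periodicM.
have p1 : p = 1%N.
  apply/eqP; rewrite eqn_leq p_gt0 andbT leqNgt; apply/negP => p_gt1.
  apply: P_aper; exists p, G; split => //.
    apply/trivIsetP => i j ip jp ij.
    wlog ltij : i j ip jp ij / (i < j)%N.
      move=> H; case: (ltngtP i j) => ij'; [exact: H| |by rewrite ij' eqxx in ij].
      by rewrite setIC; apply: H => //; rewrite eq_sym.
    apply/seteqP; split => // y [Gi Gj].
    have /pmin : (0 < j - i)%N && `[< forall k, q (k + (j - i))%N = q k >].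
      rewrite subn_gt0 ltij/=; apply/asboolP => k.
      by rewrite -(Gq _ _ _ Gi) -(Gq _ _ k Gj) -addnA subnK// ltnW.
    by rewrite leqNgt => /negP; apply; rewrite (leq_ltn_trans (leq_subr _ _)).
  move=> i x _ Gx; rewrite (_ : G _ = G i.+1); first exact: G_step.
  rewrite [in RHS](divn_eq i.+1 p) addnC; elim: (_ %/ _)%N => [|k ih].
    by rewrite mul0n addn0.
  by rewrite mulSnr addnA G_periodic.
have qT i : q i.
  have qi k : q k = q 0%N.
    by elim: k => // k <-; rewrite -[in RHS]qp p1 addn1.
  by have [k qk] := q0; rewrite qi -(qi k).
exists (G 0%N); split => //.
  by move=> y Gy; apply/E0; have := Gy 0%N Logic.I (qT _).
by move=> x /G_step; rewrite -(G_periodic 0%N) p1.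
Qed.

End absorbing_sets.

Section markov_chain_laws.
Context d (T : measurableType d) (R : realType) (P : R.-pker T ~> T).
Context dO (Omega : measurableType dO) (Pr : probability Omega R) (mu : probability T R).
Variable X : nat -> Omega -> T.
Hypothesis HX : markov_chain P Pr mu X.

Let mX i : measurable_fun setT (X i). Proof. by case: HX. Qed.

Lemma history_measurable n : history X n `<=` measurable.
Proof.
apply: smallest_sub; first exact: sigma_algebra_measurable.
by move=> E [i [A [_ mA ->]]]; rewrite -[X in measurable X]setTI; exact: mX.
Qed.

Lemma history_sub n1 n2 : (n1 <= n2)%N -> history X n1 `<=` history X n2.
Proof.
move=> n12; apply: sub_sigma_algebra2 => E [i [A [im mA ->]]].
by exists i, A; split => //; exact: leq_trans n12.
Qed.

Lemma historyX n i A : (i <= n)%N -> measurable A -> history X n (X i @^-1` A).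
Proof. by move=> im mA; apply: sub_sigma_algebra; exists i, A. Qed.

Lemma markov_path_law L n E (B : nat -> set T) :
  history X n E -> (forall j, measurable (B j)) ->
  Pr (E `&` [set w | forall j, (j < L)%N -> B j (X (n + j.+1)%N w)])
  = \int[Pr]_(w in E) path_int P B (cst 1) L (X n w).
Proof.
elim: L n E B => [|L ih] n E B HE mB.
  have mE := history_measurable HE.
  rewrite (_ : [set w | _] = setT); last by apply/seteqP; split.
  by rewrite setIT /= integral_cst// mul1e.
have mE := history_measurable HE.
have HE1 : history X n.+1 (E `&` X n.+1 @^-1` B 0%N).
  by apply: sigma_algebraI; [exact: history_sub (leqnSn n) _ HE|exact: historyX].
have mE1 := history_measurable HE1.
rewrite (_ : E `&` _ = (E `&` X n.+1 @^-1` B 0%N) `&`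
    [set w | forall j, (j < L)%N -> B j.+1 (X (n.+1 + j.+1)%N w)]); last first.
  apply/seteqP; split => w /=.
    move=> [Ew Bw]; split; first by split => //; have := Bw 0%N isT; rewrite addn1.
    by move=> j jL; rewrite addSnnS; exact: Bw.
  move=> [[Ew B0] Bw]; split => // -[|j] jL; first by rewrite addn1.
  by rewrite -addSnnS; exact: Bw.
rewrite (ih _ _ (fun j => B j.+1) HE1)//.
have := @integral_transition _ T R P _ Omega Pr E (E `&` X n.+1 @^-1` B 0%N)
  (X n.+1) (X n) (fun _ _ => 1%R) B 1 mE mE1 (mX _) (mX _).
move=> /(_ (fun _ _ => ler01) (measurable_cst _) mB); rewrite /= => ->.
- by apply: eq_integral => w _; apply: eq_integral => y _; rewrite mul1e.
- move=> A mA; have [_ _ XS] := HX.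
  rewrite -setIA -preimage_setI XS//; last exact: measurableI.
  apply: eq_integral => w _; under eq_integral do rewrite mul1e.
  by rewrite integral_indic// setIC.
- by move=> y; exact: path_int_ge0.
- exact: measurable_path_int.
Qed.

Lemma markov_initial_integral (phi : T -> \bar R) : (forall x, 0 <= phi x) ->
  measurable_fun setT phi -> \int[Pr]_w phi (X 0%N w) = \int[mu]_x phi x.
Proof.
move=> phi0 mphi.
rewrite (@integral_eq_law _ _ _ _ _ T R Pr mu setT (X 0%N) id 1)// ?mul1e//.
by move=> A mA; rewrite setTI mul1e preimage_id; have [_ X0 _] := HX; exact: X0.
Qed.

End markov_chain_laws.

Section dirac_start.
Context d (T : measurableType d) (R : realType) (P : R.-pker T ~> T).
Context dO (Omega : measurableType dO) (Pr : probability Omega R).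
Variables (X : nat -> Omega -> T) (x : T).
Hypothesis HX : markov_chain P Pr (\d_x : probability T R) X.

Let mX i : measurable_fun setT (X i). Proof. by case: HX. Qed.

Let mXA i A : measurable A -> measurable (X i @^-1` A).
Proof. by move=> mA; rewrite -[X in measurable X]setTI; exact: mX. Qed.

Lemma markov_kpow n A : measurable A -> Pr (X n @^-1` A) = kpow P n x A.
Proof.
move=> mA; case: n => [|n].
  by have [_ X0 _] := HX; rewrite /= /kdirac; exact: X0.
have HT : history X 0 setT by exact: sigma_algebraT.
have := @markov_path_law _ _ _ P _ _ Pr _ X HX n.+1 0 setT
  (fun i => if i == n then setT `&` A else setT) HT.
rewrite (_ : setT `&` _ = X n.+1 @^-1` A); last first.
  apply/seteqP; split => w /=.
    by move=> [_ /(_ n (ltnSn n))]; rewrite eqxx add0n => -[].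
  by move=> Aw; split => // j _; case: ifP => // /eqP ->; rewrite add0n.
move=> -> ; last by move=> j; case: ifP => // _; exact: measurableI.
have mind : measurable_fun setT (fun y : T => (cst 1 y * (\1_A y)%:E : \bar R)).
  by apply: emeasurable_funM => //; exact/measurable_EFinP.
under eq_integral do rewrite (path_int_setI P (fun=> setT) A (cst 1) n).
rewrite (markov_initial_integral HX); last 2 first.
- by move=> y; apply: path_int_ge0 => z; rewrite mule_ge0.
- exact: measurable_path_int.
rewrite integral_dirac//; last exact: measurable_path_int.
rewrite diracT mul1e -[RHS](path_int_kpow P n.+1 x mA).
by apply: path_int_eq => // y; rewrite mul1e.
Qed.

Lemma absorbing_hit_eventually (F : set T) : measurable F ->
  (forall y, F y -> P y F = 1) ->
  Pr [set w | forall N : nat, exists n : nat, (N <= n)%N /\ F (X n w)] = 1 ->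
  forall e : R, (0 < e)%R -> exists N, forall n, (N <= n)%N -> kpow P n x (~` F) < e%:E.
Proof.
move=> mF Fabs io_sure e e0.
pose D n := \bigcap_(i in `I_n.+1) X i @^-1` (~` F).
have mFC := measurableC mF.
have mD n : measurable (D n) by apply: bigcap_measurableType => i _; exact: mXA.
pose N := \bigcup_i (X i @^-1` F `&` X i.+1 @^-1` (~` F)).
have mNi i : measurable (X i @^-1` F `&` X i.+1 @^-1` (~` F)).
  by apply: measurableI; exact: mXA.
have mN : measurable N by exact: bigcup_measurable.
have N0 : Pr N = 0.
  apply/eqP; rewrite eq_le measure_ge0 andbT.
  rewrite (le_trans (generalized_Boole_inequality Pr mNi mN))//.
  rewrite eseries0// => i _ _; have [_ _ XS] := HX.
  have HiF : history X i (X i @^-1` F) by exact: historyX.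
  have h := XS i _ _ HiF mFC.
  suff h0 : \int[Pr]_(w in X i @^-1` F) P (X i w) (~` F) = 0.
    by move: h; rewrite h0.
  by apply: integral0_eq => w /Fabs; rewrite kernel_eq1.
have leD n : kpow P n x (~` F) <= Pr (D n).
  rewrite -markov_kpow//.
  rewrite (@le_trans _ _ (Pr (D n `|` N)))//.
    apply: le_measure; rewrite ?inE//; [exact: mXA|exact: measurableU|].
    move=> w nF; have [Nw|Nw] := pselect (N w); [by right|left].
    move=> i; rewrite /= ltnS => ile Fi.
    apply: nF; rewrite -(subnKC ile); elim: (n - i)%N => [|k ih]; first by rewrite addn0.
    by rewrite addnS; apply: contrapT => nFk; apply: Nw; exists (i + k)%N.
  rewrite (le_trans (measureU2 _ _ _))// [X in _ + X]N0 adde0//.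
have cvD : Pr \o D @ \oo --> Pr (\bigcap_n D n).
  apply: nonincreasing_cvg_mu => //.
  - by rewrite ltey_eq fin_num_measure.
  - exact: bigcapT_measurable.
  - by move=> n1 n2 n12; apply/subsetPset => w Dw i /= i1; apply: Dw; exact: leq_trans i1 _.
have D0 : Pr (\bigcap_n D n) = 0.
  pose io := \bigcap_N \bigcup_(n in [set n | (N <= n)%N]) (X n @^-1` F).
  have mio : measurable io.
    by apply: bigcapT_measurable => k; apply: bigcup_measurable => n _; exact: mXA.
  have io1 : Pr io = 1.
    rewrite -[RHS]io_sure; congr (Pr _); apply/seteqP; split => w /= h k.
      by have [n /= kn Fn] := h k Logic.I; exists n.
    by move=> _; have [n [kn Fn]] := h k; exists n.
  apply/eqP; rewrite eq_le measure_ge0 andbT.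
  have <- : Pr (~` io) = 0 by apply/measure_full => //; exact: probability_setT.
  apply: le_measure; rewrite ?inE//; [exact: bigcapT_measurable|exact: measurableC|].
  move=> w Dw iow; have [n _ Fn] := iow 0%N Logic.I.
  by apply: (Dw n Logic.I n) => /=.
rewrite D0 in cvD.
have /fine_cvgP[_ /cvgrPdist_lt/(_ _ e0)[N1 _ hN1]] := cvD.
exists N1 => n N1n; apply: le_lt_trans (leD n) _.
have := hN1 n N1n; rewrite /= sub0r normrN ger0_norm ?fine_ge0//.
by rewrite -lte_fin fineK// fin_num_measure.
Qed.

End dirac_start.

Lemma probability_add_setC d (T : measurableType d) (R : realType)
    (Pr : probability T R) (A : set T) : measurable A -> Pr A + Pr (~` A) = 1.
Proof.
move=> mA; rewrite -[RHS](probability_setT Pr) -[in RHS](setUv A).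
apply/esym; apply: measureU => //; [exact: measurableC|exact: setICr].
Qed.

Section split_family.
Context d (T : measurableType d) (R : realType) (P : R.-pker T ~> T).
Variables (m : nat) (C : set T) (delta : R) (nu : probability T R) (r : T -> T -> R).
Hypothesis m0 : (0 < m)%N.
Hypothesis mC : measurable C.
Hypothesis delta0 : (0 < delta)%R.
Hypothesis rden : minorization_density P m C delta nu r.
Hypothesis r01 : forall x y, (0 <= r x y <= 1)%R.
Context dS (OmegaS : measurableType dS).
Variables (XS : nat -> OmegaS -> T) (YS : nat -> OmegaS -> bool).
Variable Pbar : probability T R -> probability OmegaS R.
Hypothesis HS : forall mu0, split_chain P m C delta r (Pbar mu0) mu0 XS YS.

Let mr : measurable_fun setT (fun z : T * T => r z.1 z.2). Proof. by case: rden. Qed.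

Let mXS i : measurable_fun setT (XS i). Proof. by case: (HS nu). Qed.

Let mpath k : measurable_fun setT (path_from m XS YS k).
Proof. exact: measurable_path_from (HS nu) k. Qed.

Let mpathG k G : measurable G -> measurable (path_from m XS YS k @^-1` G).
Proof. by move=> mG; rewrite -[X in measurable X]setTI; exact: mpath. Qed.

Let HT : split_history m XS YS 0 setT. Proof. exact: sigma_algebraT. Qed.

Definition path_prob (G : set (pathT T)) (y : T) : \bar R :=
  Pbar (\d_y : probability T R) (path_from m XS YS 0 @^-1` G).

Lemma path_prob_rect J (A : nat -> set T) S : (forall i, measurable (A i)) ->
  path_prob (rect J A S) = cyl P m C r J (fun i => if (i < J)%N then A i else setT) S.
Proof.
move=> mA; apply/funext => y; rewrite /path_prob.
have mA' i : measurable (if (i < J)%N then A i else setT) by case: ifP.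
have mcyl := measurable_cyl P m mC mr J S mA'.
have cyl0 x : 0 <= cyl P m C r J (fun i => if (i < J)%N then A i else setT) S x.
  exact: cyl_ge0.
have := split_rect_law m0 mC rden r01 (HS (\d_y : probability T R)) J S HT mA.
rewrite setTI => h; apply: (etrans h).
have := split_integral_law (HS (\d_y : probability T R))
  (mu0 := (\d_y : probability T R)) HT _ cyl0 mcyl.
rewrite probability_setT mul1e integral_dirac// diracT mul1e; apply.
move=> D mD; rewrite setTI mul0n mul1e.
exact: (split_initial_law mC (HS (\d_y : probability T R))).
Qed.

Lemma path_prob_ge0 G y : 0 <= path_prob G y.
Proof. exact: measure_ge0. Qed.

Lemma path_probC G y : measurable G -> path_prob G y + path_prob (~` G) y = 1.
Proof.
move=> mG; apply: probability_add_setC; exact: mpathG.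
Qed.

Lemma path_prob_markov G : measurable G -> measurable_fun setT (path_prob G) /\
  forall mu0 k, Pbar mu0 (path_from m XS YS k @^-1` G) =
    \int[Pbar mu0]_w path_prob G (XS (k * m)%N w).
Proof.
move: G; apply: (@dynkin_induction _ (pathT T) (@rects _ T)
  [set G | measurable_fun setT (path_prob G) /\
    forall mu0 k, Pbar mu0 (path_from m XS YS k @^-1` G) =
    \int[Pbar mu0]_w path_prob G (XS (k * m)%N w)]) => //.
- exact: rect_setI_closed.
- have T1 : path_prob setT = cst 1.
    by apply/funext => y; exact: probability_setT.
  split; first by rewrite T1.
  by move=> mu0 k; rewrite T1 integral_cst// mul1e.
- move=> _ [J [A [S [mA ->]]]]; rewrite /mkset path_prob_rect//.
  have mA' i : measurable (if (i < J)%N then A i else setT) by case: ifP.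
  split; first exact: measurable_cyl.
  move=> mu0 k.
  have HTk : split_history m XS YS k setT by exact: sigma_algebraT.
  by have := split_rect_law m0 mC rden r01 (HS mu0) J S HTk mA; rewrite setTI.
- move=> G mG [mPG PG].
  have CE : path_prob (~` G) = fun y => 1 - path_prob G y.
    apply/funext => y; rewrite -(path_probC y mG) addeAC subee ?add0e//.
    by rewrite /path_prob fin_num_measure//; exact: mpathG.
  have mC1 : measurable_fun setT (path_prob (~` G)).
    by rewrite CE; exact: emeasurable_funB.
  split => // mu0 k.
  have h : Pbar mu0 (path_from m XS YS k @^-1` G) +
      Pbar mu0 (path_from m XS YS k @^-1` (~` G)) =
      \int[Pbar mu0]_w path_prob G (XS (k * m)%N w) +
      \int[Pbar mu0]_w path_prob (~` G) (XS (k * m)%N w).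
    rewrite -ge0_integralD//; last 2 first.
    + exact: measurableT_comp.
    + exact: measurableT_comp.
    under eq_integral do rewrite path_probC//.
    apply: (etrans (probability_add_setC (Pbar mu0) (mpathG k mG))).
    by rewrite integral_cst// mul1e; apply/esym; exact: probability_setT.
  have fG : Pbar mu0 (path_from m XS YS k @^-1` G) \is a fin_num.
    by rewrite fin_num_measure//; exact: mpathG.
  move: h; rewrite -PG => /(congr1 (fun z => z - Pbar mu0 (path_from m XS YS k @^-1` G))).
  by rewrite addeAC subee// add0e addeAC subee// add0e.
- move=> F mF tF PF.
  have tpF k : trivIset setT (fun n => path_from m XS YS k @^-1` F n).
    apply/trivIsetP => i j _ _ ij; rewrite -preimage_setI.
    by move/trivIsetP : tF => /(_ _ _ Logic.I Logic.I ij) ->; rewrite preimage_set0.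
  have sumE mu0 k : Pbar mu0 (path_from m XS YS k @^-1` (\bigcup_n F n)) =
      \sum_(n <oo) Pbar mu0 (path_from m XS YS k @^-1` F n).
    rewrite preimage_bigcup measure_bigcup//; last by move=> n _; exact: mpathG.
    by apply: eq_eseriesl => n; rewrite in_setT.
  have UE : path_prob (\bigcup_n F n) = fun y => \sum_(n <oo) path_prob (F n) y.
    by apply/funext => y; exact: sumE.
  split.
    rewrite UE; apply: ge0_emeasurable_sum => // n _.
    by have [] := PF n.
  move=> mu0 k; rewrite sumE UE integral_nneseries//; last first.
    by move=> n; apply: measurableT_comp => //; have [] := PF n.
  by apply: eq_eseriesr => n _; have [_ ->] := PF n.
Qed.

Definition never_regenerates : set (pathT T) := [set v | forall j, (v j).2 = false].

Lemma measurable_never_regenerates : measurable never_regenerates.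
Proof.
rewrite (_ : never_regenerates =
    \bigcap_j ((fun v : pathT T => (v j).2) @^-1` [set false])).
  apply: bigcapT_measurable => j; rewrite -[X in measurable X]setTI.
  exact: measurable_pathY.
by apply/seteqP; split => v h j; [move=> _; exact: h|exact: (h j Logic.I)].
Qed.

Lemma path_after_regeneration mu0 k G : measurable G ->
  Pbar mu0 (YS k @^-1` [set true] `&` path_from m XS YS k.+1 @^-1` G) =
  Pbar mu0 (YS k @^-1` [set true]) * Pbar nu (path_from m XS YS 0 @^-1` G).
Proof.
move=> mG.
have HTk : split_history m XS YS k setT by exact: sigma_algebraT.
have := split_regeneration m0 mC (ltW delta0) rden r01 (HS mu0) (HS nu) HTk mG.
by rewrite setTI.
Qed.

Section stationary.
Variable pi : probability T R.
Hypothesis pi_inv : invariant_law P pi.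

Lemma stationary_skeleton k A : measurable A -> Pbar pi (XS (k * m)%N @^-1` A) = pi A.
Proof.
elim: k A => [|k ih] A mA; first by rewrite mul0n; exact: (split_initial_law mC (HS pi)).
have HTk : split_history m XS YS k setT by exact: sigma_algebraT.
have := split_skeleton_step m0 mC rden r01 (HS pi) HTk mA; rewrite setTI => h.
apply: (etrans h); rewrite -(invariant_kpow pi_inv m mA).
have mk : measurable_fun setT (fun x => kpow P m x A).
  exact: (@measurable_kernel _ _ _ _ _ (kpow P m) _ mA).
have := split_integral_law (HS pi) (mu0 := pi) HTk _ _ mk.
rewrite probability_setT mul1e; apply => // D mD.
by rewrite setTI mul1e ih.
Qed.

Lemma stationary_path k G : measurable G ->
  Pbar pi (path_from m XS YS k @^-1` G) = Pbar pi (path_from m XS YS 0 @^-1` G).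
Proof.
move=> mG.
have HTk : split_history m XS YS k setT by exact: sigma_algebraT.
have := split_path_law m0 mC rden r01 (HS pi) (HS pi) HTk _ mG.
rewrite setTI probability_setT mul1e; apply => A mA.
by rewrite setTI mul1e stationary_skeleton.
Qed.

Lemma stationary_regeneration k :
  Pbar pi (YS k @^-1` [set true]) = delta%:E * pi C.
Proof.
rewrite -(split_initial_regeneration (HS pi)).
pose G := (fun v : pathT T => (v 0%N).2) @^-1` [set true].
have mG : measurable G.
  by rewrite -[X in measurable X]setTI; exact: measurable_pathY.
have := stationary_path k mG.
rewrite (_ : _ @^-1` G = YS k @^-1` [set true]); last first.
  by apply/seteqP; split => w; rewrite /G /path_from /= addn0.
rewrite (_ : _ @^-1` G = YS 0%N @^-1` [set true])//.
Qed.

Hypothesis piC : 0 < pi C.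

Lemma regeneration_after_atom : Pbar nu (path_from m XS YS 0 @^-1` never_regenerates) = 0.
Proof.
have mnr := measurable_never_regenerates.
pose F k := YS k @^-1` [set true] `&` path_from m XS YS k.+1 @^-1` never_regenerates.
have mF k : measurable (F k).
  apply: measurableI; last exact: mpathG.
  by rewrite -[X in measurable X]setTI; exact: (split_measurableY (HS pi)).
have tF : trivIset setT F.
  apply/trivIsetP => i j _ _ ij.
  wlog ltij : i j ij / (i < j)%N.
    move=> H; case: (ltngtP i j) => ij'; [exact: H| |by rewrite ij' eqxx in ij].
    by rewrite setIC; apply: H => //; rewrite eq_sym.
  apply/seteqP; split => // w [[_ Ni] [Yj _]].
  have := Ni (j - i.+1)%N; rewrite /path_from /= subnKC//.
  by move: Yj => /= ->.
set p := Pbar nu _.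
have p0 : 0 <= p by exact: measure_ge0.
have pfin : p \is a fin_num by rewrite fin_num_measure//; exact: mpathG.
have piCfin : pi C \is a fin_num by rewrite fin_num_measure.
pose q := (delta * fine (pi C) * fine p)%R.
have FE k : Pbar pi (F k) = q%:E.
  rewrite /F path_after_regeneration// stationary_regeneration -/p.
  by rewrite /q !EFinM !fineK.
have sumle n : (n%:R * q <= 1)%R.
  rewrite -lee_fin (_ : (n%:R * q)%:E = Pbar pi (\big[setU/set0]_(k < n) F k)).
    exact: probability_le1 (bigsetU_measurable _ _).
  apply/esym; apply: (etrans (@measure_bigsetU _ _ _ (Pbar pi) F mF tF n)).
  rewrite (eq_bigr (fun=> q%:E)); last by move=> i _; exact: FE.
  by rewrite sumEFin sumr_const card_ord mulr_natl.
have q0 : (0 <= q)%R by rewrite !mulr_ge0 ?fine_ge0// ltW.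
have qE : q = 0%R.
  apply/eqP; rewrite eq_le q0 andbT leNgt; apply/negP => q_gt0.
  have := sumle (Num.truncn q^-1).+1; rewrite leNgt => /negP; apply.
  by rewrite -ltr_pdivrMr// div1r truncnS_gt.
have : (fine p == 0)%R.
  move: qE => /eqP; rewrite !mulf_eq0 => /orP[/orP[|]|//].
    by rewrite gt_eqF.
  by rewrite -eqe fineK// gt_eqF.
by rewrite -eqe fineK// => /eqP.
Qed.

Hypothesis pi_irr : irreducible P pi.
Hypothesis P_aper : aperiodic P pi.

Let h := path_prob never_regenerates.

Let mh : measurable_fun setT h.
Proof. by have [] := path_prob_markov measurable_never_regenerates. Qed.

Let h0 y : 0 <= h y. Proof. exact: path_prob_ge0. Qed.

Let h_harm y : h y = \int[kpow P m y]_z h z.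
Proof.
have mnr := measurable_never_regenerates.
have [_ /(_ (\d_y : probability T R) 1%N) E1] := path_prob_markov mnr.
set Pr := Pbar _ in E1 *.
have -> : \int[kpow P m y]_z h z = \int[Pr]_w h (XS (1 * m)%N w).
  rewrite (@integral_eq_law _ _ _ _ _ T R Pr (kpow P m y) setT (XS (1 * m)%N) id 1)//.
    by rewrite mul1e.
  move=> A mA; rewrite mul1e preimage_id.
  apply: (etrans (split_skeleton_step m0 mC rden r01 (HS (\d_y : probability T R)) HT mA)).
  have mk : measurable_fun setT (fun x => kpow P m x A).
    exact: (@measurable_kernel _ _ _ _ _ (kpow P m) _ mA).
  have := split_integral_law (HS (\d_y : probability T R))
    (mu0 := (\d_y : probability T R)) HT _ _ mk.
  rewrite probability_setT mul1e integral_dirac// diracT mul1e; apply => // D mD.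
  by rewrite setTI mul0n mul1e; exact: (split_initial_law mC (HS _)).
rewrite -E1 /h /path_prob -/Pr.
have := path_after_regeneration (\d_y : probability T R) 0 mnr.
rewrite regeneration_after_atom mule0 -/Pr => Y0.
set B := path_from m XS YS 1 @^-1` _.
have mB : measurable B by exact: mpathG.
set N := path_from m XS YS 0 @^-1` _.
have mN : measurable N by exact: mpathG.
have mY0 : measurable (YS 0%N @^-1` [set true]).
  by rewrite -[X in measurable X]setTI; exact: (split_measurableY (HS pi)).
apply/eqP; rewrite eq_le; apply/andP; split.
  apply: le_measure; rewrite ?inE// => w Nw j.
  by have := Nw j.+1; rewrite /path_from /= add0n add1n.
rewrite (@le_trans _ _ (Pr (N `|` (YS 0%N @^-1` [set true] `&` B))))//.
  apply: le_measure; rewrite ?inE//; first exact/measurableU/measurableI.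
  move=> w Bw; case Yw : (YS 0%N w); [by right|left => -[|j]].
    by rewrite /path_from /= addn0.
  by have := Bw j; rewrite /path_from /= add1n add0n.
have := @measureU2 _ _ _ Pr N (YS 0%N @^-1` [set true] `&` B) mN (measurableI _ _ mY0 mB).
by rewrite [X in _ + X]Y0 adde0.
Qed.

Lemma split_recurrent dO (Omega : measurableType dO) (X : nat -> Omega -> T)
    (Px : T -> probability Omega R) :
  (forall y, markov_chain P (Px y) (\d_y : probability T R) X) ->
  harris_recurrent pi Px X ->
  forall mu0 k, Pbar mu0 (path_from m XS YS k @^-1` never_regenerates) = 0.
Proof.
move=> HX harris mu0 k.
have mnr := measurable_never_regenerates.
have [_ hE] := path_prob_markov mnr.
have ex0 : exists x, h x = 0.
  apply: contrapT => /forallNP hn.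
  have : \int[nu]_x `|h x| = 0.
    under eq_integral do rewrite gee0_abs//.
    have := split_integral_law (HS nu) (mu0 := nu) HT _ h0 mh.
    rewrite probability_setT mul1e => <-; first by rewrite -hE regeneration_after_atom.
    move=> D mD; rewrite setTI mul0n mul1e.
    exact: (split_initial_law mC (HS _)).
  move=> /(ae_eq_integral_abs _ measurableT mh)[N [mN N0 hN]].
  have : nu setT <= nu N.
    by apply: le_measure; rewrite ?inE// => x _; apply: hN => /= /(_ Logic.I); exact: hn.
  by rewrite N0 probability_setT; rewrite leNgt lte01.
have [F [mF Fh Fabs piF]] :=
  aperiodic_absorbing pi_inv pi_irr P_aper m0 h0 mh h_harm ex0.
have h_iter j y : h y = \int[kpow P (j * m) y]_z h z.
  elim: j y => [|j ih] y.
    by rewrite mul0n -integral_kpow.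
  rewrite mulSn integral_kpow_add// h_harm.
  by apply: eq_integral => z _; exact: ih.
have h1 y : h y <= 1 by apply: probability_le1; exact: mpathG.
have h_eq0 y : h y = 0.
  apply/eqP; rewrite eq_le h0 andbT; apply/lee_addgt0Pr => e e0; rewrite add0e.
  have [N hN] := absorbing_hit_eventually (HX y) mF Fabs (harris _ mF piF y) e0.
  rewrite (h_iter N); apply: le_trans (ltW (hN (N * m)%N _)); last by rewrite leq_pmulr.
  have mFC := measurableC mF.
  apply: (@le_trans _ _ (\int[kpow P (N * m) y]_z (\1_(~` F) z)%:E)); last first.
    by rewrite integral_indic// setIT.
  apply: ge0_le_integral => //; first exact/measurable_EFinP.
  move=> z _; rewrite indicE; have [Fz|Fz] := pselect (F z).
    by rewrite Fh// lee_fin.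
  by rewrite mem_set.
rewrite hE; apply: integral0_eq => w _; exact: h_eq0.
Qed.

End stationary.

End split_family.

Section cylinders_without_marks.
Context d (T : measurableType d) (R : realType) (P : R.-pker T ~> T).
Variables (m : nat) (C : set T) (r : T -> T -> R).
Hypothesis m0 : (0 < m)%N.

Lemma cyl_setT J (A : nat -> set T) x :
  cyl P m C r J A (fun=> setT) x =
  (\1_(A 0%N) x)%:E * path_int P (fun i => A i.+1) (cst 1) (J * m) x.
Proof.
elim: J A x => [|J ih] A x; first by rewrite /= mule1.
rewrite /=; congr (_ * _); rewrite mulSn path_int_add.
rewrite (path_int_eq P x (B' := fun i => A i.+1) (g' := fun y =>
  path_int P (fun i => A (m + i.+1)%N) (cst 1) (J * m) y * (\1_(A m) y)%:E))//; last first.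
  by move=> y; rewrite set_weightT mul1e ih addn0 muleC.
rewrite -(prednK m0) -(path_int_setI P (fun i => A i.+1) (A m.-1.+1)).
apply: path_int_eq => [i im|y].
  by case: eqVneq => // ->; rewrite setIid.
by apply: path_int_eq => // i im; rewrite addnS.
Qed.

End cylinders_without_marks.

Section chain_and_split_chain.
Context d (T : measurableType d) (R : realType) (P : R.-pker T ~> T).
Variables (m : nat) (C : set T) (delta : R) (nu : probability T R) (r : T -> T -> R).
Hypothesis m0 : (0 < m)%N.
Hypothesis mC : measurable C.
Hypothesis rden : minorization_density P m C delta nu r.
Hypothesis r01 : forall x y, (0 <= r x y <= 1)%R.
Context dO (Omega : measurableType dO) (Pr : probability Omega R).
Context dS (OmegaS : measurableType dS) (PrS : probability OmegaS R).
Variables (X : nat -> Omega -> T) (XS : nat -> OmegaS -> T) (YS : nat -> OmegaS -> bool).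
Variable x : T.
Hypothesis HX : markov_chain P Pr (\d_x : probability T R) X.
Hypothesis HXS : split_chain P m C delta r PrS (\d_x : probability T R) XS YS.

Lemma chain_split_law (G : set (pathT T)) : measurable G ->
  Pr [set w | G (fun i => (X i w, false))] = PrS [set w | G (fun i => (XS i w, false))].
Proof.
have mX i : measurable_fun setT (X i) by case: HX.
have mXS i : measurable_fun setT (XS i) by case: HXS.
have mV : measurable_fun setT (fun w => (fun i => (X i w, false)) : pathT T).
  by apply: measurable_fun_path.
have mVS : measurable_fun setT (fun w => (fun i => (XS i w, false)) : pathT T).
  by apply: measurable_fun_path.
move=> mG.
have := @path_law_unique _ T R _ _ _ _ Pr PrS setT _ _ 1 measurableT mV mVS lee01 isT.
move=> /(_ _ G mG); rewrite setTI mul1e; apply => {G mG} J A S mA.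
rewrite setTI mul1e.
have [Sf|Sf] := pselect (forall i, (i < J)%N -> S i false); last first.
  have e0 (O : Type) (V : O -> pathT T) : (forall w i, (V w i).2 = false) ->
      V @^-1` rect J A S = set0.
    move=> V2; apply/seteqP; split => // w Vw; apply: Sf => i iJ.
    by have [_] := Vw i iJ; rewrite V2.
  by rewrite !e0// !measure0.
pose A' i := if (i < J)%N then A i else setT.
have mA' i : measurable (A' i) by rewrite /A'; case: ifP.
have mpath : measurable_fun setT (path_int P (fun i => A' i.+1) (cst 1) (J * m)).
  by apply: measurable_path_int.
have path0 y : 0 <= path_int P (fun i => A' i.+1) (cst 1) (J * m) y by exact: path_int_ge0.
transitivity (\int[(\d_x : probability T R)]_y
    ((\1_(A' 0%N) y)%:E * path_int P (fun i => A' i.+1) (cst 1) (J * m) y)).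
  rewrite -(markov_initial_integral HX); last 2 first.
  - by move=> y; rewrite mule_ge0.
  - by apply: emeasurable_funM => //; exact/measurable_EFinP.
  have HE : history X 0 (X 0%N @^-1` A' 0%N) by exact: historyX.
  have := markov_path_law HX (J * m) HE (fun i => mA' i.+1).
  rewrite (_ : _ `&` _ = (fun w => (fun i => (X i w, false)) : pathT T) @^-1` rect J A S).
    move=> h; apply: (etrans h); rewrite integral_in_indic.
    by apply: eq_integral => w _; rewrite muleC.
  apply/seteqP; split => w /=.
    move=> [A0 Aw] i iJ; split; last exact: Sf.
    case: i iJ A0 => [|i] iJ A0; first by move: A0; rewrite /A' iJ.
    have := Aw i; rewrite add0n /A' iJ; apply.
    by rewrite (leq_trans (ltnW iJ))// leq_pmulr.
  move=> h; split; first by rewrite /A'; case: ifPn => // /h[].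
  by move=> i iJ; rewrite add0n /A'; case: ifPn => // /h[].
have HT : split_history m XS YS 0 setT by exact: sigma_algebraT.
have := split_rect_law m0 mC rden r01 HXS J (fun=> setT) HT mA.
rewrite setTI (_ : _ @^-1` _ =
    (fun w => (fun i => (XS i w, false)) : pathT T) @^-1` rect J A S).
  move=> hS; apply/esym; apply: (etrans hS).
  have := split_integral_law HXS (mu0 := (\d_x : probability T R)) HT.
  rewrite probability_setT => h; rewrite h.
  - by rewrite mul1e; apply: eq_integral => y _; rewrite cyl_setT.
  - move=> D mD; rewrite setTI mul0n mul1e.
    exact: (split_initial_law mC HXS mD).
  - by move=> y; exact: cyl_ge0.
  - by have [mr _ _] := rden; exact: (measurable_cyl P m mC mr J _ mA').
apply/seteqP; split => w /= h i iJ; have [] := h i iJ.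
  by split => //; exact: Sf.
by [].
Qed.

End chain_and_split_chain.

(** * Blocks between regenerations *)

Section regeneration_counts.
Variable y : nat -> bool.

Lemma next_oneP l : match next_one y l with
  | Some k => [/\ (l <= k)%N, y k & forall j, (l <= j < k)%N -> ~~ y j]
  | None => forall k, (l <= k)%N -> ~~ y k end.
Proof.
rewrite /next_one; case: pselect => [ex|nex].
  case: ex_minnP => k /andP[lk yk] kmin; split => // j /andP[lj jk].
  apply/negP => yj; have := kmin j; rewrite lj yj => /(_ isT).
  by rewrite leqNgt jk.
by move=> k lk; apply/negP => yk; apply: nex; exists k; rewrite lk.
Qed.

Lemma next_one_Some l k : (l <= k)%N -> y k -> (forall j, (l <= j < k)%N -> ~~ y j) ->
  next_one y l = Some k.
Proof.
move=> lk yk hk; have := next_oneP l; case: next_one => [k'|/(_ k lk)]; last by rewrite yk.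
move=> [lk' yk' hk']; congr Some; case: (ltngtP k k') => // kk.
  by have := hk' k; rewrite lk kk yk => /(_ isT).
by have := hk k'; rewrite lk' kk yk' => /(_ isT).
Qed.

Definition count_before (k : nat) : nat := \sum_(j < k) y j.

Lemma count_beforeS k : count_before k.+1 = (count_before k + y k)%N.
Proof. by rewrite /count_before big_ord_recr. Qed.

Lemma count_before_le k l : (k <= l)%N -> (count_before k <= count_before l)%N.
Proof.
move=> /subnKC <-; elim: (l - k)%N => [|n ih]; first by rewrite addn0.
by rewrite addnS count_beforeS (leq_trans ih)// leq_addr.
Qed.

Lemma count_before_leq k : (count_before k <= k)%N.
Proof.
elim: k => [|k ih]; first by rewrite /count_before big_ord0.
by rewrite count_beforeS -addn1 leq_add// leq_b1.
Qed.

Lemma count_before_const k l : (k <= l)%N -> (forall j, (k <= j < l)%N -> ~~ y j) ->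
  count_before l = count_before k.
Proof.
move=> kl; rewrite -(subnKC kl); elim: (l - k)%N => [|n ih] h; first by rewrite addn0.
rewrite addnS count_beforeS ih.
  by rewrite (negbTE (h _ _)) ?addn0// leq_addr addnS /=.
by move=> j /andP[kj jn]; apply: h; rewrite kj addnS (ltn_trans jn).
Qed.

Lemma count_before_reach i k : (i < count_before k)%N ->
  exists b, [/\ (b < k)%N, y b & count_before b = i].
Proof.
elim: k => [|k ih]; first by rewrite /count_before big_ord0.
rewrite count_beforeS; case: (ltnP i (count_before k)) => [/ih[b [bk yb bi]] _|ki].
  by exists b; split => //; exact: ltnW.
case yk : (y k); last by rewrite addn0 ltnNge ki.
rewrite addn1 ltnS => ik; exists k; split => //.
by apply/eqP; rewrite eqn_leq ki ik.
Qed.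

Lemma sigma_timeP i k : sigma_time y i = Some k <-> y k /\ count_before k = i.
Proof.
elim: i k => [|i ih] k /=.
  split.
    move=> h; have := next_oneP 0; rewrite h => -[_ yk hk]; split => //.
    rewrite (@count_before_const 0 k)//; first by rewrite /count_before big_ord0.
  move=> [yk ck]; apply: next_one_Some => // j /= jk.
  apply/negP => yj; have := count_before_le jk.
  by rewrite count_beforeS yj ck addn1.
split.
  case si : (sigma_time y i) => [a|//] /= h.
  have [ya ca] := (ih a).1 si.
  have := next_oneP a.+1; rewrite h => -[ak yk hk]; split => //.
  by rewrite (count_before_const ak hk) count_beforeS ya ca addn1.
move=> [yk ck]; have [|a [ak ya ca]] := @count_before_reach i k; first by rewrite ck.
have -> /= : sigma_time y i = Some a by apply/ih.
apply: next_one_Some => // j /andP[aj jk]; apply/negP => yj.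
have : (count_before j.+1 <= count_before k)%N by exact: count_before_le.
rewrite count_beforeS yj ck addn1 ltnS => cj.
by have := leq_trans (count_before_le aj) cj; rewrite count_beforeS ya ca addn1 ltnn.
Qed.

Lemma sigma_time_next i k : sigma_time y i = Some k ->
  sigma_time y i.+1 = next_one y k.+1.
Proof. by move=> /= ->. Qed.

End regeneration_counts.

Section blocks.
Context d (T : measurableType d) (R : realType).
Variables (m : nat) (f : T -> R).
Context dO (Omega : measurableType dO) (X : nat -> Omega -> T) (Y : nat -> Omega -> bool).

Definition first_block (w : Omega) : R :=
  if sigma Y 0 w is Some k then (\sum_(0 <= j < k.+1) Zblock m f X j w)%R else 0%R.

Lemma first_block_abs w : `|first_block w|%:E <= abs_first_sum m f X Y w.
Proof.
rewrite /first_block /abs_first_sum; case: (sigma Y 0 w) => [k|].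
  by rewrite sumEFin lee_fin ler_norm_sum.
by rewrite normr0; apply: nneseries_ge0 => n _ _; rewrite lee_fin.
Qed.

Lemma abs_first_sum_partial w N :
  (if sigma Y 0 w is Some k then (N <= k.+1)%N else true) ->
  `|\sum_(0 <= j < N) Zblock m f X j w|%:E <= abs_first_sum m f X Y w.
Proof.
rewrite /abs_first_sum; case: (sigma Y 0 w) => [k Nk|_].
  rewrite sumEFin lee_fin (le_trans (ler_norm_sum _ _ _))//.
  rewrite [leRHS](big_cat_nat (n := N))//= lerDl.
  by rewrite sumr_ge0.
rewrite (@le_trans _ _ (\sum_(0 <= j < N) `|Zblock m f X j w|%:E))//.
  by rewrite sumEFin lee_fin ler_norm_sum.
by apply: nneseries_lim_ge => n _; rewrite lee_fin.
Qed.

End blocks.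

Section shifted_blocks.
Context d (T : measurableType d) (R : realType).
Variables (m : nat) (f : T -> R).
Context dO (Omega : measurableType dO) (X : nat -> Omega -> T) (Y : nat -> Omega -> bool).

Let pX (i : nat) (v : pathT T) : T := (v i).1.
Let pY (i : nat) (v : pathT T) : bool := (v i).2.

Definition block_from (k : nat) (w : Omega) : R :=
  first_block m f pX pY (path_from m X Y k w).

Lemma Zblock_path_from k j w :
  Zblock m f pX j (path_from m X Y k w) = Zblock m f X (k + j) w.
Proof.
rewrite /Zblock; apply: eq_bigr => i _.
by rewrite /pX /path_from /= mulnDl addnA.
Qed.

Lemma block_fromE k l w : next_one (Y ^~ w) k = Some l ->
  block_from k w = (\sum_(k <= j < l.+1) Zblock m f X j w)%R.
Proof.
move=> kl; have := next_oneP (Y ^~ w) k; rewrite kl => -[lek Yl hl].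
rewrite /block_from /first_block /sigma /=.
have -> : next_one (fun j => pY j (path_from m X Y k w)) 0 = Some (l - k)%N.
  apply: next_one_Some => //; rewrite /pY /path_from /= ?subnKC//.
  by move=> j jl; apply: hl; rewrite leq_addr -ltn_subRL.
rewrite -[in RHS](add0n k) big_addn subSn//; apply: eq_bigr => j _.
by rewrite Zblock_path_from addnC.
Qed.

Lemma block_from_None k w : next_one (Y ^~ w) k = None -> block_from k w = 0%R.
Proof.
move=> kn; have := next_oneP (Y ^~ w) k; rewrite kn => hk.
rewrite /block_from /first_block /sigma /=.
have := next_oneP (fun j => pY j (path_from m X Y k w)) 0.
case: next_one => // a [_ ya _]; have := hk (k + a)%N (leq_addr _ _).
by move: ya; rewrite /pY /path_from /= => ->.
Qed.

Lemma sblock_block_from i k w : sigma Y i w = Some k ->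
  sblock m f X Y i w = block_from k.+1 w.
Proof.
move=> si; rewrite /sblock si /sigma (sigma_time_next si).
case kl : (next_one _ k.+1) => [l|]; first by rewrite (block_fromE kl).
by rewrite block_from_None.
Qed.

Lemma block_from_step k w : (exists j, Y (k + j)%N w) ->
  Zblock m f X k w =
  (block_from k w - block_from k.+1 w + (Y k w)%:R * block_from k.+1 w)%R.
Proof.
move=> [j Yj]; case Yk : (Y k w).
  rewrite mul1r subrK (@block_fromE k k) ?big_nat1//.
  apply: next_one_Some => // i /andP[ki ik].
  by move: ki; rewrite leqNgt ik.
have := next_oneP (Y ^~ w) k.
case kl : next_one => [l|]; last by move=> /(_ _ (leq_addr j k)); rewrite Yj.
move=> [lk Yl hl]; rewrite mul0r addr0 (block_fromE kl).
have kl1 : (k < l)%N by rewrite ltn_neqAle lk andbT; apply: contraFneq Yk => ->.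
rewrite (@block_fromE k.+1 l); last first.
  apply: next_one_Some => // i /andP[ki il]; apply: hl; rewrite il andbT.
  exact: ltnW.
by rewrite big_ltn ?ltnS// addrK.
Qed.

Lemma sum_Zblock N w : (forall k, exists j, Y (k + j)%N w) ->
  (\sum_(0 <= k < N) Zblock m f X k w =
   block_from 0 w - block_from N w
   + \sum_(0 <= i < count_before (Y ^~ w) N) sblock m f X Y i w)%R.
Proof.
move=> rec; elim: N => [|N ih].
  by rewrite /count_before big_ord0 !big_geq// subrr addr0.
rewrite big_nat_recr//= ih (block_from_step (rec N)) count_beforeS.
case YN : (Y N w); last first.
  by rewrite addn0 mul0r addr0 addrAC [X in (X + _)%R]addrA subrK.
rewrite addn1 big_nat_recr//=.
have /sblock_block_from -> : sigma Y (count_before (Y ^~ w) N) w = Some N.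
  by apply/sigma_timeP.
by rewrite mul1r; ring.
Qed.

Lemma sblock_count j k w :
  (j.+1 < count_before (Y ^~ w) k)%N ->
  sblock m f X Y j w =
  (\sum_(0 <= l < k) Zblock m f X l w *+ (count_before (Y ^~ w) l == j.+1))%R.
Proof.
move=> jk.
have [a [ak Ya ca]] := count_before_reach (ltnW jk).
have [b [bk Yb cb]] := count_before_reach jk.
have sa : sigma Y j w = Some a by apply/sigma_timeP.
have sb : sigma Y j.+1 w = Some b by apply/sigma_timeP.
have ab : (a < b)%N.
  rewrite ltnNge; apply/negP => ba.
  by have := count_before_le (Y ^~ w) ba; rewrite ca cb ltnn.
have c1 : (\sum_(0 <= l < a.+1) Zblock m f X l w *+ (count_before (Y ^~ w) l == j.+1) = 0)%R.
  rewrite big_nat big1// => l /= la; rewrite ltn_eqF//= ltnS -[leqRHS]ca.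
  exact: count_before_le.
have c2 : (\sum_(b.+1 <= l < k) Zblock m f X l w *+ (count_before (Y ^~ w) l == j.+1) = 0)%R.
  rewrite big_nat big1// => l /andP[bl _]; rewrite gtn_eqF//.
  by have := count_before_le (Y ^~ w) bl; rewrite count_beforeS Yb cb addn1.
have ak1 : (a.+1 <= b.+1)%N by rewrite ltnS ltnW.
rewrite /sblock sa sb [RHS](big_cat_nat (n := a.+1))//= c1 add0r.
rewrite [RHS](big_cat_nat (n := b.+1))//= c2 addr0.
rewrite big_nat [RHS]big_nat; apply: eq_bigr => l /andP[al lb].
rewrite (_ : count_before (Y ^~ w) l == j.+1) ?mulr1n//.
rewrite eqn_leq -[X in (_ <= X)%N]cb count_before_le//=.
by have := count_before_le (Y ^~ w) al; rewrite count_beforeS Ya ca addn1.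
Qed.

End shifted_blocks.

Lemma measurable_fun_option d1 d2 (O : measurableType d1) (U : measurableType d2)
    (tau : O -> option nat) (g : option nat -> O -> U) :
  (forall k, measurable (tau @^-1` [set Some k])) ->
  (forall o, measurable_fun setT (g o)) ->
  measurable_fun setT (fun w => g (tau w) w).
Proof.
move=> mtau mg.
have mNone : measurable (tau @^-1` [set None]).
  rewrite (_ : _ @^-1` _ = ~` \bigcup_k tau @^-1` [set Some k]).
    by apply: measurableC; exact: bigcup_measurable.
  apply/seteqP; split => [w /= tN [k _ /=]|w /= h]; first by rewrite tN.
  by case tw : (tau w) => [k|//]; case: h; exists k.
move=> _ B mB; rewrite setTI.
rewrite (_ : _ @^-1` B = (tau @^-1` [set None] `&` g None @^-1` B) `|`
   \bigcup_k (tau @^-1` [set Some k] `&` g (Some k) @^-1` B)).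
  apply: measurableU; first by apply: measurableI => //; rewrite -[X in measurable X]setTI; exact: mg.
  apply: bigcup_measurable => k _.
  by apply: measurableI => //; rewrite -[X in measurable X]setTI; exact: mg.
apply/seteqP; split => [w /= Bw|w [[/= -> //]|[k _ [/= -> //]]]].
by case tw : (tau w) Bw => [k|] Bw; [right; exists k|left].
Qed.

Section regeneration_measurability.
Context d (T : measurableType d) (R : realType).
Variables (m : nat) (f : T -> R).
Hypothesis mf : measurable_fun setT f.
Context dO (Omega : measurableType dO) (X : nat -> Omega -> T) (Y : nat -> Omega -> bool).

Lemma split_history_count k i :
  split_history m X Y k [set w | count_before (Y ^~ w) k = i].
Proof.
elim: k i => [|k ih] i.
  have [->|i0] := eqVneq i 0%N.
    rewrite (_ : [set _ | _] = setT); first exact: sigma_algebraT.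
    by apply/seteqP; split => // w _; rewrite /= /count_before big_ord0.
  rewrite (_ : [set _ | _] = set0); first exact: sigma_algebra0.
  by apply/seteqP; split => // w; rewrite /= /count_before big_ord0 => /eqP; rewrite eq_sym (negbTE i0).
have ih' j := split_history_sub (leqnSn k) (ih j).
have yt b : split_history m X Y k.+1 (Y k @^-1` [set b]) by exact: split_historyY.
rewrite (_ : [set _ | _] =
  (Y k @^-1` [set false] `&` [set w | count_before (Y ^~ w) k = i]) `|`
  (Y k @^-1` [set true] `&` [set w | (count_before (Y ^~ w) k).+1 = i])); last first.
  apply/seteqP; split => w /=; rewrite count_beforeS; case: (Y k w);
    rewrite ?addn1 ?addn0; [by right|by left|by case=> -[]|by case=> -[]].
apply: sigma_algebraU; apply: sigma_algebraI; [exact: yt|exact: ih'|exact: yt|].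
have [->|i0] := eqVneq i 0%N.
  by have -> : [set w | (count_before (Y ^~ w) k).+1 = 0%N] = set0;
    [apply/seteqP; split|exact: sigma_algebra0].
have -> : [set w | (count_before (Y ^~ w) k).+1 = i] = [set w | count_before (Y ^~ w) k = i.-1].
  by rewrite -(prednK (n := i)) ?lt0n//; apply/seteqP; split => w /= => [[]|->].
exact: ih'.
Qed.

Lemma sigma_event i k : [set w | sigma Y i w = Some k] =
  [set w | count_before (Y ^~ w) k = i] `&` Y k @^-1` [set true].
Proof.
by apply/seteqP; split => w /=; [move/sigma_timeP => -[]|move=> [h1 h2]; apply/sigma_timeP].
Qed.

Hypothesis mX : forall i, measurable_fun setT (X i).
Hypothesis mY : forall i, measurable_fun setT (Y i).

Lemma measurable_sigma i k : measurable [set w | sigma Y i w = Some k].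
Proof.
rewrite sigma_event; apply: measurableI.
  by apply: (@split_history_measurable _ _ _ _ m X Y k mX mY); exact: split_history_count.
by rewrite -[X in measurable X]setTI; exact: mY.
Qed.

Lemma measurable_Zblock j : measurable_fun setT (Zblock m f X j).
Proof. by apply: measurable_sum => k; exact: measurableT_comp. Qed.

Lemma measurable_first_block : measurable_fun setT (first_block m f X Y).
Proof.
apply: (measurable_fun_option (tau := sigma Y 0) (g := fun o w =>
  if o is Some k then (\sum_(0 <= j < k.+1) Zblock m f X j w)%R else 0%R)).
  by move=> k; exact: measurable_sigma.
by case=> [k|] //; apply: measurable_sum => j; exact: measurable_Zblock.
Qed.

Lemma measurable_sblock i : measurable_fun setT (sblock m f X Y i).
Proof.
apply: (measurable_fun_option (tau := sigma Y i) (g := fun o w =>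
  match o, sigma Y i.+1 w with
  | Some k, Some l => (\sum_(k.+1 <= j < l.+1) Zblock m f X j w)%R
  | _, _ => 0%R end)).
  by move=> k; exact: measurable_sigma.
case=> [k|] //; apply: (measurable_fun_option (tau := sigma Y i.+1) (g := fun o w =>
  match o with
  | Some l => (\sum_(k.+1 <= j < l.+1) Zblock m f X j w)%R
  | _ => 0%R end)).
  by move=> l; exact: measurable_sigma.
by case=> [l|] //; apply: measurable_sum => j; exact: measurable_Zblock.
Qed.

Lemma measurable_abs_first_sum : measurable_fun setT (abs_first_sum m f X Y).
Proof.
have mZ j : measurable_fun setT (fun w => `|Zblock m f X j w|%:E).
  by apply/measurable_EFinP; apply: measurableT_comp => //; exact: measurable_Zblock.
apply: (measurable_fun_option (tau := sigma Y 0) (g := fun o w =>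
  if o is Some k then \sum_(0 <= i < k.+1) `|Zblock m f X i w|%:E
  else \sum_(0 <= i <oo) `|Zblock m f X i w|%:E)).
  by move=> k; exact: measurable_sigma.
case=> [k|]; first by apply: emeasurable_sum => j; exact: mZ.
by apply: ge0_emeasurable_sum => // j w _ _; rewrite lee_fin.
Qed.

End regeneration_measurability.

Section regeneration_blocks.
Context d (T : measurableType d) (R : realType).
Variables (m : nat) (f : T -> R).
Hypothesis mf : measurable_fun setT f.
Context dO (Omega : measurableType dO) (X : nat -> Omega -> T) (Y : nat -> Omega -> bool).
Hypothesis mX : forall i, measurable_fun setT (X i).
Hypothesis mY : forall i, measurable_fun setT (Y i).

Lemma split_history_sblock_partial k j (B : set R) : measurable B ->
  split_history m X Y k ((fun w =>
    (\sum_(0 <= l < k) Zblock m f X l w *+ (count_before (Y ^~ w) l == j.+1))%R) @^-1` B).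
Proof.
move=> mB.
pose G := [set E | exists i A, [/\ (i <= k * m)%N, measurable A & E = X i @^-1` A]]
      `|` [set E | exists i b, (i < k)%N /\ E = Y i @^-1` [set b]].
pose g : g_sigma_algebraType G -> R := fun w =>
  (\sum_(l < k) \sum_(i < m) f (X (l * m + i)%N w) * \1_[set w | count_before (Y ^~ w) l = j.+1] w)%R.
have mg : measurable_fun setT g.
  apply: measurable_sum => l; apply: measurable_sum => i; apply: measurable_funM.
    move=> _ A mA; rewrite setTI; apply: sub_sigma_algebra; left.
    exists (l * m + i)%N, (f @^-1` A); split => //; last by rewrite -[X in measurable X]setTI; exact: mf.
    by rewrite (@leq_trans (l.+1 * m))// ?leq_mul2r ?ltn_ord ?orbT// mulSn addnC leq_add2r ltnW.
  apply: measurable_indic.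
  apply: (split_history_sub (ltnW (ltn_ord l))); exact: split_history_count.
have := mg measurableT B mB; rewrite setTI.
rewrite (_ : g = fun w =>
    (\sum_(0 <= l < k) Zblock m f X l w *+ (count_before (Y ^~ w) l == j.+1))%R)//.
apply/funext => w; rewrite big_mkord; apply: eq_bigr => l _.
rewrite -mulr_suml -mulr_natr /Zblock indicE; congr (_ * (nat_of_bool _)%:R)%R.
by apply/idP/eqP => [/set_mem//|h]; exact: mem_set.
Qed.

(* s_(i-1) involves the block at sigma(i), whose inner points depend on the state
   from which s_i starts; hence the gap j + 1 < i. *)
Definition sblock_past (i : nat) : set (set Omega) :=
  <<s [set E | exists j B, [/\ (j.+1 < i)%N, measurable B & E = sblock m f X Y j @^-1` B]] >>.

Lemma sblock_past_event i H : sblock_past i H -> measurable H /\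
  forall k, exists2 E, split_history m X Y k E &
    H `&` [set w | sigma Y i w = Some k] = E `&` Y k @^-1` [set true].
Proof.
pose F := [set H : set Omega | measurable H /\
  forall k, exists2 E, split_history m X Y k E &
    H `&` [set w | sigma Y i w = Some k] = E `&` Y k @^-1` [set true]].
suff : sblock_past i `<=` F by move=> h /h.
apply: smallest_sub; first split.
- split => // k; exists set0; first exact: sigma_algebra0.
  by rewrite !set0I.
- move=> A [mA hA]; split; first by rewrite setTD; exact: measurableC.
  move=> k; have [E HE hE] := hA k.
  exists ([set w | count_before (Y ^~ w) k = i] `&` (setT `\` E)).
    apply: sigma_algebraI; first exact: split_history_count.
    exact: sigma_algebraCD.
  rewrite sigma_event; rewrite sigma_event in hE.
  apply/seteqP; split => w /=.
    move=> [[_ nA] [ci Yk]]; split => //; split => //; split => // Ew.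
    have [] : (A `&` ([set w | count_before (Y ^~ w) k = i] `&` Y k @^-1` [set true])) w.
      by rewrite hE.
    by move=> /nA.
  move=> [[ci [_ nE]] Yk]; split => //; split => // Aw; apply: nE.
  by have [] : (E `&` Y k @^-1` [set true]) w by rewrite -hE.
- move=> A hA; split; first by apply: bigcup_measurable => j _; have [] := hA j.
  move=> k.
  have /choice[E hE] : forall j, exists E, split_history m X Y k E /\
     A j `&` [set w | sigma Y i w = Some k] = E `&` Y k @^-1` [set true].
    by move=> j; have [_ /(_ k)[E HE hE]] := hA j; exists E.
  exists (\bigcup_j E j); first by apply: sigma_algebra_bigcup => j; have [] := hE j.
  rewrite !setI_bigcupl; apply: eq_bigcupr => j _; by have [] := hE j.
move=> _ [j [B [ji mB ->]]]; split.
  by rewrite -[X in measurable X]setTI; exact: measurable_sblock.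
move=> k; exists ([set w | count_before (Y ^~ w) k = i] `&` (fun w =>
    (\sum_(0 <= l < k) Zblock m f X l w *+ (count_before (Y ^~ w) l == j.+1))%R) @^-1` B).
  by apply: sigma_algebraI; [exact: split_history_count|exact: split_history_sblock_partial].
rewrite sigma_event; apply/seteqP; split => w /=.
  by move=> [Bw [ci Yk]]; split => //; split => //; rewrite -sblock_count// ci.
by move=> [[ci Bw] Yk]; split => //; rewrite (@sblock_count _ _ _ _ _ _ _ _ _ _ k)// ci.
Qed.

End regeneration_blocks.

Section regeneration_family.
Context d (T : measurableType d) (R : realType) (P : R.-pker T ~> T).
Variables (m : nat) (C : set T) (delta : R) (nu : probability T R) (r : T -> T -> R).
Hypothesis m0 : (0 < m)%N.
Hypothesis mC : measurable C.
Hypothesis delta0 : (0 < delta)%R.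
Hypothesis rden : minorization_density P m C delta nu r.
Hypothesis r01 : forall x y, (0 <= r x y <= 1)%R.
Context dS (OmegaS : measurableType dS).
Variables (XS : nat -> OmegaS -> T) (YS : nat -> OmegaS -> bool).
Variable Pbar : probability T R -> probability OmegaS R.
Hypothesis HS : forall mu0, split_chain P m C delta r (Pbar mu0) mu0 XS YS.
Hypothesis rec : forall mu0 k, Pbar mu0 (path_from m XS YS k @^-1` @never_regenerates _ T) = 0.
Variable f : T -> R.
Hypothesis mf : measurable_fun setT f.

Let mXS i : measurable_fun setT (XS i). Proof. by case: (HS nu). Qed.
Let mYS i : measurable_fun setT (YS i). Proof. by case: (HS nu). Qed.

Let mpath k : measurable_fun setT (path_from m XS YS k).
Proof. exact: measurable_path_from (HS nu) k. Qed.

Let mpathG k G : measurable G -> measurable (path_from m XS YS k @^-1` G).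
Proof. by move=> mG; rewrite -[X in measurable X]setTI; exact: mpath. Qed.

Definition path_block : pathT T -> R :=
  first_block m f (fun i (v : pathT T) => (v i).1) (fun i v => (v i).2).

Lemma measurable_path_block : measurable_fun setT path_block.
Proof.
by apply: measurable_first_block => // i; [exact: measurable_pathX|exact: measurable_pathY].
Qed.

Lemma measurable_block_from k : measurable_fun setT (block_from m f XS YS k).
Proof. exact: (measurableT_comp measurable_path_block (mpath k)). Qed.

Definition dies : set OmegaS := \bigcup_k path_from m XS YS k @^-1` @never_regenerates _ T.

Lemma measurable_dies : measurable dies.
Proof.
by apply: bigcup_measurable => k _; apply: mpathG; exact: measurable_never_regenerates.
Qed.

Lemma dies_null mu0 : Pbar mu0 dies = 0.
Proof.
apply: measure_negligible; first exact: measurable_dies.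
apply: negligible_bigcup => k; exists (path_from m XS YS k @^-1` @never_regenerates _ T).
split; [apply: mpathG; exact: measurable_never_regenerates|exact: rec|by []].
Qed.

Lemma survives w : ~ dies w -> forall k, exists j, YS (k + j)%N w.
Proof.
move=> nd k; apply: contrapT => /forallNP h; apply: nd; exists k => // j.
by apply/negP => Yj; apply: (h j).
Qed.

Lemma sigma_finite_survives w i : ~ dies w -> exists k, sigma YS i w = Some k.
Proof.
move=> /survives hw; have nx k : exists l, next_one (YS ^~ w) k = Some l.
  have := next_oneP (YS ^~ w) k; case: next_one => [l _|h]; first by exists l.
  by have [j Yj] := hw k; have := h _ (leq_addr j k); rewrite Yj.
elim: i => [|i [k ik]]; first exact: nx.
have [l lk] := nx k.+1; exists l.
by rewrite /sigma (sigma_time_next ik).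
Qed.

Lemma measure_eq_survives mu0 (A B : set OmegaS) : measurable A -> measurable B ->
  (forall w, ~ dies w -> A w <-> B w) -> Pbar mu0 A = Pbar mu0 B.
Proof.
suff le A' B' : measurable A' -> measurable B' -> (forall w, ~ dies w -> A' w -> B' w) ->
    Pbar mu0 A' <= Pbar mu0 B'.
  by move=> mA mB AB; apply/eqP; rewrite eq_le !le// => w /AB[].
move=> mA mB AB; rewrite -[leRHS]adde0 -(dies_null mu0).
apply: (le_trans _ (measureU2 _ _ _)) => //; last exact: measurable_dies.
apply: le_measure; rewrite ?inE//.
  by apply: measurableU => //; exact: measurable_dies.
move=> w Aw; have [dw|dw] := pselect (dies w); first by right.
by left; exact: AB.
Qed.

Lemma sigma_decomposition mu0 i G : measurable G -> Pbar mu0 G =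
  \sum_(0 <= k <oo) Pbar mu0 (G `&` [set w | sigma YS i w = Some k]).
Proof.
move=> mG.
have mGk k : measurable (G `&` [set w | sigma YS i w = Some k]).
  by apply: measurableI => //; exact: (measurable_sigma m mXS).
have tG : trivIset setT (fun k => G `&` [set w | sigma YS i w = Some k]).
  apply/trivIsetP => k l _ _ /eqP kl; apply/seteqP; split => // w [[_ /= ->] [_ /= [kl']]].
  exact: kl.
have mU := bigcup_measurable (fun k _ => mGk k).
transitivity (Pbar mu0 (\bigcup_k (G `&` [set w | sigma YS i w = Some k]))); last first.
  by apply: measure_semi_bigcup.
apply: measure_eq_survives => //.
move=> w /(@sigma_finite_survives w i)[k ik]; split; last by move=> [? _ []].
by move=> Gw; exists k.
Qed.

Lemma sblock_independent mu0 i H B : sblock_past m f XS YS i H -> measurable B ->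
  Pbar mu0 (H `&` sblock m f XS YS i @^-1` B) =
  Pbar mu0 H * Pbar nu (block_from m f XS YS 0 @^-1` B).
Proof.
move=> /(sblock_past_event mf mXS mYS)[mH hH] mB.
have ms : measurable (sblock m f XS YS i @^-1` B).
  by rewrite -[X in measurable X]setTI; exact: measurable_sblock.
have dec G mG := @sigma_decomposition mu0 i G mG.
have mb : measurable (block_from m f XS YS 0 @^-1` B).
  by rewrite -[X in measurable X]setTI; exact: measurable_block_from.
have [q qE] : exists q, Pbar nu (block_from m f XS YS 0 @^-1` B) = q%:E.
  by eexists; apply/esym/fineK; exact: fin_num_measure.
rewrite (dec _ (measurableI _ _ mH ms)) [in RHS](dec _ mH) qE muleC -nneseriesZl//.
apply: eq_eseriesr => k _; have [E HE hE] := hH k.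
rewrite hE muleC -qE.
have G0 : measurable (path_block @^-1` B).
  by rewrite -[X in measurable X]setTI; exact: measurable_path_block.
have := split_regeneration m0 mC (ltW delta0) rden r01 (HS mu0) (HS nu) HE G0.
move=> h; apply: (etrans _ h); rewrite -hE; congr (Pbar mu0 _).
apply/seteqP; split => w /=.
  by move=> [[Hw Bw] sw]; split => //; rewrite (sblock_block_from m f XS sw) in Bw.
by move=> [[Hw sw] Bw]; split => //; split => //; rewrite (sblock_block_from m f XS sw).
Qed.

Lemma sblock_law mu0 i B : measurable B -> Pbar mu0 (sblock m f XS YS i @^-1` B) =
  Pbar nu (block_from m f XS YS 0 @^-1` B).
Proof.
move=> mB; have HT : sblock_past m f XS YS i setT by exact: sigma_algebraT.
by have := sblock_independent mu0 HT mB; rewrite setTI probability_setT mul1e.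
Qed.

End regeneration_family.

Section change_of_law_signed.
Context d1 d2 d3 (O1 : measurableType d1) (O2 : measurableType d2)
  (S : measurableType d3) (R : realType).
Variables (m1 : {measure set O1 -> \bar R}) (m2 : {measure set O2 -> \bar R}).

Lemma integral_eq_law_signed (E : set O1) (V1 : O1 -> S) (V2 : O2 -> S) (q : R) :
  measurable E -> measurable_fun setT V1 -> measurable_fun setT V2 -> (0 < q)%R ->
  (forall A, measurable A -> m1 (E `&` V1 @^-1` A) = q%:E * m2 (V2 @^-1` A)) ->
  forall phi : S -> R, measurable_fun setT phi ->
  (m1.-integrable E (fun w => (phi (V1 w))%:E) <->
   m2.-integrable setT (fun w => (phi (V2 w))%:E)) /\
  (m2.-integrable setT (fun w => (phi (V2 w))%:E) ->
   \int[m1]_(w in E) (phi (V1 w))%:E = q%:E * \int[m2]_w (phi (V2 w))%:E).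
Proof.
move=> mE mV1 mV2 q0 h phi mphi.
have q0' : 0 <= q%:E by rewrite lee_fin ltW.
have mphiE : measurable_fun setT (EFin \o phi) by exact/measurable_EFinP.
have ge0_law (g : S -> \bar R) : (forall x, 0 <= g x) -> measurable_fun setT g ->
    \int[m1]_(w in E) g (V1 w) = q%:E * \int[m2]_w g (V2 w).
  exact: (integral_eq_law mE mV1 mV2 q0' isT h).
have mp1 : measurable_fun E (fun w => (phi (V1 w))%:E).
  apply/measurable_EFinP; apply: measurable_funTS; exact: measurableT_comp.
have mp2 : measurable_fun setT (fun w => (phi (V2 w))%:E).
  apply/measurable_EFinP; exact: measurableT_comp.
split.
  have e : \int[m1]_(w in E) `|(phi (V1 w))%:E| = q%:E * \int[m2]_w `|(phi (V2 w))%:E|.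
    apply: (ge0_law (fun y => `|(phi y)%:E|)) => //.
    by apply: measurableT_comp.
  have i0 : 0 <= \int[m2]_w `|(phi (V2 w))%:E| by exact: integral_ge0.
  split=> /integrableP[_ i]; apply/integrableP; split => //.
    move: i; rewrite e; case: (\int[m2]_w `|(phi (V2 w))%:E|) i0 => [s||]//.
      by move=> _ _; rewrite ltry.
    by rewrite gt0_muley ?lte_fin.
  by rewrite e; exact: lte_mul_pinfty.
move=> i2; rewrite [LHS]integralE [in RHS]integralE.
have -> : \int[m1]_(w in E) (fun w => (phi (V1 w))%:E)^\+ w =
    q%:E * \int[m2]_w (fun w => (phi (V2 w))%:E)^\+ w.
  transitivity (\int[m1]_(w in E) ((EFin \o phi)^\+ (V1 w))).
    by apply: eq_integral => w _; rewrite !funeposE.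
  rewrite (ge0_law ((EFin \o phi)^\+))//; last exact: measurable_funepos.
  by congr (_ * _); apply: eq_integral => w _; rewrite !funeposE.
have -> : \int[m1]_(w in E) (fun w => (phi (V1 w))%:E)^\- w =
    q%:E * \int[m2]_w (fun w => (phi (V2 w))%:E)^\- w.
  transitivity (\int[m1]_(w in E) ((EFin \o phi)^\- (V1 w))).
    by apply: eq_integral => w _; rewrite !funenegE.
  rewrite (ge0_law ((EFin \o phi)^\-))//; last exact: measurable_funeneg.
  by congr (_ * _); apply: eq_integral => w _; rewrite !funenegE.
rewrite [RHS]muleDr ?muleN//; exact: integrable_add_def.
Qed.
End change_of_law_signed.

Section stationary_blocks.
Context d (T : measurableType d) (R : realType) (P : R.-pker T ~> T).
Variables (m : nat) (C : set T) (delta : R) (nu : probability T R) (r : T -> T -> R).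
Hypothesis m0 : (0 < m)%N.
Hypothesis mC : measurable C.
Hypothesis delta0 : (0 < delta)%R.
Hypothesis rden : minorization_density P m C delta nu r.
Hypothesis r01 : forall x y, (0 <= r x y <= 1)%R.
Context dS (OmegaS : measurableType dS).
Variables (XS : nat -> OmegaS -> T) (YS : nat -> OmegaS -> bool).
Variable Pbar : probability T R -> probability OmegaS R.
Hypothesis HS : forall mu0, split_chain P m C delta r (Pbar mu0) mu0 XS YS.
Hypothesis rec : forall mu0 k, Pbar mu0 (path_from m XS YS k @^-1` @never_regenerates _ T) = 0.
Variable f : T -> R.
Hypothesis mf : measurable_fun setT f.
Variable pi : probability T R.
Hypothesis pi_inv : invariant_law P pi.

Let mXS i : measurable_fun setT (XS i). Proof. by case: (HS nu). Qed.
Let mYS i : measurable_fun setT (YS i). Proof. by case: (HS nu). Qed.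

Lemma stationary_within_block k A : (k < m)%N -> measurable A ->
  Pbar pi (XS k @^-1` A) = pi A.
Proof.
case: k => [|k] km mA.
  by have := stationary_skeleton m0 mC rden r01 HS pi_inv 0 mA; rewrite mul0n.
have [mr _ _] := rden.
have HT : split_history m XS YS 0 setT by exact: sigma_algebraT.
have := @split_block_law _ _ _ P m C delta r mC mr r01 _ _ (Pbar pi) pi XS YS (HS pi) 0 setT setT
  (fun i => if i == k then setT `&` A else setT) HT.
rewrite (_ : setT `&` _ = XS k.+1 @^-1` A); last first.
  apply/seteqP; split => w /=.
    by move=> [_ [_ /(_ k)]]; rewrite eqxx mul0n add0n => /(_ (ltnW km))[].
  by move=> Aw; split => //; split => // j jm; case: ifP => // /eqP ->; rewrite mul0n add0n.
move=> h; apply: (etrans (h _)); first by move=> j; case: ifP => // _; exact: measurableI.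
rewrite -(invariant_kpow pi_inv k.+1 mA).
have mk : measurable_fun setT (fun x => kpow P k.+1 x A).
  exact: (@measurable_kernel _ _ _ _ _ (kpow P k.+1) _ mA).
have := split_integral_law (HS pi) (mu0 := pi) HT _ (fun x => measure_ge0 _ _) mk.
rewrite probability_setT mul1e => <-; last first.
  by move=> D mD; rewrite setTI mul1e (stationary_skeleton m0 mC rden r01 HS pi_inv 0).
apply: eq_integral => w _; rewrite mul0n.
apply: (etrans _ (path_int_kpow P k.+1 (XS 0%N w) mA)).
have -> : forall B g x, path_int P B g m x = path_int P B g (k.+1 + (m - k.+1)) x.
  by move=> B g x; rewrite subnKC// ltnW.
rewrite path_int_add -[RHS](path_int_eq P (B := fun=> setT)
  (g := fun y => cst 1 y * (\1_A y)%:E))//; last by move=> y; rewrite mul1e.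
rewrite -(path_int_setI P (fun=> setT) A _ k); apply: path_int_eq => // y.
rewrite (path_int_eq P y (B' := fun=> setT) (g' := fun z => (\1_setT z)%:E)).
- by rewrite path_int_kpow// kpow_setT.
- by move=> i _; rewrite gtn_eqF// addSn ltnS leq_addr.
- by move=> z; rewrite set_weightT indicT.
Qed.

Let mb k : measurable_fun setT (block_from m f XS YS k).
Proof. exact: (measurable_block_from nu HS mf). Qed.

Lemma stationary_block k B : measurable B ->
  Pbar pi (block_from m f XS YS k @^-1` B) = Pbar pi (block_from m f XS YS 0 @^-1` B).
Proof.
move=> mB; have mG : measurable (path_block m f @^-1` B : set (pathT T)).
  by rewrite -[X in measurable X]setTI; exact: measurable_path_block.
exact: (stationary_path m0 mC rden r01 HS pi_inv k mG).
Qed.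

Hypothesis piC : 0 < pi C.
Hypothesis int_f : pi.-integrable setT (EFin \o f).
Hypothesis mean_f : \int[pi]_y (f y)%:E = 0.

Lemma Zblock_mean : (Pbar pi).-integrable setT (EFin \o Zblock m f XS 0) /\
  \int[Pbar pi]_w (Zblock m f XS 0 w)%:E = 0.
Proof.
have fk k : (k < m)%N -> (Pbar pi).-integrable setT (fun w => (f (XS (0 * m + k)%N w))%:E) /\
    \int[Pbar pi]_w (f (XS (0 * m + k)%N w))%:E = 0.
  move=> km; rewrite mul0n add0n.
  have [|h1 h2] := @integral_eq_law_signed _ _ _ _ _ T R (Pbar pi) pi setT (XS k) id 1 measurableT
      (mXS k) (@measurable_id _ _ _) ltr01 _ f mf.
    by move=> A mA; rewrite setTI mul1e; exact: stationary_within_block.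
  by split; [apply/h1|rewrite (h2 int_f) mean_f mule0].
have e w : (Zblock m f XS 0 w)%:E = \sum_(k < m) (f (XS (0 * m + k)%N w))%:E.
  by rewrite -sumEFin.
split.
  rewrite (_ : _ \o _ = fun w => \sum_(k < m) (f (XS (0 * m + k)%N w))%:E); last first.
    by apply/funext => w /=; exact: e.
  by apply: integrable_sum => // k _; have [] := fk k (ltn_ord k).
rewrite (eq_integral _ _ (fun w _ => e w)) integral_sum//.
  by rewrite big1// => k _; have [] := fk k (ltn_ord k).
by move=> k; have [] := fk k (ltn_ord k).
Qed.

Let regen_pos : exists2 th : R, (0 < th)%R &
  forall k, Pbar pi (YS k @^-1` [set true]) = th%:E.
Proof.
exists (delta * fine (pi C))%R.
  by rewrite mulr_gt0// fine_gt0// piC ltey_eq fin_num_measure.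
move=> k; rewrite (stationary_regeneration m0 mC rden r01 HS pi_inv).
by rewrite EFinM fineK// fin_num_measure.
Qed.

Lemma block_mean : (Pbar pi).-integrable setT (EFin \o block_from m f XS YS 0) ->
  (Pbar nu).-integrable setT (EFin \o block_from m f XS YS 0) /\
  \int[Pbar nu]_w (block_from m f XS YS 0 w)%:E = 0.
Proof.
move=> i0; have [th th0 hth] := regen_pos.
have mY0 : measurable (YS 0%N @^-1` [set true]).
  by rewrite -[X in measurable X]setTI; exact: mYS.
have [|h1 h2] := @integral_eq_law_signed _ _ _ _ _ _ R (Pbar pi) (Pbar pi) setT
   (block_from m f XS YS 1) (block_from m f XS YS 0) 1 measurableT (mb 1) (mb 0) ltr01 _ id
   (@measurable_id _ _ _).
  by move=> A mA; rewrite setTI mul1e; exact: stationary_block.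
have i1 := h1.2 i0; have e1 := h2 i0; rewrite mul1e in e1.
have [|h3 h4] := @integral_eq_law_signed _ _ _ _ _ _ R (Pbar pi) (Pbar nu) (YS 0%N @^-1` [set true])
   (block_from m f XS YS 1) (block_from m f XS YS 0) th mY0 (mb 1) (mb 0) th0 _ id
   (@measurable_id _ _ _).
  move=> A mA.
  have mG : measurable (path_block m f @^-1` A : set (pathT T)).
    by rewrite -[X in measurable X]setTI; exact: measurable_path_block.
  rewrite -(hth 0%N).
  exact: (path_after_regeneration m0 mC delta0 rden r01 HS pi 0 mG).
have iY : (Pbar pi).-integrable (YS 0%N @^-1` [set true]) (EFin \o block_from m f XS YS 1).
  exact: (integrableS measurableT _ (@subsetT _ _) i1).
have inu := h3.1 iY; split => //; have e2 := h4 inu.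
have [iZ eZ] := Zblock_mean.
have := eZ.
pose D k w := (block_from m f XS YS k w)%:E.
have iY' : (Pbar pi).-integrable setT (D 1%N \_ (YS 0%N @^-1` [set true])).
  exact/(integrable_mkcond _ mY0).1.
have iD : (Pbar pi).-integrable setT (fun w => D 0%N w - D 1%N w) by exact: integrableB.
rewrite (@ae_eq_integral _ _ _ _ _ (fun w => (D 0%N w - D 1%N w) +
    (D 1%N \_ (YS 0%N @^-1` [set true])) w))//; last 3 first.
- exact: measurable_int iZ.
- have iS := integrableD measurableT iD iY'; exact: measurable_int iS.
- exists (dies m XS YS); split; [exact: (measurable_dies nu HS)|exact: (dies_null nu HS rec)|].
  move=> w /= nw; apply: contrapT => nd; apply: nw => _.
  rewrite (block_from_step m f XS (survives nd 0)) EFinD EFinB; congr (_ + _).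
  rewrite patchE; case: ifPn => [/set_mem /= ->|/negP nY]; first by rewrite mul1r.
  case Y0 : (YS 0%N w); last by rewrite mul0r.
  by case: nY; exact: mem_set.
rewrite integralD// integralB// -integral_mkcond.
have f0 : \int[Pbar pi]_w D 0%N w \is a fin_num by exact: integrable_fin_num.
have e1' : \int[Pbar pi]_w D 1%N w = \int[Pbar pi]_w D 0%N w by exact: e1.
have e2' : \int[Pbar pi]_(w in YS 0%N @^-1` [set true]) D 1%N w =
   th%:E * \int[Pbar nu]_w D 0%N w by exact: e2.
rewrite e1' e2' subee// add0e => /eqP; rewrite mule_eq0 eqe gt_eqF//= => /eqP.
exact.
Qed.

(* Conditionally on the first regeneration k, block_from N is a function of the path
   restarted from nu; weighting by the stationary probability of regenerating at
   time 0 turns that law into a part of the stationary one. *)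
Lemma late_block_tail mu0 N (G : set R) : measurable G ->
  Pbar mu0 [set w | (exists2 k, (k < N)%N & sigma YS 0 w = Some k) /\
                    G (block_from m f XS YS N w)] <=
  (delta%:E * pi C)^-1 * Pbar pi (block_from m f XS YS 0 @^-1` G).
Proof.
move=> mG; have [th th0 hth] := regen_pos.
rewrite -(stationary_regeneration m0 mC rden r01 HS pi_inv 0) hth inver gt_eqF//.
set L := [set w | _].
have mBG k : measurable (block_from m f XS YS k @^-1` G).
  by rewrite -[X in measurable X]setTI; exact: mb.
have msig k := @measurable_sigma _ T m _ OmegaS XS YS mXS mYS 0 k.
have mL : measurable L.
  rewrite (_ : L = (\bigcup_(k in [set k | (k < N)%N]) [set w | sigma YS 0 w = Some k])
      `&` block_from m f XS YS N @^-1` G).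
    by apply: measurableI => //; apply: bigcup_measurable.
  by apply/seteqP; split => w [[k kN sk] Gw]; split => //; exists k.
rewrite (sigma_decomposition nu HS rec mu0 0 mL).
have [q q0 qE] : exists2 q : R, (0 <= q)%R & q%:E = (th^-1)%:E * Pbar pi (block_from m f XS YS 0 @^-1` G).
  exists (th^-1 * fine (Pbar pi (block_from m f XS YS 0 @^-1` G)))%R.
    by rewrite mulr_ge0 ?invr_ge0 ?(ltW th0)// fine_ge0.
  by rewrite EFinM fineK// fin_num_measure.
have step k : Pbar mu0 (L `&` [set w | sigma YS 0 w = Some k]) <=
    q%:E * Pbar mu0 (setT `&` [set w | sigma YS 0 w = Some k]).
  rewrite setTI; have [kN|kN] := ltnP k N; last first.
    rewrite (_ : L `&` _ = set0) ?measure0; first by rewrite mule_ge0 ?lee_fin.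
    apply/seteqP; split => // w [[[l lN /= sl] _] /= sk].
    by move: sk lN; rewrite sl => -[->]; rewrite ltnNge kN.
  pose sh (v : pathT T) : pathT T :=
    path_from m (fun i (v : pathT T) => (v i).1) (fun i v => (v i).2) (N - k.+1) v.
  have msh : measurable_fun setT sh.
    by apply: measurable_fun_path => i; [exact: measurable_pathX|exact: measurable_pathY].
  pose Gk : set (pathT T) := sh @^-1` (path_block m f @^-1` G).
  have mGk : measurable Gk.
    rewrite -[X in measurable X]setTI; apply: msh => //.
    by rewrite -[X in measurable X]setTI; exact: measurable_path_block.
  have shE l w : sh (path_from m XS YS l w) = path_from m XS YS (l + (N - k.+1)) w.
    by apply/funext => i; rewrite /sh /path_from /= mulnDl !addnA.
  have HE : split_history m XS YS k [set w | count_before (YS ^~ w) k = 0%N].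
    exact: split_history_count.
  have := split_regeneration m0 mC (ltW delta0) rden r01 (HS mu0) (HS nu) HE mGk.
  rewrite -sigma_event => h.
  rewrite (_ : L `&` _ = [set w | sigma YS 0 w = Some k] `&` path_from m XS YS k.+1 @^-1` Gk).
    rewrite h muleC lee_wpmul2r// qE lee_pdivlMl//.
    rewrite -(hth 0%N).
    have := path_after_regeneration m0 mC delta0 rden r01 HS pi 0 mGk => h'.
    rewrite -h'.
    apply: (@le_trans _ _ (Pbar pi (block_from m f XS YS (1 + (N - k.+1)) @^-1` G))).
      apply: le_measure; rewrite ?inE//.
        apply: measurableI; rewrite -[X in measurable X]setTI; first exact: mYS.
        exact: (measurable_path_from (HS nu) 1).
      by move=> w [_]; rewrite /= /Gk /= shE.
    by rewrite stationary_block.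
  apply/seteqP; split => w.
    by move=> [[_ Gw] sk]; split => //; rewrite /= /Gk /= shE subnKC.
  by move=> [sk]; rewrite /= /Gk /= shE subnKC// => Gw; split => //; split => //; exists k.
apply: (@le_trans _ _ (\sum_(0 <= k <oo) (q%:E * Pbar mu0 (setT `&` [set w | sigma YS 0 w = Some k])))).
  by apply: lee_nneseries => // k _; exact: measure_ge0.
rewrite nneseriesZl//.
rewrite -(sigma_decomposition nu HS rec mu0 0 measurableT) probability_setT mule1.
by rewrite qE.
Qed.

End stationary_blocks.

(** * Maximal inequalities for independent sums *)

Section independent_sums.
Context d (O : measurableType d) (R : realType) (Pr : probability O R).
Variable xi : nat -> O -> R.
Hypothesis mxi : forall i, measurable_fun setT (xi i).
Context d0 (O0 : measurableType d0) (Pr0 : probability O0 R).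
Variable zeta : O0 -> R.
Hypothesis mzeta : measurable_fun setT zeta.

Definition past_generators k : set (set O) :=
  [set E | exists j B, [/\ (j < k)%N, measurable B & E = xi j @^-1` B]].

Hypothesis indep : forall k H B, <<s past_generators k >> H -> measurable B ->
  Pr (H `&` xi k @^-1` B) = Pr H * Pr0 (zeta @^-1` B).

Lemma past_measurable k : <<s past_generators k >> `<=` measurable.
Proof.
apply: smallest_sub; first exact: sigma_algebra_measurable.
by move=> _ [j [B [_ mB ->]]]; rewrite -[X in measurable X]setTI; exact: mxi.
Qed.

Lemma past_measurable_fun k (U : O -> \bar R) :
  measurable_fun setT (U : g_sigma_algebraType (past_generators k) -> \bar R) ->
  measurable_fun setT U.
Proof.
by move=> mU _ B mB; apply: (@past_measurable k); exact: mU.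
Qed.

Lemma integral_past_mul k (U : O -> \bar R) (g : R -> R) :
  (forall w, 0 <= U w) ->
  measurable_fun setT (U : g_sigma_algebraType (past_generators k) -> \bar R) ->
  (forall x, 0 <= g x)%R -> measurable_fun setT g ->
  \int[Pr0]_w (g (zeta w))%:E \is a fin_num ->
  \int[Pr]_w (U w * (g (xi k w))%:E) = \int[Pr]_w U w * \int[Pr0]_w (g (zeta w))%:E.
Proof.
move=> U0 mU g0 mg gfin; set c := \int[Pr0]_w (g (zeta w))%:E.
have c0 : 0 <= c by apply: integral_ge0 => w _; rewrite lee_fin.
have mgx : measurable_fun setT (fun w => (g (xi k w))%:E).
  by apply/measurable_EFinP; exact: measurableT_comp.
have gE0 x : 0 <= (g x)%:E by rewrite lee_fin.
have mP := @past_measurable_fun k.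
have mfg (f : O -> \bar R) :
    measurable_fun setT (f : g_sigma_algebraType (past_generators k) -> \bar R) ->
    measurable_fun setT (fun w => f w * (g (xi k w))%:E).
  by move=> mf; apply: emeasurable_funM => //; exact: mP.
have fg0 (f : O -> \bar R) : (forall w, 0 <= f w) -> forall w, 0 <= f w * (g (xi k w))%:E.
  by move=> f0 w; rewrite mule_ge0 ?lee_fin.
move: U U0 mU; apply: (@ge0_fun_ind _ (g_sigma_algebraType (past_generators k)) R
  (fun U => \int[Pr]_w (U w * (g (xi k w))%:E) = \int[Pr]_w U w * c)).
- move=> A mA; have mA' : measurable (A : set O) by exact: past_measurable mA.
  have h := @integral_eq_law _ _ _ _ _ R R Pr Pr0 A (xi k) zeta (Pr A) mA' (mxi k) mzeta
    (measure_ge0 _ _) (fin_num_measure Pr A mA') (fun B mB => indep mA mB) (EFin \o g) gE0.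
  have -> : \int[Pr]_w (\1_A w)%:E = Pr A by rewrite integral_indic// setIT.
  rewrite -h; last exact/measurable_EFinP.
  by rewrite integral_in_indic; apply: eq_integral => w _; rewrite muleC.
- move=> a f a0 f0 mf Qf.
  under eq_integral do rewrite -muleA.
  have h := ge0_integralZl Pr measurableT (mfg f mf) (fun w _ => fg0 f f0 w) (k := a%:E).
  rewrite h ?lee_fin// Qf.
  have h' := ge0_integralZl Pr measurableT (mP f mf) (fun w _ => f0 w) (k := a%:E).
  by rewrite h' ?lee_fin// muleA.
- move=> f h f0 mf h0 mh Qf Qh.
  transitivity (\int[Pr]_w (f w * (g (xi k w))%:E + h w * (g (xi k w))%:E)).
    by apply: eq_integral => w _; rewrite ge0_muleDl.
  have e1 := ge0_integralD Pr measurableT (fun w _ => fg0 f f0 w) (mfg f mf)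
    (fun w _ => fg0 h h0 w) (mfg h mh).
  have e2 := ge0_integralD Pr measurableT (fun w _ => f0 w) (mP f mf) (fun w _ => h0 w) (mP h mh).
  have i1 : 0 <= \int[Pr]_w f w by apply: integral_ge0.
  have i2 : 0 <= \int[Pr]_w h w by apply: integral_ge0.
  have -> : \int[Pr]_w (f w + h w) = \int[Pr]_w f w + \int[Pr]_w h w by exact: e2.
  by rewrite e1 Qf Qh [RHS](ge0_muleDl c i1 i2).
- move=> f f0 mf ndf Qf.
  have e1 := cvg_monotone_convergence (mu := Pr) measurableT (fun n => mfg _ (mf n))
    (fun n w _ => fg0 _ (f0 n) w)
    (fun w _ n1 n2 n12 => lee_wpmul2r (gE0 (xi k w)) (ndf w _ _ n12)).
  have e2 := cvg_monotone_convergence (mu := Pr) measurableT (fun n => mP _ (mf n))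
    (fun n w _ => f0 n w) (fun w _ => ndf w).
  have e3 := cvgeZr gfin e2.
  have -> : (fun w => limn (f ^~ w) * (g (xi k w))%:E) =
      (fun w => limn (fun n => f n w * (g (xi k w))%:E)).
    apply/funext => w; apply/esym/cvg_lim => //; apply: cvgeZr => //.
    exact: ereal_nondecreasing_is_cvgn (ndf w).
  have e4 : (fun n => \int[Pr]_w (f n w * (g (xi k w))%:E)) = (fun n => \int[Pr]_w f n w * c).
    by apply/funext => n; exact: Qf.
  by apply: (cvg_unique _ e1) => //; rewrite e4; exact: e3.
Qed.

Lemma measurable_past_comp k j (h : R -> R) : (j < k)%N -> measurable_fun setT h ->
  measurable_fun setT (fun w : g_sigma_algebraType (past_generators k) => h (xi j w)).
Proof.
move=> jk mh _ B mB; rewrite setTI; apply: sub_sigma_algebra.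
exists j, (h @^-1` B); split => //; rewrite -[X in measurable X]setTI; exact: mh.
Qed.

Section exponential_maximal_inequality.
Variables (h : R -> R) (kap v : R).
Hypothesis mh : measurable_fun setT h.
Hypothesis kap1 : (1 <= kap)%R.
Hypothesis hkap : \int[Pr0]_w (expR (h (zeta w)))%:E <= kap%:E.

Let S k w : R := (\sum_(i < k) h (xi i w))%R.

Let crossed k w := [exists j : 'I_k.+1, (v < S j w)%R].

(* The exponential supermartingale stopped at the first passage above [v], its
   value being lowered to [expR v] there. *)
Let W k w : R := if crossed k w then expR v else expR (S k w).

Let mS k j : (j <= k)%N ->
  measurable_fun setT (S j : g_sigma_algebraType (past_generators k) -> R).
Proof.
move=> jk; apply: measurable_sum => i.
by apply: measurable_past_comp => //; exact: leq_trans jk.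
Qed.

Let crossed_event k : measurable ([set w | crossed k w] : set (g_sigma_algebraType (past_generators k))).
Proof.
rewrite (_ : [set _ | _] = \bigcup_(j in [set j | (j <= k)%N])
    (S j : g_sigma_algebraType (past_generators k) -> R) @^-1` `]v, +oo[%classic).
  apply: bigcup_measurable => j /= jk; rewrite -[X in measurable X]setTI; exact: mS.
apply/seteqP; split => w /=.
  move=> /existsP[j vj]; exists (nat_of_ord j); first by rewrite /= -ltnS.
  by rewrite /= in_itv/= vj.
move=> [j /= jk]; rewrite in_itv/= andbT => vj; apply/existsP.
by exists (Ordinal (jk : (j < k.+1)%N)).
Qed.

Let mW k : measurable_fun setT (W k : g_sigma_algebraType (past_generators k) -> R).
Proof.
apply: measurable_fun_ifT => //.
  apply: (measurable_fun_bool true); rewrite setTI; exact: crossed_event.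
by apply: measurableT_comp => //; exact: mS.
Qed.

Let W_bound k : \int[Pr]_w (W k w)%:E <= (kap ^+ k)%:E.
Proof.
elim: k => [|k ih].
  rewrite expr0 (@le_trans _ _ (\int[Pr]_w 1))//; last first.
    by rewrite integral_cst// mul1e; exact: probability_le1.
  apply: ge0_le_integral => //.
  - by move=> w _; rewrite lee_fin /W; case: ifP => _; exact: expR_ge0.
  - by apply: (@past_measurable_fun 0 (EFin \o W 0%N)); apply/measurable_EFinP; exact: mW.
  - move=> w _; rewrite lee_fin /W; case: ifPn => [/existsP[j]|_].
      rewrite /S (ord1 j) big_ord0 => v0.
      by rewrite -(expR0 R) ler_expR ltW.
    by rewrite /S big_ord0 expR0.
pose A w : R := if crossed k w then expR v else 0%R.
pose U w : R := if crossed k w then 0%R else expR (S k w).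
have mcr : measurable_fun setT (crossed k : g_sigma_algebraType (past_generators k) -> bool).
  by apply: (measurable_fun_bool true); rewrite setTI; exact: crossed_event.
have mA : measurable_fun setT (EFin \o A).
  apply: (@past_measurable_fun k (EFin \o A)); apply/measurable_EFinP.
  exact: measurable_fun_ifT.
have mU' : measurable_fun setT ((EFin \o U) : g_sigma_algebraType (past_generators k) -> \bar R).
  apply/measurable_EFinP; apply: measurable_fun_ifT => //.
  by apply: measurableT_comp => //; exact: mS.
have mU : measurable_fun setT (EFin \o U) by exact: past_measurable_fun mU'.
have A0 w : (0 <= A w)%R by rewrite /A; case: ifP => // _; exact: expR_ge0.
have U0 w : (0 <= U w)%R by rewrite /U; case: ifP => // _; exact: expR_ge0.
have K0 : 0 <= \int[Pr0]_w (expR (h (zeta w)))%:E.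
  by apply: integral_ge0 => w _; rewrite lee_fin expR_ge0.
have Kfin : \int[Pr0]_w (expR (h (zeta w)))%:E \is a fin_num.
  by rewrite ge0_fin_numE// (le_lt_trans hkap)// ltry.
have mexp : measurable_fun setT (fun x => expR (h x)) by exact: measurableT_comp.
have mUe : measurable_fun setT (fun w => (U w)%:E * (expR (h (xi k w)))%:E).
  apply: emeasurable_funM => //; apply/measurable_EFinP.
  exact: (measurableT_comp mexp).
have UE := @integral_past_mul k (EFin \o U) (fun x => expR (h x)) U0 mU'
  (fun x => expR_ge0 _) mexp Kfin.
have WE : \int[Pr]_w (W k w)%:E = \int[Pr]_w (A w)%:E + \int[Pr]_w (U w)%:E.
  rewrite -(ge0_integralD Pr measurableT (fun w _ => A0 w : 0 <= (A w)%:E) mA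
    (fun w _ => U0 w : 0 <= (U w)%:E) mU).
  apply: eq_integral => w _; rewrite -EFinD /W /A /U.
  by case: ifP; rewrite ?addr0 ?add0r.
apply: (@le_trans _ _ (\int[Pr]_w ((A w)%:E + (U w)%:E * (expR (h (xi k w)))%:E))).
  apply: ge0_le_integral => //.
  - by move=> w _; rewrite lee_fin /W; case: ifP => _; exact: expR_ge0.
  - by apply: (@past_measurable_fun k.+1 (EFin \o W k.+1)); apply/measurable_EFinP; exact: mW.
  - by apply: emeasurable_funD.
  move=> w _; rewrite -EFinM -EFinD lee_fin /W /A /U.
  have [ck|nck] := boolP (crossed k w).
    have -> : crossed k.+1 w.
      move/existsP : ck => [j vj]; apply/existsP.
      by exists (widen_ord (leqnSn _) j).
    by rewrite mul0r addr0.
  rewrite add0r -expRD -[(S k w + _)%R]/(_ + h (xi k w))%R.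
  have SE : S k.+1 w = (S k w + h (xi k w))%R by rewrite /S big_ord_recr.
  rewrite -SE; case: ifPn => // /existsP[j vj].
  rewrite ler_expR ltW//; suff <- : j = k.+1 :> nat by [].
  apply/eqP; rewrite eqn_leq -ltnS ltn_ord /= ltnNge; apply: contra nck => jk.
  by apply/existsP; exists (Ordinal (jk : (j < k.+1)%N)).
have Ue0 w : 0 <= (U w)%:E * (expR (h (xi k w)))%:E by rewrite mule_ge0 ?lee_fin ?expR_ge0.
rewrite (ge0_integralD Pr measurableT (fun w _ => A0 w : 0 <= (A w)%:E) mA (fun w _ => Ue0 w) mUe).
rewrite UE exprS EFinM.
apply: (@le_trans _ _ (kap%:E * \int[Pr]_w (W k w)%:E)); last first.
  by rewrite lee_wpmul2l// lee_fin (le_trans ler01).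
have iA : 0 <= \int[Pr]_w (A w)%:E by apply: integral_ge0 => w _; rewrite lee_fin.
have iU : 0 <= \int[Pr]_w (U w)%:E by apply: integral_ge0 => w _; rewrite lee_fin.
rewrite WE (ge0_muleDr _ iA iU); apply: leeD; first by rewrite lee_pemull// lee_fin.
by rewrite muleC; exact: lee_wpmul2r.
Qed.

Lemma exponential_maximal_inequality n :
  Pr [set w | exists2 k, (k <= n)%N & (v < \sum_(i < k) h (xi i w))%R]
  <= (kap ^+ n * expR (- v))%:E.
Proof.
rewrite (_ : [set _ | _] = [set w | crossed n w]); last first.
  apply/seteqP; split => w /=.
    by move=> [k kn vk]; apply/existsP; exists (Ordinal (kn : (k < n.+1)%N)).
  by move=> /existsP[j vj]; exists (nat_of_ord j) => //; rewrite -ltnS.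
have mC : measurable [set w | crossed n w] by apply: (@past_measurable n); exact: crossed_event.
rewrite expRN EFinM lee_pdivlMr ?expR_gt0//.
apply: le_trans (W_bound n).
rewrite muleC; have -> : (expR v)%:E * Pr [set w | crossed n w] =
    \int[Pr]_w ((expR v)%:E * (\1_[set w | crossed n w] w)%:E).
  by rewrite -integral_in_indic integral_cst.
apply: ge0_le_integral => //.
- by apply: emeasurable_funM => //; apply/measurable_EFinP; exact: measurable_indic.
- by apply: (@past_measurable_fun n (EFin \o W n)); apply/measurable_EFinP; exact: mW.
move=> w _; rewrite -EFinM lee_fin indicE /W.
have [cr|ncr] := boolP (crossed n w); first by rewrite mem_set// mulr1.
by rewrite memNset ?mulr0 ?expR_ge0//; exact/negP.
Qed.

End exponential_maximal_inequality.

End independent_sums.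

Section real_inequalities.
Local Open Scope ring_scope.
Context {R : realType}.
Implicit Types x y z u v a L : R.

Lemma ge0_of_derive_ge0 (g dg : R -> R) :
  (forall x, is_derive x 1 g (dg x)) -> g 0 = 0 ->
  (forall x, 0 <= x -> 0 <= dg x) -> forall x, 0 <= x -> 0 <= g x.
Proof.
move=> gd g0 dg0 x x0; rewrite -g0.
have dg' y : derivable g y 1 by have [] := gd y.
apply: (@ger0_derive1_le_cc R g 0 x) => //; rewrite ?in_itv/= ?lexx ?x0//.
- move=> y; rewrite in_itv/= => /andP[y0 _].
  by rewrite derive1E derive_val dg0// ltW.
- apply: continuous_subspaceT => y; apply: differentiable_continuous.
  exact/derivable1_diffP.
Qed.

Lemma expRN_le_quadratic x : 0 <= x -> expR (- x) <= 1 - x + x ^+ 2 / 2.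
Proof.
move=> x0; rewrite -subr_ge0.
apply: (@ge0_of_derive_ge0 (fun y => 1 - y + y ^+ 2 / 2 - expR (- y))
  (fun y => - 1 + y + expR (- y))) => //.
- move=> y; apply: is_derive_eq.
  by rewrite /GRing.scale/=; field.
- by rewrite oppr0 expR0; ring.
- by move=> y _; have := expR_ge1Dx (- y); lra.
Qed.

(* Clearing the denominator in the case y = x of the Bernstein bound below. *)
Lemma expR_le_pade x : 0 <= x -> expR x * (6 - 2 * x) <= 6 + 4 * x + x ^+ 2.
Proof.
move=> x0; rewrite -subr_ge0.
apply: (@ge0_of_derive_ge0 (fun y => 6 + 4 * y + y ^+ 2 - expR y * (6 - 2 * y))
  (fun y => 4 + 2 * y - expR y * (4 - 2 * y))) => //.
- move=> y; apply: is_derive_eq.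
  by rewrite /GRing.scale/=; ring.
- by rewrite expR0; ring.
apply: (@ge0_of_derive_ge0 (fun y => 4 + 2 * y - expR y * (4 - 2 * y))
  (fun y => 2 - expR y * (2 - 2 * y))) => //.
- move=> y; apply: is_derive_eq.
  by rewrite /GRing.scale/=; ring.
- by rewrite expR0; ring.
move=> y y0; have h : expR y * (1 - y) <= 1.
  have := expR_ge1Dx (- y); rewrite expRN => h.
  by rewrite mulrC -ler_pdivlMr ?expR_gt0// mul1r.
by lra.
Qed.

Lemma expR_le_bernstein x y : `|x| <= y -> y < 3 ->
  expR x <= 1 + x + x ^+ 2 / (2 * (1 - y / 3)).
Proof.
move=> xy y3; have y0 : 0 <= y by exact: le_trans xy.
have d0 z : z < 3 -> 0 < 2 * (1 - z / 3) by lra.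
have [x0|x0] := leP 0 x.
  rewrite ger0_norm// in xy.
  apply: (@le_trans _ _ (1 + x + x ^+ 2 / (2 * (1 - x / 3)))); last first.
    rewrite lerD2l ler_wpM2l ?sqr_ge0// lef_pV2 ?posrE ?d0//; last exact: le_lt_trans y3.
    by lra.
  have x3 : 0 < 6 - 2 * x by lra.
  rewrite -(ler_pM2r x3); apply: le_trans (expR_le_pade x0) _.
  rewrite le_eqVlt; apply/orP; left; apply/eqP; field.
  by apply/eqP; lra.
have x0' : 0 <= - x by lra.
have := expRN_le_quadratic x0'; rewrite opprK sqrrN => h.
apply: (le_trans h); rewrite lerD2l ler_wpM2l ?sqr_ge0// lef_pV2 ?posrE ?d0//.
by lra.
Qed.

Lemma powRV x a : 0 <= x -> (x^-1) `^ a = (x `^ a)^-1.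
Proof. by move=> x0; rewrite -(@powR_inv1 _ x)// -powRrM mulN1r powRN. Qed.

Lemma powRD_le x y a : 0 <= x -> 0 <= y -> 0 < a <= 1 ->
  (x + y) `^ a <= x `^ a + y `^ a.
Proof.
move=> x0 y0 /andP[a0 a1].
have [xy0|xy0] := leP (x + y) 0.
  have -> : x = 0 by lra.
  have -> : y = 0 by lra.
  by rewrite addr0 powR0 ?gt_eqF// addr0.
have frac z : 0 <= z -> z <= x + y -> z / (x + y) * (x + y) `^ a <= z `^ a.
  move=> z0 zxy; have [->|z1] := eqVneq z 0.
    by rewrite !mul0r powR_ge0.
  have zp : 0 < z by rewrite lt_neqAle eq_sym z1.
  have -> : z `^ a = (z / (x + y)) `^ a * (x + y) `^ a.
    by rewrite -powRM ?divfK ?gt_eqF// ?divr_ge0// ltW.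
  rewrite ler_wpM2r ?powR_ge0// ger1_powR// divr_gt0//=.
  by rewrite ler_pdivrMr// mul1r.
have -> : (x + y) `^ a = x / (x + y) * (x + y) `^ a + y / (x + y) * (x + y) `^ a.
  by rewrite -mulrDl -mulrDl divff ?mul1r// gt_eqF.
by apply: lerD; apply: frac; rewrite ?lerDl ?lerDr.
Qed.

Lemma powR_sum_le (I : Type) (s : seq I) (F : I -> R) a : (forall i, 0 <= F i) ->
  0 < a <= 1 -> (\sum_(i <- s) F i) `^ a <= \sum_(i <- s) F i `^ a.
Proof.
move=> F0 a01; have /andP[a0 _] := a01; elim: s => [|i s ih].
  by rewrite !big_nil powR0// gt_eqF.
rewrite !big_cons (le_trans (powRD_le _ _ a01))// ?lerD2l// sumr_ge0//.
Qed.

Lemma le_expR_powR u a L : 0 <= u -> 0 < a <= 1 -> 1 <= L ->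
  3 * a ^- 2 * L <= u `^ a -> u <= expR (- L) * expR (u `^ a).
Proof.
move=> u0 /andP[a0 a1] L1 h; set v := u `^ a.
set s := a^-1; have s1 : 1 <= s by rewrite /s invf_ge1.
have h' : 3 * s ^+ 2 * L <= v by rewrite /s exprVn.
have s2 : 1 <= s ^+ 2 by rewrite expr_ge1// (le_trans ler01).
have s2L : s ^+ 2 <= s ^+ 2 * L by rewrite ler_peMr// (le_trans ler01).
have Ls2 : L <= s ^+ 2 * L by rewrite ler_peMl// (le_trans ler01).
have v0 : 0 < v by lra.
have uE : u = expR (s * ln v).
  rewrite /v ln_powR mulrA mulVf ?gt_eqF// mul1r lnK// posrE.
  rewrite lt_neqAle u0 andbT eq_sym; apply/eqP => uz; move: v0.
  by rewrite /v uz powR0 ?gt_eqF// ltxx.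
rewrite {1}uE -expRD ler_expR.
have lnv : ln v <= v / (3 * s) + s.
  have s3 : 0 < 3 * s by lra.
  have q0 : 0 < v / (3 * s) by rewrite divr_gt0.
  have l1 z : 0 < z -> ln z <= z - 1.
    by move=> z0; have := @le_ln1Dx R (z - 1); rewrite addrCA subrr addr0; apply; lra.
  have s0 : 0 < s by lra.
  have h3 : 0 < (3 : R) by lra.
  have -> : ln v = ln (v / (3 * s)) + (ln 3 + ln s).
    by rewrite -(@lnM _ 3 s) ?posrE// -lnM ?posrE// divfK// gt_eqF.
  by have := l1 _ q0; have := l1 s s0; have := l1 3 h3; lra.
have : s * ln v <= v / 3 + s ^+ 2.
  apply: (le_trans (ler_wpM2l _ lnv)); first lra.
  rewrite le_eqVlt; apply/orP; left; apply/eqP; field.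
  by apply/eqP; lra.
rewrite -/v; lra.
Qed.

Lemma ceil_half N : Num.ceil (N%:R / 2 : R)%R = (uphalf N)%:Z.
Proof.
have NE : N%:R = (odd N)%:R + 2 * N./2%:R :> R.
  by rewrite -{1}(odd_double_half N) natrD -muln2 natrM mulrC.
have UE : (uphalf N)%:R = (odd N)%:R + N./2%:R :> R by rewrite uphalf_half natrD.
apply: ceil_def; rewrite intrB -pmulrn UE NE.
by case: (odd N) => /=; apply/andP; split; lra.
Qed.

End real_inequalities.

Section bounded_exponential_moment.
Context d (O : measurableType d) (R : realType) (Pr : probability O R).

Lemma integrable_bounded (Y : O -> R) (B : R) : measurable_fun setT Y ->
  (forall w, (`|Y w| <= B)%R) -> Pr.-integrable setT (EFin \o Y).
Proof.
move=> mY YB; apply: (@le_integrable _ _ _ Pr setT measurableT _ (cst B%:E)).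
- exact/measurable_EFinP.
- by move=> w _; rewrite /= lee_fin (le_trans (YB w))// ler_norm.
- exact: finite_measure_integrable_cst.
Qed.

Lemma bounded_exp_moment (Y : O -> R) (B lam s2 : R) : measurable_fun setT Y ->
  (forall w, (`|Y w| <= B)%R) -> (0 <= lam)%R -> (lam * (2 * B) < 3)%R ->
  \int[Pr]_w (Y w ^+ 2)%:E <= s2%:E ->
  \int[Pr]_w (expR (lam * (Y w - fine (\int[Pr]_w (Y w)%:E))))%:E <=
  (expR (lam ^+ 2 * s2 / (2 * (1 - lam * (2 * B) / 3))))%:E.
Proof.
move=> mY YB lam0 lamB Y2; set tm := fine _.
have B0 : (0 <= B)%R by apply: (le_trans (normr_ge0 (Y point))).
have iY := integrable_bounded mY YB.
have mY2 : measurable_fun setT (fun w => Y w ^+ 2)%R by exact: measurable_funX.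
have iY2 : Pr.-integrable setT (EFin \o (fun w => Y w ^+ 2)%R).
  apply: (@integrable_bounded _ (B ^+ 2)) => // w.
  by rewrite normrX lerXn2r ?nnegrE.
have tmE : \int[Pr]_w (Y w)%:E = tm%:E.
  by rewrite fineK//; exact: (integrable_fin_num measurableT iY).
pose t2 := fine (\int[Pr]_w (Y w ^+ 2)%:E).
have t2E : \int[Pr]_w (Y w ^+ 2)%:E = t2%:E.
  by rewrite fineK//; exact: (integrable_fin_num measurableT iY2).
have tmB : (`|tm| <= B)%R.
  have : `|\int[Pr]_w (Y w)%:E| <= \int[Pr]_w B%:E.
    apply: (le_trans (le_abse_integral _ _ _)) => //; first exact/measurable_EFinP.
    apply: ge0_le_integral => //; first by apply: measurableT_comp => //; exact/measurable_EFinP.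
    by move=> w _; rewrite lee_fin.
  rewrite tmE integral_cst//=.
  have -> : B%:E * Pr setT = B%:E by rewrite -[RHS]mule1; congr (_ * _); exact: probability_setT.
  by rewrite lee_fin.
set K := ((2 * (1 - lam * (2 * B) / 3))^-1)%R.
have K0 : (0 <= K)%R by rewrite invr_ge0; lra.
pose A2 := (K * lam ^+ 2)%R.
pose A1 := (lam - 2 * (K * lam ^+ 2) * tm)%R.
pose A0 := (1 - lam * tm + K * lam ^+ 2 * tm ^+ 2)%R.
have YtmB w : (`|lam * (Y w - tm)| <= lam * (2 * B))%R.
  rewrite normrM (ger0_norm lam0) ler_wpM2l// (le_trans (ler_normB _ _))//.
  by have := YB w; have := tmB; lra.
have i0 : Pr.-integrable setT (fun=> A0%:E) by exact: finite_measure_integrable_cst.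
have i1 : Pr.-integrable setT (fun w => A1%:E * (Y w)%:E) by exact: integrableZl.
have i2 : Pr.-integrable setT (fun w => A2%:E * (Y w ^+ 2)%:E) by exact: integrableZl.
have i12 := integrableD measurableT i1 i2.
apply: (@le_trans _ _ (\int[Pr]_w (A0%:E + (A1%:E * (Y w)%:E + A2%:E * (Y w ^+ 2)%:E)))).
  apply: le_integral => //.
  - apply: (@integrable_bounded _ (expR (lam * (2 * B)))) => [|w].
      apply: measurableT_comp => //; apply: measurable_funM => //.
      exact: measurable_funB.
    by rewrite ger0_norm ?expR_ge0// ler_expR (le_trans (ler_norm _)).
  - exact: integrableD.
  move=> w _; rewrite -!EFinM -!EFinD lee_fin.
  apply: (le_trans (expR_le_bernstein (YtmB w) lamB)).
  rewrite -/K /A0 /A1 /A2 -/K le_eqVlt; apply/orP; left; apply/eqP; ring.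
have e1 := integralD measurableT i0 i12.
have e2 := integralD measurableT i1 i2.
have e3 := integralZl measurableT iY A1.
have e4 := integralZl measurableT iY2 A2.
have e5 : \int[Pr]_w A0%:E = A0%:E.
  rewrite integral_cst// -[RHS]mule1; congr (_ * _); exact: probability_setT.
rewrite [leLHS]e1 [X in _ + X]e2 [X in _ + (X + _)]e3 [X in _ + (_ + X)]e4 e5 tmE t2E.
rewrite -!EFinM -!EFinD lee_fin.
have t2s : (t2 <= s2)%R by rewrite -lee_fin -t2E.
apply: le_trans (expR_ge1Dx _).
rewrite /A0 /A1 /A2 -/K.
have h1 : (0 <= K * lam ^+ 2)%R by rewrite mulr_ge0// sqr_ge0.
have h2 : (0 <= K * lam ^+ 2 * tm ^+ 2)%R by rewrite mulr_ge0// sqr_ge0.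
have h3 : (K * lam ^+ 2 * t2 <= K * lam ^+ 2 * s2)%R by rewrite ler_wpM2l.
have e : (lam ^+ 2 * s2 / (2 * (1 - lam * (2 * B) / 3)) = K * lam ^+ 2 * s2)%R.
  by rewrite -/K; ring.
by rewrite e; lra.
Qed.

End bounded_exponential_moment.

Section maximal_bernstein.
Context d (O : measurableType d) (R : realType) (Pr : probability O R).
Variable xi : nat -> O -> R.
Hypothesis mxi : forall i, measurable_fun setT (xi i).
Context d0 (O0 : measurableType d0) (Pr0 : probability O0 R).
Variable zeta : O0 -> R.
Hypothesis mzeta : measurable_fun setT zeta.
Hypothesis indep : forall k H B, <<s past_generators xi k >> H -> measurable B ->
  Pr (H `&` xi k @^-1` B) = Pr H * Pr0 (zeta @^-1` B).
Variables (alpha c s2 L u : R) (n : nat).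
Hypothesis alpha01 : (0 < alpha <= 1)%R.
Hypothesis c0 : (0 < c)%R.
Hypothesis s20 : (0 < s2)%R.
Hypothesis L1 : (1 <= L)%R.
Hypothesis n0 : (0 < n)%N.
Hypothesis nL : (n%:R <= expR L)%R.
Hypothesis u0 : (0 < u)%R.
Hypothesis int_zeta : Pr0.-integrable setT (EFin \o zeta).
Hypothesis mean_zeta : \int[Pr0]_w (zeta w)%:E = 0.
Hypothesis var_zeta : \int[Pr0]_w (zeta w ^+ 2)%:E <= s2%:E.
Hypothesis exp_zeta : \int[Pr0]_w (expR (`|zeta w| `^ alpha / c `^ alpha))%:E <= 2%:E.

Let M : R := (c * (3 * alpha ^- 2 * L) `^ alpha^-1)%R.

Let trunc (x : R) : R := (if `|x| <= M then x else 0)%R.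

Let tm : R := fine (\int[Pr0]_w (trunc (zeta w))%:E).

Let alpha0 : (0 < alpha)%R. Proof. by case/andP: alpha01. Qed.

Let ca0 : (0 < c `^ alpha)%R. Proof. exact: powR_gt0. Qed.

Let B0 : (0 < 3 * alpha ^- 2 * L)%R.
Proof. by rewrite !mulr_gt0// ?invr_gt0 ?exprn_gt0// (lt_le_trans ltr01). Qed.

Let M0 : (0 < M)%R. Proof. by rewrite mulr_gt0// powR_gt0. Qed.

Let beyond (x : R) : (M < `|x|)%R -> (3 * alpha ^- 2 * L <= (`|x| / c) `^ alpha)%R.
Proof.
move=> Mx; have -> : (3 * alpha ^- 2 * L = (M / c) `^ alpha)%R.
  rewrite /M [(c * _)%R]mulrC mulfK ?gt_eqF// -powRrM mulVf ?gt_eqF//.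
  by rewrite powRr1// ltW.
apply: ge0_ler_powR; rewrite ?nnegrE ?divr_ge0 ?(ltW c0) ?(ltW M0) ?(ltW alpha0)//.
by rewrite ler_pM2r ?invr_gt0// ltW.
Qed.

Let divpow (x : R) : ((`|x| / c) `^ alpha = `|x| `^ alpha / c `^ alpha)%R.
Proof.
by rewrite powRM ?invr_ge0 ?(ltW c0)// powRV// ltW.
Qed.

Let mtrunc : measurable_fun setT trunc.
Proof.
apply: measurable_fun_ifT => //.
by apply: measurable_fun_ler => //; exact: measurableT_comp.
Qed.

Let trunc_le x : (`|trunc x| <= M)%R.
Proof. by rewrite /trunc; case: ifPn => // _; rewrite normr0 ltW. Qed.

Let mtz : measurable_fun setT (trunc \o zeta). Proof. exact: measurableT_comp. Qed.

Let int_trunc : Pr0.-integrable setT (EFin \o (trunc \o zeta)).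
Proof. by apply: (@integrable_bounded _ _ _ _ _ M) => // w; exact: trunc_le. Qed.

Let sum_tail (x : R) : (`|x - trunc x| <= c * expR (- L) * expR (`|x| `^ alpha / c `^ alpha))%R.
Proof.
rewrite /trunc; case: (leP (`|x|)%R M) => [_|Mx].
  by rewrite subrr normr0 !mulr_ge0 ?expR_ge0// ltW.
rewrite subr0 -mulrA -ler_pdivrMl// mulrC.
rewrite -divpow; apply: le_expR_powR => //; [by rewrite divr_ge0// ltW|exact: beyond].
Qed.

Let mexpz : measurable_fun setT (fun w => (expR (`|zeta w| `^ alpha / c `^ alpha))%:E).
Proof.
apply/measurable_EFinP; apply: measurableT_comp => //; apply: measurable_funM => //.
apply: (measurableT_comp (measurable_powR _)); exact: measurableT_comp.
Qed.

Let expz_ge0 w : 0 <= (expR (`|zeta w| `^ alpha / c `^ alpha))%:E.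
Proof. by rewrite lee_fin expR_ge0. Qed.

Let mtail : measurable_fun setT (fun x : R => `|x - trunc x|)%R.
Proof. by apply: measurableT_comp => //; exact: measurable_funB. Qed.

Let tm_small : (`|tm| <= 2 * c * expR (- L))%R.
Proof.
have tmE : \int[Pr0]_w (trunc (zeta w))%:E = tm%:E.
  by rewrite fineK//; exact: (integrable_fin_num measurableT int_trunc).
have iB := integrableB measurableT int_zeta int_trunc.
have eB := integralB measurableT int_zeta int_trunc.
have -> : (`|tm| = `|- tm|)%R by rewrite normrN.
rewrite -lee_fin.
have -> : (`|- tm|)%:E = `|\int[Pr0]_w ((EFin \o zeta) w - (EFin \o (trunc \o zeta)) w)|.
  by rewrite eB /= mean_zeta tmE sub0e.
apply: (le_trans (le_abse_integral _ _ _)) => //; first exact: measurable_int iB.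
apply: (@le_trans _ _ (\int[Pr0]_w ((c * expR (- L))%:E *
    (expR (`|zeta w| `^ alpha / c `^ alpha))%:E))).
  apply: ge0_le_integral => //.
  - by apply: measurableT_comp => //; exact: measurable_int iB.
  - exact: emeasurable_funM.
  by move=> w _; rewrite -EFinB /= lee_fin; exact: sum_tail.
have ce0 : (0 <= c * expR (- L))%R by rewrite mulr_ge0 ?expR_ge0// ltW.
rewrite (ge0_integralZl Pr0 measurableT mexpz (fun w _ => expz_ge0 w)) ?lee_fin//.
apply: (le_trans (lee_wpmul2l _ exp_zeta)); first by rewrite lee_fin.
by rewrite -EFinM lee_fin; lra.
Qed.

Let tail_exp : \int[Pr0]_w (expR (`|zeta w - trunc (zeta w)| `^ alpha / (2 * c `^ alpha)))%:E
  <= (1 + 2 * expR (- L))%:E.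
Proof.
have me : 0 <= (expR (- L))%:E by rewrite lee_fin expR_ge0.
have mee : measurable_fun setT
    (fun w => (expR (- L))%:E * (expR (`|zeta w| `^ alpha / c `^ alpha))%:E).
  exact: emeasurable_funM.
have ee0 w : 0 <= (expR (- L))%:E * (expR (`|zeta w| `^ alpha / c `^ alpha))%:E.
  by rewrite mule_ge0.
apply: (@le_trans _ _ (\int[Pr0]_w (1 + (expR (- L))%:E *
    (expR (`|zeta w| `^ alpha / c `^ alpha))%:E))).
  apply: ge0_le_integral => //.
  - apply/measurable_EFinP; apply: measurableT_comp => //; apply: measurable_funM => //.
    apply: (measurableT_comp (measurable_powR _)).
    exact: (measurableT_comp mtail mzeta).
  - exact: emeasurable_funD.
  move=> w _; rewrite -EFinM -EFinD lee_fin /trunc.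
  case: (leP (`|zeta w|)%R M) => [_|Mx].
    rewrite subrr normr0 powR0 ?gt_eqF// mul0r expR0 lerDl mulr_ge0// expR_ge0.
  rewrite subr0 -expRD.
  have := beyond Mx; rewrite divpow => h.
  rewrite (@le_trans _ _ (expR (- L + `|zeta w| `^ alpha / c `^ alpha)))//; last first.
    by rewrite lerDr.
  rewrite ler_expR invfM.
  set q := (`|zeta w| `^ alpha / c `^ alpha)%R in h *.
  have -> : (`|zeta w| `^ alpha * (2^-1 / c `^ alpha) = q / 2)%R by rewrite /q; ring.
  have h1 : (1 <= alpha ^- 2)%R.
    have /andP[_ a1] := alpha01.
    by rewrite invf_ge1 ?exprn_gt0// exprn_ile1// ltW.
  have h2 : (L <= alpha ^- 2 * L)%R by rewrite ler_peMl// (le_trans ler01).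
  have h3 : (3 * (alpha ^- 2 * L) <= q)%R by rewrite mulrA.
  have gen (a b e : R) : (1 <= e -> e <= b -> 3 * b <= a -> a / 2 <= - e + a)%R.
    by move=> ? ? ?; lra.
  exact: (gen _ _ _ L1 h2 h3).
have e := ge0_integralD Pr0 measurableT (fun w _ => lee01) (measurable_cst _) (fun w _ => ee0 w) mee.
rewrite [leLHS]e (ge0_integralZl Pr0 measurableT mexpz (fun w _ => expz_ge0 w))//.
rewrite EFinD; apply: leeD.
  by rewrite integral_cst// mul1e; exact: probability_le1.
by rewrite mulrC EFinM; exact: lee_wpmul2l.
Qed.

Let measurable_max (F : nat -> O -> R) (v : R) : (forall k, measurable_fun setT (F k)) ->
  measurable [set w | exists2 k, (k <= n)%N & (v < F k w)%R].
Proof.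
move=> mF; rewrite (_ : [set _ | _] = \bigcup_(k in [set k | (k <= n)%N]) F k @^-1` `]v, +oo[%classic).
  apply: bigcup_measurable => k _; rewrite -[X in measurable X]setTI; exact: mF.
apply/seteqP; split => w /=.
  by move=> [k kn vk]; exists k => //=; rewrite in_itv/= vk.
by move=> [k kn] /=; rewrite in_itv/= andbT; exists k.
Qed.

Let D : R := (n%:R * s2 + 2 * M * u / 3)%R.

Let D0 : (0 < D)%R.
Proof.
apply: addr_gt0; first by rewrite mulr_gt0// ltr0n.
by apply: divr_gt0 => //; apply: mulr_gt0 => //; apply: mulr_gt0.
Qed.

Let body_bound (sg : R) : (`|sg| = 1)%R ->
  Pr [set w | exists2 k, (k <= n)%N & (u < \sum_(i < k) sg * (trunc (xi i w) - tm))%R] <=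
  (expR (- (u ^+ 2 / (2 * D))))%:E.
Proof.
move=> sg1; pose lam := (u / D)%R.
have lam0 : (0 < lam)%R by rewrite divr_gt0.
have V0 : (0 < n%:R * s2)%R by rewrite mulr_gt0// ltr0n.
have lamM : (lam * (2 * M) < 3)%R.
  by rewrite /lam mulrAC ltr_pdivrMr// /D; lra.
pose Y w := (sg * trunc (zeta w))%R.
have mY : measurable_fun setT Y by apply: measurable_funM => //.
have YM w : (`|Y w| <= M)%R by rewrite normrM sg1 mul1r.
have sg2 : (sg ^+ 2 = 1)%R by rewrite -real_normK ?num_real// sg1 expr1n.
have Y2 : \int[Pr0]_w (Y w ^+ 2)%:E <= s2%:E.
  apply: le_trans var_zeta; apply: ge0_le_integral => //.
  - by move=> w _; rewrite lee_fin sqr_ge0.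
  - by apply/measurable_EFinP; exact: measurable_funX.
  - by apply/measurable_EFinP; exact: measurable_funX.
  move=> w _; rewrite lee_fin exprMn sg2 mul1r /trunc; case: ifP => // _.
  by rewrite expr0n/= sqr_ge0.
have mom := bounded_exp_moment mY YM (ltW lam0) lamM Y2.
have tmY : fine (\int[Pr0]_w (Y w)%:E) = (sg * tm)%R.
  have -> : \int[Pr0]_w (Y w)%:E = sg%:E * \int[Pr0]_w (trunc (zeta w))%:E.
    exact: (integralZl measurableT int_trunc).
  by rewrite fineM//; exact: (integrable_fin_num measurableT int_trunc).
rewrite tmY in mom.
pose h (x : R) := (lam * (sg * trunc x - sg * tm))%R.
have mh : measurable_fun setT h.
  by apply: measurable_funM => //; apply: measurable_funB => //; exact: measurable_funM.
have kap1 : (1 <= expR (lam ^+ 2 * s2 / (2 * (1 - lam * (2 * M) / 3))))%R.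
  have q0 : (0 <= 1 - lam * (2 * M) / 3)%R.
    by rewrite subr_ge0 ler_pdivrMr// mul1r ltW.
  rewrite -{1}(expR0 R) ler_expR.
  apply: divr_ge0; first by apply: mulr_ge0; [exact: sqr_ge0|exact: ltW].
  by apply: mulr_ge0.
have := exponential_maximal_inequality mxi mzeta indep (lam * u)%R mh kap1 mom n.
rewrite (_ : [set w | _] =
    [set w | exists2 k, (k <= n)%N & (u < \sum_(i < k) sg * (trunc (xi i w) - tm))%R]); last first.
  have e w k : (\sum_(i < k) h (xi i w) = lam * \sum_(i < k) sg * (trunc (xi i w) - tm))%R.
    by rewrite mulr_sumr; apply: eq_bigr => i _; rewrite /h -mulrBr.
  by apply/seteqP; split => w /= [k kn]; rewrite ?e ?ltr_pM2l// => uk; exists k;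
    rewrite ?e ?ltr_pM2l.
move=> hb; apply: (le_trans hb); rewrite lee_fin -expRM_natl -expRD ler_expR.
rewrite le_eqVlt; apply/orP; left; apply/eqP.
have gen1 (x y z : R) : (x + 2 * y * z / 3 != 0 ->
    1 - z / (x + 2 * y * z / 3) * (2 * y) / 3 = x / (x + 2 * y * z / 3))%R.
  by move=> xyz; field; move: xyz; apply: contra => /eqP e; apply/eqP; lra.
have gen2 (x y z w : R) : (x != 0 -> y != 0 -> w != 0 ->
    x * ((z / w) ^+ 2 * y / (2 * (x * y / w))) + - (z / w * z) = - (z ^+ 2 / (2 * w)))%R.
  by move=> x0 y0 w0; field; rewrite x0 y0 w0.
have Dn0 : (D != 0)%R by rewrite gt_eqF.
rewrite /lam [X in (2 * X)%R](gen1 _ _ _ Dn0); apply: gen2; rewrite ?gt_eqF ?ltr0n//.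
Qed.

Let tail_bound :
  Pr [set w | exists2 k, (k <= n)%N &
    (u < \sum_(i < k) `|xi i w - trunc (xi i w)| + 2 * c)%R] <=
  (expR 3 * expR (- (u `^ alpha / (2 * c `^ alpha))))%:E.
Proof.
pose h (x : R) := (`|x - trunc x| `^ alpha / (2 * c `^ alpha))%R.
have mh : measurable_fun setT h.
  by apply: measurable_funM => //; exact: (measurableT_comp (measurable_powR _)).
have kap1 : (1 <= 1 + 2 * expR (- L))%R by rewrite lerDl mulr_ge0// expR_ge0.
pose v := (u `^ alpha / (2 * c `^ alpha) - 1)%R.
have := exponential_maximal_inequality mxi mzeta indep v mh kap1 tail_exp n.
move=> hb; apply: (le_trans (le_trans _ hb)).
  apply: le_measure; rewrite ?inE.
  - apply: measurable_max => k; apply: measurable_funD => //; apply: measurable_sum => i.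
    exact: (measurableT_comp mtail).
  - by apply: measurable_max => k; apply: measurable_sum => i; exact: measurableT_comp.
  move=> w /= [k kn uk]; exists k => //; rewrite /v /h -mulr_suml.
  have S0 : (0 <= \sum_(i < k) `|xi i w - trunc (xi i w)|)%R by exact: sumr_ge0.
  have c2 : (0 <= 2 * c)%R by rewrite mulr_ge0// ltW.
  have u1 : (u `^ alpha < (\sum_(i < k) `|xi i w - trunc (xi i w)| + 2 * c) `^ alpha)%R.
    by apply: gt0_ltr_powR; rewrite ?nnegrE ?addr_ge0// ltW.
  have u2 := powRD_le S0 c2 alpha01.
  have u3 := powR_sum_le (index_enum 'I_k) (fun i => normr_ge0 (xi i w - trunc (xi i w))%R) alpha01.
  have u4 : ((2 * c) `^ alpha <= 2 * c `^ alpha)%R.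
    rewrite powRM ?(ltW c0)// ler_pM2r// ler1_powR ?ler1n//.
    by case/andP: alpha01.
  have c20 : (0 < 2 * c `^ alpha)%R by rewrite mulr_gt0.
  rewrite ltrBlDr -(ltr_pM2r c20) divfK ?gt_eqF// mulrDl divfK ?gt_eqF// mul1r.
  by apply: (lt_le_trans u1); apply: (le_trans u2); apply: lerD.
rewrite lee_fin.
have k1 : ((1 + 2 * expR (- L)) ^+ n <= expR 2)%R.
  apply: (@le_trans _ _ (expR (2 * expR (- L)) ^+ n)%R).
    by rewrite lerXn2r ?nnegrE ?expR_ge0 ?(le_trans ler01)// expR_ge1Dx.
  rewrite -expRM_natl ler_expR mulrCA -[leRHS]mulr1 ler_pM2l//.
  by rewrite expRN ler_pdivrMr ?expR_gt0// mul1r.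
apply: (le_trans (ler_wpM2r (expR_ge0 _) k1)).
rewrite -!expRD ler_expR /v; lra.
Qed.

Lemma maximal_bernstein :
  Pr [set w | exists2 k, (k <= n)%N & (2 * u < `|\sum_(i < k) xi i w|)%R] <=
  (2 * expR (- (u ^+ 2 / (2 * D))) + expR 8 * expR (- (u `^ alpha / (2 * c `^ alpha))))%:E.
Proof.
pose A sg := [set w | exists2 k, (k <= n)%N &
  (u < \sum_(i < k) sg * (trunc (xi i w) - tm))%R].
pose B := [set w | exists2 k, (k <= n)%N &
  (u < \sum_(i < k) `|xi i w - trunc (xi i w)| + 2 * c)%R].
have mA sg : measurable (A sg).
  apply: measurable_max => k; apply: measurable_sum => i; apply: measurable_funM => //.
  by apply: measurable_funB => //; exact: measurableT_comp.
have mB : measurable B.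
  apply: measurable_max => k; apply: measurable_funD => //; apply: measurable_sum => i.
  exact: (measurableT_comp mtail).
apply: (@le_trans _ _ (Pr (A 1%R `|` A (-1)%R `|` B))).
  apply: le_measure; rewrite ?inE.
  - apply: measurable_max => k; apply: measurableT_comp => //; exact: measurable_sum.
  - by apply: measurableU => //; exact: measurableU.
  move=> w /= [k kn uk].
  have [h1|h1] := ltP u (\sum_(i < k) (1 * (trunc (xi i w) - tm)))%R; first by left; left; exists k.
  have [h2|h2] := ltP u (\sum_(i < k) (-1 * (trunc (xi i w) - tm)))%R; first by left; right; exists k.
  right; exists k => //.
  have e1 : (\sum_(i < k) xi i w = \sum_(i < k) (1 * (trunc (xi i w) - tm)) +
      (\sum_(i < k) (xi i w - trunc (xi i w)) + k%:R * tm))%R.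
    have -> : (k%:R * tm = \sum_(i < k) tm)%R by rewrite sumr_const card_ord mulr_natl.
    by rewrite -!big_split; apply: eq_bigr => i _ /=; ring.
  have e2 : (\sum_(i < k) (-1 * (trunc (xi i w) - tm)) = - \sum_(i < k) (1 * (trunc (xi i w) - tm)))%R.
    by rewrite -sumrN; apply: eq_bigr => i _; rewrite mulN1r mul1r.
  have n1 : (`|\sum_(i < k) (1 * (trunc (xi i w) - tm))| <= u)%R.
    by rewrite ler_norml h1 andbT lerNl -e2.
  have n2 : (`|\sum_(i < k) (xi i w - trunc (xi i w))| <= \sum_(i < k) `|xi i w - trunc (xi i w)|)%R.
    exact: ler_norm_sum.
  have n3 : (`|k%:R * tm| <= 2 * c)%R.
    rewrite normrM normr_nat (@le_trans _ _ (expR L * (2 * c * expR (- L))))%R//.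
      by rewrite ler_pM// (le_trans _ nL)// ler_nat.
    by rewrite mulrCA -expRD subrr expR0 mulr1.
  rewrite e1 in uk.
  have := ler_normD (\sum_(i < k) (1 * (trunc (xi i w) - tm)))%R
    (\sum_(i < k) (xi i w - trunc (xi i w)) + k%:R * tm)%R.
  have := ler_normD (\sum_(i < k) (xi i w - trunc (xi i w)))%R (k%:R * tm)%R.
  by lra.
apply: (le_trans (measureU2 _ _ _)) => //; first exact: measurableU.
rewrite EFinD; apply: leeD.
  apply: (le_trans (measureU2 _ _ _)) => //.
  rewrite mulr2n mulrDl mul1r EFinD.
  by apply: leeD; apply: body_bound; rewrite ?normrN normr1.
apply: (le_trans tail_bound); rewrite lee_fin ler_wpM2r ?expR_ge0// ler_expR; lra.
Qed.

End maximal_bernstein.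

(** * Orlicz norms *)

Lemma measurable_expeR (R : realType) : measurable_fun setT (@expeR R).
Proof.
have eqE (y : \bar R) : measurable_fun setT (fun x : \bar R => x == y).
  apply: (measurable_fun_bool true); rewrite setTI.
  rewrite (_ : _ @^-1` _ = [set y]); first exact: emeasurable_set1.
  by apply/seteqP; split => x /=; [by move/eqP|by move=> ->; rewrite eqxx].
rewrite (_ : @expeR R = fun x => if x == +oo then +oo else
    if x == -oo then 0 else (expR (fine x))%:E); last first.
  by apply/funext => -[x| |].
apply: measurable_fun_ifT => //; apply: measurable_fun_ifT => //.
apply/measurable_EFinP; apply: measurableT_comp => //; exact: measurable_fine.
Qed.

Section orlicz.
Context d (O : measurableType d) (R : realType) (Pr : probability O R).
Variables (alpha : R) (alpha01 : (0 < alpha <= 1)%R).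

Let ltrDl1 (x : R) : (x < x + 1)%R. Proof. by rewrite ltrDl. Qed.

Let alpha0 : (0 < alpha)%R. Proof. by case/andP: alpha01. Qed.

Lemma expeR_orlicz (z c : R) : (0 < c)%R ->
  expeR ((`|z%:E| `^ alpha) / (c `^ alpha)%:E) = (expR (`|z| `^ alpha / c `^ alpha))%:E.
Proof. by move=> c0; rewrite abse_EFin poweR_EFin inver gt_eqF ?powR_gt0. Qed.

Lemma measurable_orlicz (Z : O -> \bar R) c : measurable_fun setT Z ->
  measurable_fun setT (fun w => expeR ((`|Z w| `^ alpha) / (c `^ alpha)%:E)).
Proof.
move=> mZ; apply: (measurableT_comp (@measurable_expeR R)).
apply: emeasurable_funM => //; apply: (measurableT_comp (measurable_poweR alpha)).
exact: measurableT_comp.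
Qed.

Lemma orlicz_mono (x y : \bar R) (c : R) : (0 < c)%R -> `|x| <= `|y| ->
  expeR ((`|x| `^ alpha) / (c `^ alpha)%:E) <= expeR ((`|y| `^ alpha) / (c `^ alpha)%:E).
Proof.
move=> c0 xy; rewrite lee_expeR lee_wpmul2r//.
  by rewrite inver gt_eqF ?powR_gt0// lee_fin invr_ge0 powR_ge0.
by apply: gt0_ler_poweR => //; rewrite ?in_itv/= ?leey ?abse_ge0// ltW.
Qed.

Lemma orlicz_markov (Z : O -> \bar R) (c t : R) : measurable_fun setT Z -> (0 < c)%R ->
  (0 <= t)%R ->
  \int[Pr]_w expeR ((`|Z w| `^ alpha) / (c `^ alpha)%:E) <= 2%:E ->
  Pr [set w | t%:E < `|Z w|] <= (2 * expR (- (t `^ alpha / c `^ alpha)))%:E.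
Proof.
move=> mZ c0 t0 Z2; set A := [set w | _].
have mA : measurable A.
  rewrite -[X in measurable X]setTI; apply: emeasurable_fun_o_infty => //.
  exact: measurableT_comp.
rewrite expRN EFinM lee_pdivlMr ?expR_gt0//; apply: le_trans Z2; rewrite muleC.
have -> : (expR (t `^ alpha / c `^ alpha))%:E * Pr A =
    \int[Pr]_w ((expR (t `^ alpha / c `^ alpha))%:E * (\1_A w)%:E).
  by rewrite -integral_in_indic integral_cst.
apply: ge0_le_integral => //.
- by apply: emeasurable_funM => //; apply/measurable_EFinP; exact: measurable_indic.
- exact: measurable_orlicz.
move=> w _; rewrite -EFinM indicE.
have [tZ|tZ] := pselect (A w); last by rewrite memNset ?mulr0 ?expeR_ge0.
rewrite mem_set// mulr1.
rewrite -[X in (expR (X `^ _ / _))%:E](ger0_norm t0) -expeR_orlicz//.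
by apply: orlicz_mono => //; rewrite abse_EFin ger0_norm// ltW.
Qed.

Lemma orlicz_admissible (Z : O -> \bar R) (a : R) : orlicz_norm Pr alpha Z = a%:E ->
  forall e, (a < e)%R -> exists c, [/\ (0 < c)%R, (c < e)%R &
    \int[Pr]_w expeR ((`|Z w| `^ alpha) / (c `^ alpha)%:E) <= 2%:E].
Proof.
move=> Za e ae; have : orlicz_norm Pr alpha Z < e%:E by rewrite Za lte_fin.
by move=> /ereal_inf_lt[_ [c [c0 cZ] <-]]; rewrite lte_fin => ce; exists c.
Qed.

Lemma orlicz_norm_ge0 (Z : O -> \bar R) (a : R) : orlicz_norm Pr alpha Z = a%:E -> (0 <= a)%R.
Proof.
move=> Za; rewrite leNgt; apply/negP => a0.
by have [c [c0 c0' _]] := orlicz_admissible Za a0; have := lt_trans c0 c0'; rewrite ltxx.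
Qed.

Lemma orlicz_tail_real (Z : O -> \bar R) (a t : R) : measurable_fun setT Z ->
  orlicz_norm Pr alpha Z = a%:E -> (0 < t)%R -> Pr [set w | t%:E < `|Z w|] != 0 ->
  (0 < a)%R /\ Pr [set w | t%:E < `|Z w|] <= (2 * expR (- (t `^ alpha / a `^ alpha)))%:E.
Proof.
move=> mZ Za t0 p0; set A := [set w | _].
have mA : measurable A.
  rewrite -[X in measurable X]setTI; apply: emeasurable_fun_o_infty => //.
  exact: measurableT_comp.
have pE : Pr A = (fine (Pr A))%:E by rewrite fineK// fin_num_measure.
set p := fine (Pr A) in pE; have pp : (0 < p)%R.
  by rewrite -lte_fin -pE lt_neqAle eq_sym p0 measure_ge0.
have ta0 : (0 < t `^ alpha)%R by exact: powR_gt0.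
have lower c : (0 < c)%R -> \int[Pr]_w expeR ((`|Z w| `^ alpha) / (c `^ alpha)%:E) <= 2%:E ->
    (t `^ alpha / c `^ alpha <= - ln (p / 2))%R.
  move=> c0 cZ; have := orlicz_markov mZ c0 (ltW t0) cZ; rewrite -/A pE lee_fin => h.
  rewrite lerNr -ler_expR lnK ?posrE ?divr_gt0//.
  by rewrite ler_pdivrMr// mulrC.
set l := (- ln (p / 2))%R in lower.
have lge c : (0 < c)%R -> \int[Pr]_w expeR ((`|Z w| `^ alpha) / (c `^ alpha)%:E) <= 2%:E ->
    (0 < l)%R /\ (t / l `^ alpha^-1 <= c)%R.
  move=> c0 cZ; have h := lower c c0 cZ.
  have l0 : (0 < l)%R by apply: lt_le_trans h; rewrite divr_gt0 ?powR_gt0.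
  split => //; rewrite ler_pdivrMr ?powR_gt0// mulrC -ler_pdivrMr//.
  have e x : (0 <= x)%R -> (x = (x `^ alpha) `^ alpha^-1)%R.
    by move=> x0; rewrite -powRrM divff ?gt_eqF// powRr1.
  rewrite (e (t / c)%R) ?divr_ge0 ?(ltW t0) ?(ltW c0)//.
  apply: ge0_ler_powR; rewrite ?nnegrE ?invr_ge0 ?powR_ge0 ?(ltW l0) ?(ltW alpha0)//.
  have -> : ((t / c) `^ alpha = t `^ alpha / c `^ alpha)%R.
    by rewrite powRM ?invr_ge0 ?(ltW t0) ?(ltW c0)// powRV// ltW.
  exact: h.
have [c1 [c10 _ c1Z]] := orlicz_admissible Za (ltrDl1 a).
have [l0 _] := lge _ c10 c1Z.
have lb0 : (0 < t / l `^ alpha^-1)%R by rewrite divr_gt0 ?powR_gt0.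
have lb : (t / l `^ alpha^-1 <= a)%R.
  rewrite -lee_fin -Za; apply/ereal_infP => _ [c [c0 cZ] <-]; rewrite lee_fin.
  by have [] := lge c c0 cZ.
have a0 : (0 < a)%R by exact: lt_le_trans lb.
split => //; rewrite pE lee_fin -ler_pdivrMl// mulrC -[leLHS]lnK ?posrE ?divr_gt0//.
rewrite ler_expR lerNr -/l.
have : ((t / l `^ alpha^-1) `^ alpha <= a `^ alpha)%R.
  by apply: ge0_ler_powR; rewrite ?nnegrE ?(ltW alpha0) ?(ltW lb0) ?(ltW a0).
have -> : ((t / l `^ alpha^-1) `^ alpha = t `^ alpha / l)%R.
  rewrite powRM ?invr_ge0 ?powR_ge0 ?(ltW t0)// powRV ?powR_ge0//.
  by rewrite -powRrM mulVf ?gt_eqF// powRr1// ltW.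
by rewrite !ler_pdivrMr ?powR_gt0// mulrC.
Qed.

Lemma orlicz_tail (Z : O -> \bar R) (a t : R) : measurable_fun setT Z ->
  orlicz_norm Pr alpha Z = a%:E -> (0 < t)%R ->
  Pr [set w | t%:E < `|Z w|] <= 2%:E * expeR (- ((t `^ alpha)%:E / (a `^ alpha)%:E)).
Proof.
move=> mZ Za t0; have [->|p0] := eqVneq (Pr [set w | t%:E < `|Z w|]) 0.
  by rewrite mule_ge0// expeR_ge0.
have [a0 h] := orlicz_tail_real mZ Za t0 p0.
by rewrite inver gt_eqF ?powR_gt0.
Qed.

Lemma orlicz_norm0 (Z : O -> \bar R) : measurable_fun setT Z ->
  orlicz_norm Pr alpha Z = 0 -> Pr [set w | 0 < `|Z w|] = 0.
Proof.
move=> mZ Z0; have mA t : measurable [set w | t%:E < `|Z w|].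
  rewrite -[X in measurable X]setTI; apply: emeasurable_fun_o_infty => //.
  exact: measurableT_comp.
have null t : (0 < t)%R -> Pr [set w | t%:E < `|Z w|] = 0.
  move=> t0; apply/eqP; apply: contraT => p0.
  by have [] := orlicz_tail_real mZ Z0 t0 p0; rewrite ltxx.
apply: measure_negligible; first exact: (mA 0%R).
rewrite (_ : [set w | 0 < `|Z w|] = \bigcup_k [set w | (k.+1%:R^-1)%:E < `|Z w|]).
  apply: negligible_bigcup => k; exists [set w | (k.+1%:R^-1)%:E < `|Z w|].
  by split => //; apply: null.
apply/seteqP; split => w /=; last by move=> [k _ /=]; apply: lt_trans; rewrite lte_fin.
move=> Zw; case Zr : `|Z w| Zw => [z| |]//.
  rewrite lte_fin => z0; exists (Num.bound z^-1) => //=; rewrite Zr lte_fin.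
  rewrite invf_plt ?posrE//.
  rewrite (lt_le_trans (archi_boundP _))// ?invr_ge0 ?(ltW z0)//.
  by rewrite ler_nat.
by move=> _; exists 0%N => //=; rewrite Zr ltry.
Qed.

Lemma orlicz_attained (z : O -> R) (c : R) : measurable_fun setT z ->
  orlicz_norm Pr alpha (EFin \o z) = c%:E -> (0 < c)%R ->
  \int[Pr]_w (expR (`|z w| `^ alpha / c `^ alpha))%:E <= 2%:E.
Proof.
move=> mz zc c0.
pose q w := (`|z w| `^ alpha / c `^ alpha)%R.
have q0 w : (0 <= q w)%R by rewrite divr_ge0 ?powR_ge0.
pose s k := (1 - k.+1%:R^-1 : R)%R.
have mq : measurable_fun setT q.
  apply: measurable_funM => //; apply: (measurableT_comp (measurable_powR _)).
  exact: measurableT_comp.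
have mg k : measurable_fun setT (fun w => (expR (q w * s k))%:E).
  by apply/measurable_EFinP; apply: measurableT_comp => //; exact: measurable_funM.
have nds w : {homo (fun k => (expR (q w * s k))%:E) : k l / (k <= l)%N >-> k <= l}.
  move=> k l kl; rewrite lee_fin ler_expR ler_wpM2l// lerD2l lerN2 lef_pV2 ?posrE//.
  by rewrite ler_nat.
have g2 k : \int[Pr]_w (expR (q w * s k))%:E <= 2%:E.
  case: k => [|k].
    rewrite (eq_integral (cst 1)); last by move=> w _; rewrite /s invr1 subrr mulr0 expR0.
    rewrite integral_cst// mul1e (le_trans (probability_le1 _ _))//.
    by rewrite lee_fin ler1n.
  have sk0 : (0 < s k.+1)%R by rewrite subr_gt0 invf_lt1// ltr1n.
  have sk1 : (s k.+1 < 1)%R by rewrite gtrBl invr_gt0.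
  have ska : (0 < s k.+1 `^ alpha^-1)%R by exact: powR_gt0.
  have cs : (c < c / s k.+1 `^ alpha^-1)%R.
    rewrite ltr_pdivlMr// -[ltRHS]mulr1 ltr_pM2l//.
    have e1 : (1 `^ alpha^-1 = 1 :> R)%R by rewrite powR1.
    by rewrite -[ltRHS]e1 gt0_ltr_powR ?invr_gt0 ?nnegrE ?(ltW sk0).
  have [c' [c'0 c's c'2]] := orlicz_admissible zc cs.
  apply: le_trans c'2; apply: ge0_le_integral => //.
    by apply: measurable_orlicz; exact/measurable_EFinP.
  move=> w _; rewrite /= expeR_orlicz// lee_fin ler_expR /q -mulrA ler_wpM2l ?powR_ge0//.
  rewrite mulrC -ler_pdivlMr ?invr_gt0 ?powR_gt0// invrK.
  rewrite mulrC ler_pdivlMr ?powR_gt0// mulrC.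
  have : (c' * s k.+1 `^ alpha^-1 <= c)%R by rewrite -ler_pdivlMr// ltW.
  move=> /(ge0_ler_powR (ltW alpha0)); rewrite !nnegrE (ltW c0) mulr_ge0 ?(ltW c'0) ?(ltW ska)//.
  move=> /(_ isT isT); rewrite powRM ?(ltW c'0) ?(ltW ska)// -powRrM mulVf ?gt_eqF//.
  by rewrite powRr1 ?(ltW sk0).
have lim w : limn (fun k => (expR (q w * s k))%:E) = (expR (q w))%:E.
  have c1 : expR (q w * s k) @[k --> \oo] --> expR (q w).
    apply: continuous_cvg; first exact: continuous_expR.
    rewrite -[X in _ --> X]mulr1; apply: cvgM; first exact: cvg_cst.
    rewrite -[X in _ --> X]subr0; apply: cvgB; first exact: cvg_cst.
    exact: cvg_harmonic.
  by apply/cvg_lim => //; apply: cvg_EFin; [near=> k|exact: c1].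
have := cvg_monotone_convergence (mu := Pr) measurableT mg
  (fun k w _ => expR_ge0 _ : 0 <= (expR (q w * s k))%:E) (fun w _ => nds w).
under [X in _ --> \int[_]_(w in _) X w]eq_fun do rewrite lim.
move=> cv; rewrite -(cvg_lim _ cv)//; apply: lime_le; first by apply/cvg_ex; eexists; exact: cv.
by near=> k; exact: g2.
Unshelve. all: by end_near. Qed.

Lemma orlicz_integrable (Z : O -> \bar R) (z : O -> R) (a : R) : measurable_fun setT Z ->
  measurable_fun setT z -> (forall w, `|z w|%:E <= Z w) ->
  orlicz_norm Pr alpha Z = a%:E -> Pr.-integrable setT (EFin \o z).
Proof.
move=> mZ mz zZ Za.
have [c [c0 _ cZ]] := orlicz_admissible Za (ltrDl1 a).
have cal0 : (0 < c `^ alpha)%R by exact: powR_gt0.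
pose U := ((3 * alpha ^- 2) `^ alpha^-1)%R.
have mE : measurable_fun setT (fun w => (expR (`|z w| `^ alpha / c `^ alpha))%:E).
  apply/measurable_EFinP; apply: measurableT_comp => //; apply: measurable_funM => //.
  apply: (measurableT_comp (measurable_powR _)); exact: measurableT_comp.
have E2 : \int[Pr]_w (expR (`|z w| `^ alpha / c `^ alpha))%:E <= 2%:E.
  apply: le_trans cZ; apply: ge0_le_integral => //; first exact: measurable_orlicz.
  move=> w _; rewrite -expeR_orlicz//; apply: orlicz_mono => //.
  by rewrite (le_trans (zZ w))// lee_abs.
have pt w : (`|z w| <= c * U + c * expR (`|z w| `^ alpha / c `^ alpha))%R.
  have zc0 : (0 <= `|z w| / c)%R by rewrite divr_ge0// ltW.
  have e : (`|z w| `^ alpha / c `^ alpha = (`|z w| / c) `^ alpha)%R.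
    by rewrite powRM ?invr_ge0 ?(ltW c0)// powRV// ltW.
  rewrite -mulrDr -ler_pdivrMl// mulrC e.
  have [h|h] := leP (3 * alpha ^- 2 * 1)%R ((`|z w| / c) `^ alpha)%R.
    have := le_expR_powR zc0 alpha01 (lexx 1) h.
    move=> /le_trans; apply; rewrite (@le_trans _ _ (expR ((`|z w| / c) `^ alpha)))//.
      by rewrite ler_piMl ?expR_ge0// -(expR0 R) ler_expR oppr_le0.
    by rewrite lerDr powR_ge0.
  apply: (@le_trans _ _ U); last by rewrite lerDl expR_ge0.
  have -> : (`|z w| / c = ((`|z w| / c) `^ alpha) `^ alpha^-1)%R.
    by rewrite -powRrM divff ?gt_eqF// powRr1.
  apply: ge0_ler_powR; rewrite ?nnegrE ?invr_ge0 ?powR_ge0 ?(ltW alpha0)//.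
    by rewrite mulr_ge0// invr_ge0 sqr_ge0.
  by rewrite mulr1 in h; exact: ltW.
have cU0 : (0 <= c * U)%R by rewrite mulr_ge0 ?powR_ge0// ltW.
apply/integrableP; split; first exact/measurable_EFinP.
apply: (@le_lt_trans _ _ (\int[Pr]_w ((c * U)%:E + c%:E * (expR (`|z w| `^ alpha / c `^ alpha))%:E))).
  apply: ge0_le_integral => //.
  - by apply: measurableT_comp => //; exact/measurable_EFinP.
  - by apply: emeasurable_funD => //; exact: emeasurable_funM.
  by move=> w _; rewrite -EFinM -EFinD /= lee_fin; exact: pt.
have Ege0 w : 0 <= (expR (`|z w| `^ alpha / c `^ alpha))%:E by rewrite lee_fin expR_ge0.
have cEge0 w : 0 <= c%:E * (expR (`|z w| `^ alpha / c `^ alpha))%:E.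
  by rewrite mule_ge0// lee_fin ltW.
have mcE : measurable_fun setT (fun w => c%:E * (expR (`|z w| `^ alpha / c `^ alpha))%:E).
  exact: emeasurable_funM.
have h := ge0_integralD Pr measurableT (fun w _ => cU0 : 0 <= (c * U)%:E) (measurable_cst _)
  (fun w _ => cEge0 w) mcE.
rewrite [X in X < _]h integral_cst//.
have h' := ge0_integralZl Pr measurableT mE (fun w _ => Ege0 w) (k := c%:E).
rewrite h'; last by rewrite lee_fin ltW.
apply: lte_add_pinfty.
  apply: lte_mul_pinfty; rewrite ?lee_fin//.
  exact: (le_lt_trans (probability_le1 _ measurableT) (ltry _)).
rewrite (@le_lt_trans _ _ (c%:E * 2%:E)) ?ltry//.
by rewrite lee_wpmul2l// lee_fin ltW.
Qed.

End orlicz.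

(** * The tail bound *)

Lemma sum_parity (V : zmodType) (F : nat -> V) K :
  (\sum_(0 <= i < K) F i = \sum_(i < uphalf K) F i.*2 + \sum_(i < K./2) F i.*2.+1)%R.
Proof.
elim: K => [|K ih]; first by rewrite big_geq// !big_ord0 addr0.
have FK : F K = F (odd K + K./2.*2)%N by rewrite odd_double_half.
rewrite big_nat_recr//= ih uphalf_half FK.
case: (odd K) => /=; rewrite ?add0n ?add1n.
  by rewrite -addrA; congr (_ + _)%R; rewrite big_ord_recr.
by rewrite [X in (_ = X + _)%R]big_ord_recr /= addrAC.
Qed.

Lemma sum_Zblock_skeleton d (T : measurableType d) (R : realType) (Omega : Type)
    m (f : T -> R) (X : nat -> Omega -> T) N w :
  (\sum_(i < N * m) f (X i w) = \sum_(0 <= j < N) \sum_(k < m) f (X (j * m + k)%N w))%R.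
Proof.
rewrite -(big_mkord xpredT (fun i => f (X i w))).
elim: N => [|N ih]; first by rewrite mul0n !big_geq.
rewrite big_nat_recr//= -ih mulSn addnC (big_cat_nat (n := (N * m)%N)) ?leq_addr//=.
congr (_ + _)%R; rewrite -{1}(add0n (N * m)%N) big_addn addKn big_mkord.
by apply: eq_bigr => k _; rewrite addnC.
Qed.

Lemma block_from0 d (T : measurableType d) (R : realType) m (f : T -> R)
    dO (Omega : measurableType dO) (X : nat -> Omega -> T) (Y : nat -> Omega -> bool) w :
  block_from m f X Y 0 w = first_block m f X Y w.
Proof.
rewrite /first_block /sigma /=; case e : next_one => [k|]; first by rewrite (block_fromE m f X e).
by rewrite (block_from_None m f X e).
Qed.

Lemma split_law_atom d (T : measurableType d) (R : realType) (C : set T) (delta : R)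
    (pi : probability T R) :
  split_law C delta pi (split_atom C) = delta%:E * pi C.
Proof.
rewrite /split_law (_ : [set x | split_atom C (x, true)] = C).
  rewrite (_ : [set x | split_atom C (x, false)] = set0).
    by rewrite setIid !set0I !measure0 mule0 !adde0.
  by apply/seteqP; split => x // [].
by apply/seteqP; split => [x []|x Cx].
Qed.

Section block_maximum.
Context d (T : measurableType d) (R : realType) (P : R.-pker T ~> T).
Variables (m : nat) (C : set T) (delta : R) (nu : probability T R) (r : T -> T -> R).
Hypothesis m0 : (0 < m)%N.
Hypothesis mC : measurable C.
Hypothesis delta0 : (0 < delta)%R.
Hypothesis rden : minorization_density P m C delta nu r.
Hypothesis r01 : forall x y, (0 <= r x y <= 1)%R.
Context dS (OmegaS : measurableType dS).
Variables (XS : nat -> OmegaS -> T) (YS : nat -> OmegaS -> bool).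
Variable Pbar : probability T R -> probability OmegaS R.
Hypothesis HS : forall mu0, split_chain P m C delta r (Pbar mu0) mu0 XS YS.
Hypothesis rec : forall mu0 k, Pbar mu0 (path_from m XS YS k @^-1` @never_regenerates _ T) = 0.
Variable f : T -> R.
Hypothesis mf : measurable_fun setT f.
Variables (mu0 mu : probability T R) (alpha c s2 : R) (N : nat).
Hypothesis alpha01 : (0 < alpha <= 1)%R.
Hypothesis N0 : (0 < N)%N.

Let s := sblock m f XS YS.

Let mXS i : measurable_fun setT (XS i). Proof. by case: (HS nu). Qed.
Let mYS i : measurable_fun setT (YS i). Proof. by case: (HS nu). Qed.
Let ms i : measurable_fun setT (s i). Proof. exact: measurable_sblock. Qed.

Definition block_max (p : bool) (t : R) : set OmegaS :=
  [set w | exists2 k, (k <= uphalf N)%N & (t / 2 < `|\sum_(i < k) s (p + i.*2) w|)%R].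

Lemma measurable_block_max p t : measurable (block_max p t).
Proof.
rewrite (_ : block_max p t = \bigcup_(k in [set k | (k <= uphalf N)%N])
    (fun w => `|\sum_(i < k) s (p + i.*2) w|)%R @^-1` `](t / 2)%R, +oo[%classic).
  apply: bigcup_measurable => k _; rewrite -[X in measurable X]setTI.
  apply: measurableT_comp => //; exact: measurable_sum.
apply/seteqP; split => w /=.
  by move=> [k kn vk]; exists k => //=; rewrite in_itv/= vk.
by move=> [k kn] /=; rewrite in_itv/= andbT; exists k.
Qed.

Lemma block_max_null p t : (0 <= t)%R -> Pbar mu [set w | s 0 w != 0%R] = 0 ->
  Pbar mu0 (block_max p t) = 0.
Proof.
move=> t0 s0; have mB : measurable ([set x | x != 0] : set R)%R.
  rewrite (_ : [set _ | _] = ~` [set 0%R]); first exact: measurableC.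
  by apply/seteqP; split => x /=; [move/eqP|move/eqP].
have null i : Pbar mu0 [set w | s i w != 0%R] = 0.
  have h1 := sblock_law m0 mC delta0 rden r01 HS rec mf mu0 i mB.
  have h2 := sblock_law m0 mC delta0 rden r01 HS rec mf mu 0 mB.
  by apply: (etrans h1); rewrite -h2.
apply: measure_negligible; first exact: measurable_block_max.
apply: (@negligibleS _ _ _ _ (\bigcup_i [set w | s i w != 0%R])).
  move=> w [k _ tk]; apply: contrapT => nex; move: tk; rewrite big1.
    by rewrite normr0 ltNge divr_ge0.
  move=> i _; apply/eqP; apply: contraT => si; case: nex.
  by exists (p + i.*2)%N.
apply: negligible_bigcup => i; exists [set w | s i w != 0%R].
split; [|exact: null|by []].
rewrite -[X in measurable X]setTI; exact: (ms i measurableT mB).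
Qed.

Hypothesis c0 : (0 < c)%R.
Hypothesis s20 : (0 < s2)%R.
Hypothesis int_s : (Pbar mu).-integrable setT (EFin \o s 0).
Hypothesis mean_s : \int[Pbar mu]_w (s 0 w)%:E = 0.
Hypothesis var_s : \int[Pbar mu]_w (s 0 w ^+ 2)%:E <= s2%:E.
Hypothesis exp_s : \int[Pbar mu]_w (expR (`|s 0 w| `^ alpha / c `^ alpha))%:E <= 2%:E.

Lemma block_max_bound p t : (0 < t)%R ->
  Pbar mu0 (block_max p t) <=
  (2 * expR (- (t ^+ 2 / (32 * ((uphalf N)%:R * s2 +
     c * (3 * alpha ^- 2 * ln (Num.max N%:R (expR 1))) `^ alpha^-1 * t / 6)))) +
   expR 8 * expR (- (t `^ alpha / (2 * (4 * c) `^ alpha))))%:E.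
Proof.
move=> t0; pose xi i := s (p + i.*2)%N; pose L : R := ln (Num.max N%:R (expR 1)).
have maxe : (expR 1 <= Num.max N%:R (expR 1) :> R)%R by rewrite le_max lexx orbT.
have max0 : (0 < Num.max N%:R (expR 1) :> R)%R by exact: lt_le_trans (expR_gt0 1) maxe.
have L1 : (1 <= L)%R by rewrite -ler_expR lnK.
have nL : ((uphalf N)%:R <= expR L)%R.
  by rewrite lnK// le_max ler_nat leq_uphalf_double -addnn leq_addr.
have indep k H B : <<s past_generators xi k >> H -> measurable B ->
    Pbar mu0 (H `&` xi k @^-1` B) = Pbar mu0 H * Pbar mu (s 0 @^-1` B).
  move=> HH mB.
  have HP : sblock_past m f XS YS (p + k.*2) H.
    apply: sub_sigma_algebra2 HH => E [j [B' [jk mB' ->]]].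
    by exists (p + j.*2)%N, B'; split => //; rewrite -addnS ltn_add2l -doubleS leq_double.
  have h2 := sblock_law m0 mC delta0 rden r01 HS rec mf mu 0 mB.
  rewrite h2; exact: (sblock_independent m0 mC delta0 rden r01 HS rec mf mu0 HP mB).
have u0 : (0 < t / 4)%R by rewrite divr_gt0.
have n0 : (0 < uphalf N)%N by rewrite uphalf_gt0.
have := maximal_bernstein (fun i => ms _) (ms 0) indep alpha01 c0 s20 L1 n0 nL u0
  int_s mean_s var_s exp_s.
rewrite (_ : [set w | _] = block_max p t); last first.
  rewrite /block_max; have -> : (2 * (t / 4) = t / 2)%R by field.
  by [].
move=> h; apply: (le_trans h); rewrite lee_fin -/L.
rewrite le_eqVlt; apply/orP; left; apply/eqP; congr (2 * expR (- _) + expR 8 * expR (- _))%R.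
  set M := (c * _)%R; have M0 : (0 <= M)%R by rewrite mulr_ge0 ?powR_ge0// ltW.
  have V0 : (0 < (uphalf N)%:R * s2)%R by rewrite mulr_gt0// ltr0n.
  have D0 : ((uphalf N)%:R * s2 + M * t / 6 != 0)%R.
    by rewrite gt_eqF// ltr_wpDr// divr_ge0// mulr_ge0// ltW.
  have gen (x y z : R) : (x + y * z / 6 != 0 ->
      (z / 4) ^+ 2 / (2 * (x + 2 * y * (z / 4) / 3)) = z ^+ 2 / (32 * (x + y * z / 6)))%R.
    move=> h0; have -> : (x + 2 * y * (z / 4) / 3 = x + y * z / 6)%R by field.
    by field; move: h0; apply: contra => /eqP e; apply/eqP; lra.
  exact: gen.
have -> : ((t / 4) `^ alpha = t `^ alpha / 4 `^ alpha)%R.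
  by rewrite powRM ?invr_ge0 ?(ltW t0)// powRV.
have -> : ((4 * c) `^ alpha = 4 `^ alpha * c `^ alpha)%R by rewrite powRM ?(ltW c0).
by field; rewrite !gt_eqF ?powR_gt0.
Qed.

End block_maximum.

Section tail_decomposition.
Context d (T : measurableType d) (R : realType) (P : R.-pker T ~> T).
Variables (m : nat) (C : set T) (delta : R) (nu : probability T R) (r : T -> T -> R).
Hypothesis m0 : (0 < m)%N.
Hypothesis mC : measurable C.
Hypothesis delta0 : (0 < delta)%R.
Hypothesis rden : minorization_density P m C delta nu r.
Hypothesis r01 : forall x y, (0 <= r x y <= 1)%R.
Context dS (OmegaS : measurableType dS).
Variables (XS : nat -> OmegaS -> T) (YS : nat -> OmegaS -> bool).
Variable Pbar : probability T R -> probability OmegaS R.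
Hypothesis HS : forall mu0, split_chain P m C delta r (Pbar mu0) mu0 XS YS.
Hypothesis rec : forall mu0 k, Pbar mu0 (path_from m XS YS k @^-1` @never_regenerates _ T) = 0.
Variable f : T -> R.
Hypothesis mf : measurable_fun setT f.
Variable pi : probability T R.
Hypothesis pi_inv : invariant_law P pi.
Hypothesis piC : 0 < pi C.

Let mXS i : measurable_fun setT (XS i). Proof. by case: (HS nu). Qed.
Let mYS i : measurable_fun setT (YS i). Proof. by case: (HS nu). Qed.

Lemma block_sum_cases w N t : ~ dies m XS YS w -> (0 <= t)%R ->
  (3 * t < `|\sum_(0 <= k < N) Zblock m f XS k w|)%R ->
  [\/ t%:E < `|abs_first_sum m f XS YS w|,
      block_max m XS YS f N false t w \/ block_max m XS YS f N true t w |
      (exists2 k, (k < N)%N & sigma YS 0 w = Some k) /\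
      (t < `|block_from m f XS YS N w|)%R].
Proof.
move=> dw t0 tS.
have first x : (t < x)%R -> x%:E <= abs_first_sum m f XS YS w -> t%:E < `|abs_first_sum m f XS YS w|.
  by move=> tx xA; rewrite (lt_le_trans _ (lee_abs _))// (lt_le_trans _ xA)// lte_fin.
have [k sk] := sigma_finite_survives 0 dw.
have [kN|Nk] := ltnP k N; last first.
  apply: Or31; apply: (first (`|\sum_(0 <= k < N) Zblock m f XS k w|)%R).
    by apply: le_lt_trans tS; lra.
  by apply: abs_first_sum_partial; rewrite sk (leq_trans Nk).
have [h0|h0] := ltP t `|first_block m f XS YS w|%R.
  by apply: Or31; apply: (first _ h0); exact: first_block_abs.
have [hN|hN] := ltP t `|block_from m f XS YS N w|%R.
  by apply: Or33; split => //; exists k.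
apply: Or32; move: tS; rewrite (sum_Zblock m f XS N (survives dw)) block_from0 sum_parity.
set K := count_before _ N; set a := first_block _ _ _ _ _; set b := block_from _ _ _ _ _ _.
move=> tS; have KN : (K <= N)%N by exact: count_before_leq.
have [he|he] := ltP (t / 2)%R `|\sum_(i < uphalf K) sblock m f XS YS i.*2 w|%R.
  left; exists (uphalf K) => //; rewrite !uphalf_half.
  by move: KN (odd_double_half K) (odd_double_half N); lia.
have [ho|ho] := ltP (t / 2)%R `|\sum_(i < K./2) sblock m f XS YS i.*2.+1 w|%R.
  right; exists K./2 => //; rewrite (leq_trans (half_leq KN))//.
  by rewrite uphalf_half leq_addl.
exfalso; move: tS; apply/negP; rewrite -leNgt.
rewrite (le_trans (ler_normD _ _))// (le_trans (lerD (ler_normB _ _) (ler_normD _ _)))//.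
by move: h0 hN he ho; rewrite -/a -/b; lra.
Qed.

Lemma block_sum_tail mu0 N t : (0 <= t)%R ->
  Pbar mu0 [set w | (3 * t < `|\sum_(0 <= k < N) Zblock m f XS k w|)%R] <=
  Pbar mu0 [set w | t%:E < `|abs_first_sum m f XS YS w|] +
  (delta%:E * pi C)^-1 * Pbar pi [set w | t%:E < `|abs_first_sum m f XS YS w|] +
  (Pbar mu0 (block_max m XS YS f N false t) + Pbar mu0 (block_max m XS YS f N true t)).
Proof.
move=> t0; set A := [set w | t%:E < _].
pose B p := block_max m XS YS f N p t.
pose G : set R := [set x | (t < `|x|)%R].
pose L := [set w | (exists2 k, (k < N)%N & sigma YS 0 w = Some k) /\
                    G (block_from m f XS YS N w)].
have mG : measurable G.
  rewrite -[X in measurable X]setTI (_ : G = (fun x : R => `|x|)%R @^-1` `]t, +oo[%classic).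
    exact: (@normr_measurable R setT measurableT).
  by apply/seteqP; split => x /=; rewrite in_itv/= andbT.
have mA : measurable A.
  rewrite -[X in measurable X]setTI; apply: emeasurable_fun_o_infty => //.
  by apply: measurableT_comp => //; exact: measurable_abs_first_sum.
have mB p : measurable (B p) by exact: (measurable_block_max nu HS mf).
have mbG k : measurable (block_from m f XS YS k @^-1` G).
  rewrite -[X in measurable X]setTI; exact: (measurable_block_from nu HS mf).
have mL : measurable L.
  rewrite (_ : L = (\bigcup_(k in [set k | (k < N)%N]) [set w | sigma YS 0 w = Some k])
      `&` block_from m f XS YS N @^-1` G).
    apply: measurableI => //; apply: bigcup_measurable => k _.
    exact: (measurable_sigma m mXS mYS).
  by apply/seteqP; split => w [[k kN sk] Gw]; split => //; exists k.
have mD : measurable (dies m XS YS) by exact: (measurable_dies nu HS).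
have mAL : measurable (A `|` L) by exact: measurableU.
have mBB : measurable (B false `|` B true) by exact: measurableU.
have mU : measurable (A `|` L `|` (B false `|` B true)) by exact: measurableU.
apply: (@le_trans _ _ (Pbar mu0 (A `|` L `|` (B false `|` B true) `|` dies m XS YS))).
  apply: le_measure; rewrite ?inE.
  - rewrite (_ : [set _ | _] = (fun w => \sum_(0 <= k < N) Zblock m f XS k w)%R @^-1`
        ((fun x : R => `|x|)%R @^-1` `](3 * t)%R, +oo[%classic)).
      rewrite -[X in measurable X]setTI.
      have mS : measurable_fun setT (fun w => \sum_(0 <= k < N) Zblock m f XS k w)%R.
        by apply: measurable_sum => k; exact: measurable_Zblock.
      apply: mS => //; rewrite -[X in measurable X]setTI; exact: (@normr_measurable R setT measurableT).
    by apply/seteqP; split => w /=; rewrite in_itv/= andbT.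
  - exact: measurableU.
  move=> w /= tS; have [dw|dw] := pselect (dies m XS YS w); first by right.
  by left; case: (block_sum_cases dw t0 tS) => [h|h|h];
    [left; left|right|left; right].
have D0 : Pbar mu0 (dies m XS YS) <= 0 by rewrite (dies_null nu HS rec).
apply: (le_trans (measureU2 _ _ _)) => //; rewrite -[leRHS]adde0; apply: leeD; last exact: D0.
apply: (le_trans (measureU2 _ _ _)) => //; apply: leeD; last exact: measureU2.
apply: (le_trans (measureU2 _ _ _)) => //; apply: leeD => //.
apply: (le_trans (late_block_tail m0 mC delta0 rden r01 HS rec mf pi_inv piC mu0 N mG)).
have thE : exists2 th : R, (0 < th)%R & delta%:E * pi C = th%:E.
  exists (delta * fine (pi C))%R.
    by rewrite mulr_gt0// fine_gt0// piC ltey_eq fin_num_measure.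
  by rewrite EFinM fineK// fin_num_measure.
have [th th0 ->] := thE.
rewrite inver gt_eqF// lee_wpmul2l ?lee_fin ?invr_ge0 ?(ltW th0)//.
apply: le_measure; rewrite ?inE// => w /= tw.
rewrite /A /= (lt_le_trans _ (lee_abs _))//.
rewrite block_from0 in tw; apply: lt_le_trans (first_block_abs m f XS YS w).
by rewrite lte_fin.
Qed.

End tail_decomposition.

Lemma chain_split_tail d (T : measurableType d) (R : realType) (f : T -> R) n (t : R) :
  measurable_fun setT f ->
  measurable ([set v | (t < `|\sum_(i < n) f (v i).1|)%R] : set (pathT T)).
Proof.
move=> mf; have mS : measurable_fun setT (fun v : pathT T => \sum_(i < n) f (v i).1)%R.
  by apply: measurable_sum => i; apply: measurableT_comp => //; exact: measurable_pathX.
have mN : measurable_fun setT (fun v : pathT T => `|\sum_(i < n) f (v i).1|)%R.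
  exact: measurableT_comp.
have h : measurable ((fun v : pathT T => `|\sum_(i < n) f (v i).1|)%R @^-1` `]t, +oo[%classic).
  by rewrite -[X in measurable X]setTI; exact: mN.
apply: (eq_ind _ measurable h).
by apply/seteqP; split => v /=; rewrite in_itv/= andbT.
Qed.

(* World: MathComp-Analysis.
   Px is the family of laws of the original chain; Pbar is the family of laws
   of the split chain, indexed by the initial law of its first coordinate.
   The law of s_0(f) does not depend on the initial law: the theorem is stated
   for an arbitrary initial law mu used to compute the parameters of s_0(f).
   In extended reals u / 0 = +oo for u > 0 and 0 / 0 = 0. *)
Theorem theorem7 (R : realType) (d : measure_display) (T : measurableType d)
  (P : R.-pker T ~> T) (pi : probability T R)
  (dO : measure_display) (Omega : measurableType dO)
  (X : nat -> Omega -> T) (Px : T -> probability Omega R)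
  (m : nat) (C : set T) (delta : R) (nu : probability T R) (r : T -> T -> R)
  (dS : measure_display) (OmegaS : measurableType dS)
  (XS : nat -> OmegaS -> T) (YS : nat -> OmegaS -> bool)
  (Pbar : probability T R -> probability OmegaS R)
  (n : nat) (x : T) (alpha : R) (f : T -> R)
  (mu : probability T R) (a b c : R) :
  countably_generated T ->
  (forall y, markov_chain P (Px y) (\d_y : probability T R) X) ->
  harris_ergodic P pi Px X ->
  (0 < m)%N -> measurable C -> 0 < pi C -> 0 < nu C ->
  (0 < delta <= 1)%R ->
  minorization P m C delta nu ->
  minorization_density P m C delta nu r ->
  (forall mu0, split_chain P m C delta r (Pbar mu0) mu0 XS YS) ->
  (0 < n)%N -> (m %| n)%N ->
  (0 < alpha <= 1)%R ->
  measurable_fun setT f ->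
  pi.-integrable setT (EFin \o f) -> \int[pi]_y (f y)%:E = 0 ->
  orlicz_norm (Pbar (\d_x : probability T R)) alpha (abs_first_sum m f XS YS)
    = a%:E ->
  orlicz_norm (Pbar pi) alpha (abs_first_sum m f XS YS) = b%:E ->
  orlicz_norm (Pbar mu) alpha (EFin \o sblock m f XS YS 0) = c%:E ->
  let M : R := (c * (3 * alpha ^- 2 *
                 ln (Num.max (n%:R / m%:R) (expR 1))) `^ (alpha^-1))%R in
  let varsigma2 : \bar R := 'E_(Pbar mu)[fun w => (sblock m f XS YS 0 w ^+ 2)%R] in
  let pi_theta : \bar R := split_law C delta pi (split_atom C) in
  forall t : R, (0 <= t)%R ->
  Px x [set w | (3 * t < `|\sum_(i < n) f (X i w)|)%R] <=
      2%:E * expeR (- ((t `^ alpha)%:E / (a `^ alpha)%:E))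
    + 2%:E * pi_theta^-1 * expeR (- ((t `^ alpha)%:E / (b `^ alpha)%:E))
    + (2 * expR 8)%:E
        * expeR (- ((t `^ alpha)%:E / (2 * (4 * c) `^ alpha)%:E))
    + 4%:E * expeR (- ((t ^+ 2)%:E /
        (32%:E * ((Num.ceil (n%:R / (2 * m%:R) : R))%:~R%:E * varsigma2
                  + (M * t / 6)%:E)))).
Proof.
move=> cgT HX [pi_inv pi_irr P_aper harris] m0 mC piC nuC /andP[delta0 delta1] Pmin rden0 HS0 n0
  mn alpha01 mf int_f mean_f norm_a norm_b norm_c M varsigma2 pi_theta t t0.
have HS mu0 := split_chain_density1 Pmin rden0 (HS0 mu0).
have rden := density1_minorization_density Pmin rden0.
have r01 := density1_ge0_le1 rden0.
have rec := split_recurrent m0 mC delta0 rden r01 HS pi_inv piC pi_irr P_aper HX harris.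
have mXS i : measurable_fun setT (XS i) by case: (HS nu).
have mYS i : measurable_fun setT (YS i) by case: (HS nu).
have alpha0 : (0 < alpha)%R by case/andP: alpha01.
have mabs : measurable_fun setT (abs_first_sum m f XS YS) by exact: measurable_abs_first_sum.
have ms : measurable_fun setT (sblock m f XS YS 0) by exact: measurable_sblock.
pose N := (n %/ m)%N; have nE : n = (N * m)%N by rewrite divnK.
have N0 : (0 < N)%N by rewrite divn_gt0// dvdn_leq.
have nmE : (n%:R / m%:R = N%:R :> R)%R by rewrite nE natrM mulfK// pnatr_eq0 -lt0n.
have ceilE : (Num.ceil (n%:R / (2 * m%:R) : R)%R)%:~R = (uphalf N)%:R :> R.
  have -> : (n%:R / (2 * m%:R) = N%:R / 2 :> R)%R by rewrite invfM mulrCA nmE mulrC.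
  by rewrite ceil_half -pmulrn.
pose G : set (pathT T) := [set v | (3 * t < `|\sum_(i < n) f (v i).1|)%R].
have mG : measurable G by exact: chain_split_tail.
have transfer := chain_split_law m0 mC rden r01 (HX x) (HS (\d_x : probability T R)) mG.
have -> : [set w | (3 * t < `|\sum_(i < n) f (X i w)|)%R] =
  [set w | G (fun i => (X i w, false))] by [].
rewrite transfer {transfer}.
have piE : pi_theta = delta%:E * pi C by exact: split_law_atom.
have pi_theta0 : 0 <= pi_theta^-1.
  by rewrite inve_ge0 piE mule_ge0// lee_fin ltW.
set Ea := expeR (- ((t `^ alpha)%:E / (a `^ alpha)%:E)).
set Eb := expeR (- ((t `^ alpha)%:E / (b `^ alpha)%:E)).
set Ec := expeR (- ((t `^ alpha)%:E / (2 * (4 * c) `^ alpha)%:E)).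
set Ed := expeR _.
have E0 y : 0 <= expeR y by exact: expeR_ge0.
have [Ta Tb Tc] : [/\ 0 <= 2%:E * Ea, 0 <= 2%:E * pi_theta^-1 * Eb & 0 <= (2 * expR 8)%:E * Ec].
  have e8 : 0 <= (2 * expR 8 : R)%:E by rewrite lee_fin mulr_ge0// expR_ge0.
  by split; apply: mule_ge0; rewrite ?mule_ge0 ?lee_fin//; exact: E0.
have Td : 0 <= 4%:E * Ed by apply: mule_ge0; [rewrite lee_fin|exact: E0].
have mSG : measurable [set w | G (fun i => (XS i w, false))].
  rewrite -[X in measurable X]setTI.
  by apply: (measurable_fun_path (V := fun w => (fun i => (XS i w, false)))).
have [tz|tn0] := eqVneq t 0%R.
  have Ea1 : Ea = 1 by rewrite /Ea tz powR0 ?gt_eqF// mul0e oppe0 expeR0.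
  rewrite -!addeA (@le_trans _ _ (2%:E * Ea))//; last by rewrite leeDl// !adde_ge0.
  by rewrite Ea1 mule1 (le_trans (probability_le1 _ mSG))// lee_fin ler1n.
have tp : (0 < t)%R by rewrite lt_neqAle eq_sym tn0.
have vE : varsigma2 = \int[Pbar mu]_w (sblock m f XS YS 0 w ^+ 2)%:E.
  by rewrite /varsigma2 unlock.
have v0 : 0 <= varsigma2.
  by rewrite vE integral_ge0// => w _; rewrite lee_fin sqr_ge0.
have up0 : (0 < (uphalf N)%:R :> R)%R by rewrite ltr0n uphalf_gt0.
have [vy|vny] := eqVneq varsigma2 +oo.
  have Ed1 : Ed = 1.
    rewrite /Ed vy ceilE gt0_muley ?lte_fin// addye// gt0_muley ?lte_fin//.
    by rewrite invey mule0 oppe0 expeR0.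
  rewrite (@le_trans _ _ (4%:E * Ed))//; last by rewrite leeDr// !adde_ge0.
  by rewrite Ed1 mule1 (le_trans (probability_le1 _ mSG))// lee_fin ler1n.
have [s2 s2E] : exists s2, varsigma2 = s2%:E.
  by exists (fine varsigma2); rewrite fineK// ge0_fin_numE// ltey.
have -> : [set w | G (fun i => (XS i w, false))] =
    [set w | (3 * t < `|\sum_(0 <= k < N) Zblock m f XS k w|)%R].
  have e w : (\sum_(i < n) f (XS i w) = \sum_(0 <= k < N) Zblock m f XS k w)%R.
    by rewrite -[RHS](sum_Zblock_skeleton m f XS N w) -nE.
  by apply/seteqP; split => w; rewrite /G /= e.
apply: (le_trans (block_sum_tail m0 mC delta0 rden r01 HS rec mf pi_inv piC _ N t0)).
rewrite -[leRHS]addeA; apply: leeD.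
  apply: leeD; first exact: orlicz_tail.
  rewrite -piE [X in _ <= X * _]muleC -muleA lee_wpmul2l//.
  exact: orlicz_tail.
have c0 : (0 <= c)%R by exact: orlicz_norm_ge0 norm_c.
have s20 : (0 <= s2)%R by rewrite -lee_fin -s2E.
have [null|nnull] := pselect (Pbar mu [set w | sblock m f XS YS 0 w != 0%R] = 0).
  rewrite !(block_max_null m0 mC delta0 rden r01 HS rec mf _ N _ t0 null) add0e.
  exact: adde_ge0.
have cp : (0 < c)%R.
  rewrite lt_neqAle c0 andbT; apply/eqP => cz; apply: nnull.
  have ms' : measurable_fun setT (EFin \o sblock m f XS YS 0) by exact/measurable_EFinP.
  have := orlicz_norm0 alpha01 ms' (etrans norm_c (congr1 EFin (esym cz))).
  rewrite (_ : [set w | _] = [set w | sblock m f XS YS 0 w != 0%R])//.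
  by apply/seteqP; split => w /=; rewrite lte_fin normr_gt0.
have sp : (0 < s2)%R.
  rewrite lt_neqAle s20 andbT; apply/eqP => sz; apply: nnull.
  have msq : measurable_fun setT (fun w => (sblock m f XS YS 0 w ^+ 2)%:E).
    by apply/measurable_EFinP; exact: measurable_funX.
  have : \int[Pbar mu]_w `|(sblock m f XS YS 0 w ^+ 2)%:E| = 0.
    rewrite (eq_integral (fun w => (sblock m f XS YS 0 w ^+ 2)%:E)); first by rewrite -vE s2E -sz.
    by move=> w _; rewrite gee0_abs// lee_fin sqr_ge0.
  move/(ae_eq_integral_abs (Pbar mu) measurableT msq) => ae0.
  apply: measure_negligible.
    have mB : measurable ([set y | y != 0] : set R)%R.
      rewrite (_ : [set _ | _] = ~` [set 0%R]); first exact: measurableC.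
      by apply/seteqP; split => y /=; [move/eqP|move/eqP].
    have h := ms measurableT _ mB; rewrite setTI in h; exact: h.
  apply: negligibleS ae0 => w /= sw /(_ Logic.I)[] /eqP.
  by rewrite sqrf_eq0; apply/negP.
have mb k : measurable_fun setT (block_from m f XS YS k) by exact: (measurable_block_from nu HS mf).
have ib : (Pbar pi).-integrable setT (EFin \o block_from m f XS YS 0).
  apply: (orlicz_integrable alpha01 mabs (mb 0%N) _ norm_b) => w.
  by rewrite block_from0; exact: first_block_abs.
have [inu mnu] := block_mean m0 mC delta0 rden r01 HS rec mf pi_inv piC int_f mean_f ib.
have [|i1 i2] := @integral_eq_law_signed _ _ _ _ _ _ R (Pbar mu) (Pbar nu) setT
   (sblock m f XS YS 0) (block_from m f XS YS 0) 1 measurableT ms (mb 0%N) ltr01 _ id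
   (@measurable_id _ _ _).
  move=> B mB; rewrite setTI mul1e.
  exact: (sblock_law m0 mC delta0 rden r01 HS rec mf mu 0 mB).
have int_s := i1.2 inu; have mean_s := i2 inu; rewrite mnu mule0 in mean_s.
have var_s : \int[Pbar mu]_w (sblock m f XS YS 0 w ^+ 2)%:E <= s2%:E by rewrite -vE s2E.
have exp_s := orlicz_attained alpha01 ms norm_c cp.
have bound p := block_max_bound m0 mC delta0 rden r01 HS rec mf (\d_x : probability T R)
  alpha01 N0 cp sp int_s mean_s var_s exp_s p tp.
apply: (le_trans (leeD (bound false) (bound true))).
have ca0 : (0 < 2 * (4 * c) `^ alpha)%R by rewrite mulr_gt0// powR_gt0// mulr_gt0.
have ME : M = (c * (3 * alpha ^- 2 * ln (Num.max N%:R (expR 1))) `^ alpha^-1)%R.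
  by rewrite /M nmE.
have D0 : (0 < 32 * ((uphalf N)%:R * s2 + M * t / 6))%R.
  rewrite mulr_gt0// ltr_wpDr ?mulr_gt0// divr_ge0// mulr_ge0//.
  by rewrite ME mulr_ge0// powR_ge0.
have EcE : Ec = (expR (- (t `^ alpha / (2 * (4 * c) `^ alpha))))%:E.
  by rewrite /Ec inver gt_eqF.
have EdE : Ed = (expR (- (t ^+ 2 / (32 * ((uphalf N)%:R * s2 + M * t / 6)))))%:E.
  rewrite /Ed s2E ceilE; have -> : 32%:E * ((uphalf N)%:R%:E * s2%:E + (M * t / 6)%:E) =
    (32 * ((uphalf N)%:R * s2 + M * t / 6))%:E by [].
  by rewrite inver gt_eqF.
rewrite EcE EdE ME -!EFinM -!EFinD lee_fin.
by rewrite le_eqVlt; apply/orP; left; apply/eqP; ring.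
Qed.
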